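(* The following statements hold. (1) Let $(G,\Sigma)$ be a twisted locally compact étale groupoid with locally compact Hausdorff unit space (the arrow space need not be Hausdorff). Both $C_r^*(G,\Sigma)$ and $B_r^*(G,\Sigma)$ have controlled propagation. (2) Let $H$ be an infinite-dimensional Hilbert space (not assumed separable) and let $J\subsetneq B(H)$ be a norm-closed two-sided ideal. Then $B(H)/J$ has uncontrolled propagation. Moreover, for every $C^*$-algebra $A$ with controlled propagation, every (not necessarily unital) $*$-homomorphism $B(H)/J\to A$ is zero. (3) Every von Neumann algebra with controlled propagation is finite.
   Context: Controlled propagation. For a set $I$ and $T\in B(\ell^2(I))$ write $T_{ij}=\langle T\delta_j,\delta_i\rangle$. For $m\ge1$, $S_m(I)$ is the set of $T\in B(\ell^2(I))$ whose matrix has at most $m$ nonzero entries in every row and in every column, and $S(I)=\overline{\bigcup_{m\ge1}S_m(I)}^{\|\cdot\|}$, a $C^*$-subalgebra of $B(\ell^2(I))$. A $C^*$-algebra $A$ has controlled propagation if for some set $I$ there is an injective $*$-homomorphism $\rho\colon A\to B(\ell^2(I))$ with $\rho(A)\subseteq S(I)$; otherwise it has uncontrolled propagation. Groupoids. A topological groupoid $G$ is a small category in which every arrow is invertible, with a topology making multiplication and inversion continuous. Its unit space is $G^{(0)}$; $s,r$ are source and range; $\alpha\beta$ is defined iff $s(\alpha)=r(\beta)$. $G$ is étale if $s\colon G\to G^{(0)}$ is a local homeomorphism. Twists. A twist over $G$ is a central extension of topological groupoids $G^{(0)}\times\mathbb T\xrightarrow{\iota}\Sigma\xrightarrow{p}G$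 such that $p$ is the identity on unit spaces and makes $\Sigma$ a locally trivial principal $\mathbb T$-bundle over $G$; $p^{-1}(G^{(0)})=\iota(G^{(0)}\times\mathbb T)$; and $\iota(r(\sigma),z)\sigma=\sigma\,\iota(s(\sigma),z)$. Write $z\sigma=\iota(r(\sigma),z)\sigma$. The Fell line bundle is $L=(\Sigma\times\mathbb C)/\mathbb T$ for $z\cdot(\sigma,a)=(z\sigma,\overline z a)$, with class $[\sigma,a]\in L_{p(\sigma)}$, norm $|a|$, product $[\sigma,a][\tau,b]=[\sigma\tau,ab]$ and involution $[\sigma,a]^*=[\sigma^{-1},\overline a]$. Algebras. If $G$ is Hausdorff, $C_c(G,L)$ is the space of compactly supported continuous sections of $L$; in general it is the linear span of continuous sections on open Hausdorff subsets whose supports are compact in those subsets, extended by zero. $B_c(G,L)$ is the space of bounded Borel sections of $L$ that vanish outside some compact subset of $G$. Both are $*$-algebras under $(f*g)(\gamma)=\sum_{\alpha\beta=\gamma}f(\alpha)g(\beta)$, $f^*(\gamma)=f(\gamma^{-1})^*$ (finite sums). For $u\in G^{(0)}$ put $G_u=s^{-1}(u)$, $\mathcal H_u=\bigoplus_{\gamma\in G_u}L_\gamma$ ($\ell^2$-sum) and $(\lambda_u(f)\xi)_\gamma=\sum_{\eta\in G_u}f(\gamma\eta^{-1})\xi_\eta$. With $\|f\|_r=\sup_u\|\lambda_u(f)\|$, $C_r^*(G,\Sigma)$ and $B_r^*(G,\Sigma)$ are the completions of $C_c(G,L)$ and $B_c(G,L)$ in $\|\cdot\|_r$. *)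

(* Defs.v *)
From HB Require Import structures.
From mathcomp Require Import all_boot all_order all_algebra.
From mathcomp Require Import all_classical all_reals all_analysis.
From mathcomp Require Import generic_quotient finmap complex.
From mathcomp Require Import ring lra.

Set Implicit Arguments.
Unset Strict Implicit.
Unset Printing Implicit Defensive.

Import Order.TTheory GRing.Theory Num.Theory.
Import numFieldNormedType.Exports.

Local Open Scope classical_set_scope.
Local Open Scope ring_scope.
Local Open Scope complex_scope.
Local Open Scope quotient_scope.
Local Obligation Tactic := idtac.

HB.instance Definition _ (R : realType) := NormedModule.copy R[i] R[i]^o.

(* The norm of a normed R[i]-module takes its values in R[i]; [rnorm] is the
   same norm with values in R. *)
Definition rnorm (R : realType) (V : normedModType R[i]) (x : V) : R :=
  complex.Re `|x|.

Section RealNorm.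
Variable R : realType.

Lemma Re_real_complex (z : R[i]) : 0 <= z -> z = (complex.Re z)%:C.
Proof. by case: z => a b; rewrite lecE /= => /andP[/eqP -> _]. Qed.

Variable V : normedModType R[i].
Implicit Types x y : V.

Lemma rnormE x : `|x| = (rnorm x)%:C.
Proof. exact: Re_real_complex. Qed.

Lemma rnorm_ge0 x : 0 <= rnorm x.
Proof. by have := normr_ge0 x; rewrite rnormE lecR. Qed.

Lemma rnorm0 : rnorm (0 : V) = 0.
Proof. by rewrite /rnorm normr0. Qed.

Lemma rnormD x y : rnorm (x + y) <= rnorm x + rnorm y.
Proof. by have := ler_normD x y; rewrite !rnormE -rmorphD lecR. Qed.

Lemma rnormN x : rnorm (- x) = rnorm x.
Proof. by rewrite /rnorm normrN. Qed.

Lemma rdistC x y : rnorm (x - y) = rnorm (y - x).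
Proof. by rewrite /rnorm distrC. Qed.

Lemma rnorm0_eq0 x : rnorm x = 0 -> x = 0.
Proof. by move=> x0; apply/eqP; rewrite -normr_eq0 rnormE x0. Qed.

End RealNorm.

Lemma rnormZ (R : realType) (V : normedModType R[i]) (a : R[i]) (x : V) :
  rnorm (a *: x) = rnorm a * rnorm x.
Proof. by rewrite /rnorm normrZ (rnormE a) (rnormE x) -rmorphM. Qed.

Lemma rnorm_Re (R : realType) (z : R[i]) : `|complex.Re z| <= rnorm z.
Proof. by have := normc_ge_Re z; rewrite rnormE lecR. Qed.

Lemma rnorm_real (R : realType) (r : R) : rnorm r%:C = `|r|.
Proof. by rewrite /rnorm normc_def /= expr0n addr0 sqrtr_sqr. Qed.

Lemma rnormJ (R : realType) (z : R[i]) : rnorm (Num.conj z) = rnorm z.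
Proof. by rewrite /rnorm norm_conjC. Qed.

(* Inner products are linear in the first variable. *)
HB.mixin Record CompleteNormedModule_isHilbert (C : numClosedFieldType) V
    & CompleteNormedModule C V := {
  inner : V -> V -> C ;
  inner_linearl : forall (a : C) (u v w : V),
    inner (a *: u + v) w = a * inner u w + inner v w ;
  inner_conj : forall u v : V, inner v u = Num.conj (inner u v) ;
  inner_norm : forall u : V, inner u u = `|u| ^+ 2
}.

#[short(type="hilbertType")]
HB.structure Definition Hilbert (C : numClosedFieldType) :=
  {V of CompleteNormedModule C V & CompleteNormedModule_isHilbert C V}.

HB.mixin Record CompleteNormedModule_isCStar (C : numClosedFieldType) A
    & CompleteNormedModule C A := {
  cmul : A -> A -> A ;
  cstar : A -> A ;
  cmulA : associative cmul ;
  cmul_linearl : forall (a : C) (x y z : A),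
    cmul (a *: x + y) z = a *: cmul x z + cmul y z ;
  cmul_linearr : forall (a : C) (x y z : A),
    cmul z (a *: x + y) = a *: cmul z x + cmul z y ;
  cstar_antilinear : forall (a : C) (x y : A),
    cstar (a *: x + y) = Num.conj a *: cstar x + cstar y ;
  cstarK : involutive cstar ;
  cstarM : forall x y : A, cstar (cmul x y) = cmul (cstar y) (cstar x) ;
  cnormM : forall x y : A, `|cmul x y| <= `|x| * `|y| ;
  cnorm_star : forall x : A, `|cmul (cstar x) x| = `|x| ^+ 2
}.

#[short(type="cstarAlgType")]
HB.structure Definition CStar (C : numClosedFieldType) :=
  {A of CompleteNormedModule C A & CompleteNormedModule_isCStar C A}.

Record bop (R : realType) (H : hilbertType R[i]) := Bop {
  bop_fun :> H -> H ;
  bop_linear : forall (a : R[i]) (x y : H),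
    bop_fun (a *: x + y) = a *: bop_fun x + bop_fun y ;
  bop_bounded : exists M : R, forall x : H, rnorm (bop_fun x) <= M * rnorm x
}.

Section BoundedOperators.
Variables (R : realType) (H : hilbertType R[i]).
Implicit Types (S T : bop H) (x y z : H).

Lemma bop_eq S T : (forall x, S x = T x) -> S = T.
Proof.
case: S T => [f fl fb] [g gl gb] /= fg.
have {}fg : f = g by apply/funext.
by subst g; rewrite (Prop_irrelevance fl gl) (Prop_irrelevance fb gb).
Qed.

HB.instance Definition _ := gen_eqMixin (bop H).
HB.instance Definition _ := gen_choiceMixin (bop H).

Lemma bopD T x y : T (x + y) = T x + T y.
Proof. by have := bop_linear T 1 x y; rewrite !scale1r. Qed.

Lemma bop0 T : T 0 = 0.
Proof. by have /esym/eqP := bopD T 0 0; rewrite addr0 -subr_eq0 addrK => /eqP. Qed.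

Lemma bopZ T a x : T (a *: x) = a *: T x.
Proof. by have := bop_linear T a x 0; rewrite !addr0 bop0 addr0. Qed.

Lemma bopN T x : T (- x) = - T x.
Proof. by rewrite -scaleN1r bopZ scaleN1r. Qed.

Lemma bopB T x y : T (x - y) = T x - T y.
Proof. by rewrite bopD bopN. Qed.

Program Definition bop_zero : bop H := @Bop R H (fun=> 0) _ _.
Next Obligation. by move=> a x y; rewrite scaler0 addr0. Qed.
Next Obligation. by exists 0 => x; rewrite rnorm0 mul0r. Qed.

Program Definition bop_add S T : bop H := @Bop R H (fun x => S x + T x) _ _.
Next Obligation.
by move=> S T a x y /=; rewrite !bop_linear scalerDr addrACA.
Qed.
Next Obligation.
move=> S T; have [M hM] := bop_bounded S; have [N hN] := bop_bounded T.
exists (M + N) => x /=; rewrite mulrDl (le_trans (rnormD _ _))//.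
exact: lerD.
Qed.

Program Definition bop_scale (c : R[i]) T : bop H :=
  @Bop R H (fun x => c *: T x) _ _.
Next Obligation.
by move=> c T a x y /=; rewrite bop_linear scalerDr !scalerA mulrC.
Qed.
Next Obligation.
move=> c T; have [M hM] := bop_bounded T; exists (rnorm c * M) => x /=.
by rewrite rnormZ -mulrA ler_wpM2l// rnorm_ge0.
Qed.

Lemma bop_addA : associative bop_add.
Proof. by move=> S T U; apply: bop_eq => x /=; rewrite addrA. Qed.
Lemma bop_addC : commutative bop_add.
Proof. by move=> S T; apply: bop_eq => x /=; rewrite addrC. Qed.
Lemma bop_add0 : left_id bop_zero bop_add.
Proof. by move=> S; apply: bop_eq => x /=; rewrite add0r. Qed.
Lemma bop_addN : left_inverse bop_zero (bop_scale (-1)) bop_add.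
Proof. by move=> S; apply: bop_eq => x /=; rewrite scaleN1r addNr. Qed.

HB.instance Definition _ :=
  GRing.isZmodule.Build (bop H) bop_addA bop_addC bop_add0 bop_addN.

Lemma bop_scaleA a b T : bop_scale a (bop_scale b T) = bop_scale (a * b) T.
Proof. by apply: bop_eq => x /=; rewrite scalerA. Qed.
Lemma bop_scale1 : left_id 1 bop_scale.
Proof. by move=> T; apply: bop_eq => x /=; rewrite scale1r. Qed.
Lemma bop_scaleDr : right_distributive bop_scale +%R.
Proof. by move=> a S T; apply: bop_eq => x /=; rewrite scalerDr. Qed.
Lemma bop_scaleDl T : {morph bop_scale^~ T : a b / a + b}.
Proof. by move=> a b; apply: bop_eq => x /=; rewrite scalerDl. Qed.

HB.instance Definition _ := GRing.Zmodule_isLmodule.Build R[i] (bop H)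
  bop_scaleA bop_scale1 bop_scaleDr bop_scaleDl.

Definition opnorm T : R :=
  inf [set M | 0 <= M /\ forall x, rnorm (T x) <= M * rnorm x].

Lemma opnorm_has_inf T :
  has_inf [set M | 0 <= M /\ forall x, rnorm (T x) <= M * rnorm x].
Proof.
split; last by exists 0 => M [].
have [M hM] := bop_bounded T; exists `|M|; split=> // x.
by rewrite (le_trans (hM x))// ler_wpM2r ?rnorm_ge0// ler_norm.
Qed.

Lemma opnorm_ge0 T : 0 <= opnorm T.
Proof. by apply: lb_le_inf; [case: (opnorm_has_inf T)|move=> M []]. Qed.

Lemma opnorm_le T M : 0 <= M -> (forall x, rnorm (T x) <= M * rnorm x) ->
  opnorm T <= M.
Proof. by move=> M0 hM; apply: ge_inf => //; case: (opnorm_has_inf T). Qed.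

Lemma opnormP T x : rnorm (T x) <= opnorm T * rnorm x.
Proof.
have [->|x0] := eqVneq x 0; first by rewrite bop0 !rnorm0 mulr0.
have nx : 0 < rnorm x.
  rewrite lt_def rnorm_ge0 andbT; apply/eqP => /rnorm0_eq0; exact/eqP.
rewrite -ler_pdivrMr//; apply: lb_le_inf; first by case: (opnorm_has_inf T).
by move=> M [_ hM]; rewrite ler_pdivrMr.
Qed.

Lemma opnormD S T : opnorm (S + T) <= opnorm S + opnorm T.
Proof.
apply: opnorm_le => [|x]; first by rewrite addr_ge0// opnorm_ge0.
by rewrite (le_trans (rnormD _ _))// mulrDl lerD// opnormP.
Qed.

Lemma opnormZ_le a T : opnorm (a *: T) <= rnorm a * opnorm T.
Proof.
apply: opnorm_le => [|x]; first by rewrite mulr_ge0// ?rnorm_ge0 ?opnorm_ge0.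
by rewrite rnormZ -mulrA ler_wpM2l ?rnorm_ge0 ?opnormP.
Qed.

Lemma opnormZ a T : opnorm (a *: T) = rnorm a * opnorm T.
Proof.
apply/eqP; rewrite eq_le opnormZ_le /=.
have [->|a0] := eqVneq a 0; first by rewrite rnorm0 mul0r opnorm_ge0.
have na : 0 < rnorm a.
  rewrite lt_def rnorm_ge0 andbT; apply/eqP => /rnorm0_eq0; exact/eqP.
have := opnormZ_le a^-1 (a *: T); rewrite scalerA mulVf// scale1r.
have -> : rnorm a^-1 = (rnorm a)^-1.
  apply: (mulIf (lt0r_neq0 na)); rewrite mulVf ?gt_eqF// -rnormZ.
  by rewrite /GRing.scale /= mulVf// /rnorm normr1.
by rewrite mulrC ler_pdivlMr// mulrC.
Qed.

Lemma opnorm0_eq0 T : opnorm T = 0 -> T = 0.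
Proof.
move=> T0; apply: bop_eq => x; apply: rnorm0_eq0; apply/eqP.
by rewrite eq_le rnorm_ge0 andbT (le_trans (opnormP T x))// T0 mul0r.
Qed.

Let bop_norm T : R[i] := (opnorm T)%:C.

Lemma bop_normD S T : bop_norm (S + T) <= bop_norm S + bop_norm T.
Proof. by rewrite /bop_norm -rmorphD lecR opnormD. Qed.
Lemma bop_normZ (a : R[i]) T : bop_norm (a *: T) = `|a| * bop_norm T.
Proof. by rewrite /bop_norm opnormZ rmorphM rnormE. Qed.
Lemma bop_norm0_eq0 T : bop_norm T = 0 -> T = 0.
Proof. by move=> /(congr1 (@complex.Re R))/= /opnorm0_eq0. Qed.

HB.instance Definition _ := Lmodule_isNormed.Build R[i] (bop H)
  bop_normD bop_normZ bop_norm0_eq0.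

Lemma bop_zeroE x : (0 : bop H) x = 0. Proof. by []. Qed.
Lemma bop_addE S T x : (S + T : bop H) x = S x + T x. Proof. by []. Qed.
Lemma bop_scaleE a T x : (a *: T : bop H) x = a *: T x. Proof. by []. Qed.
Lemma bop_subE S T x : (S - T : bop H) x = S x - T x.
Proof. by rewrite bop_addE; congr (_ + _); exact: scaleN1r. Qed.

Lemma bop_rnormE T : rnorm T = opnorm T. Proof. by []. Qed.

End BoundedOperators.

Section RealNormTopology.
Variables (R : realType).

Lemma rcvgP (V : normedModType R[i]) (F : set_system V) (x : V) : Filter F ->
  (F --> x <-> forall e : R, 0 < e -> F [set y | rnorm (x - y) < e]).
Proof.
move=> FF; split => [/cvgrPdist_lt Fx e e0|Fx].
  have := Fx e%:C; rewrite ltcR => /(_ e0); apply: filterS => y.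
  by rewrite rnormE ltcR.
apply/cvgrPdist_lt => e e0; have /Re_real_complex eE := ltW e0.
have := Fx (complex.Re e); rewrite -ltcR -eE => /(_ e0).
by apply: filterS => y /=; rewrite rnormE eE ltcR.
Qed.

Lemma rcauchyP (V : normedModType R[i]) (F : set_system V) : ProperFilter F ->
  (cauchy F <-> forall e : R, 0 < e -> exists x, F [set y | rnorm (x - y) < e]).
Proof.
move=> FF; split => [/cauchyP Fc e e0|Fc].
  have [|x Fx] := Fc e%:C; first by rewrite ltcR.
  by exists x; apply: filterS Fx => y; rewrite -ball_normE /= rnormE ltcR.
apply/cauchyP => e e0; have /Re_real_complex eE := ltW e0.
have [|x Fx] := Fc (complex.Re e); first by rewrite -ltcR -eE.
by exists x; apply: filterS Fx => y; rewrite -ball_normE /= rnormE eE ltcR.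
Qed.

End RealNormTopology.

Section BoundedOperatorsComplete.
Variables (R : realType) (H : hilbertType R[i]).

Lemma bop_complete (F : set_system (bop H)) :
  ProperFilter F -> cauchy F -> cvg F.
Proof.
move=> FF /rcauchyP Fc.
have ev (x : H) : cvg ((fun T : bop H => T x) @ F).
  apply: cauchy_cvg; apply/rcauchyP => e e0.
  have d0 : 0 < e / (rnorm x + 1) by rewrite divr_gt0// ltr_wpDl// rnorm_ge0.
  have [T0 FT] := Fc _ d0; exists (T0 x).
  suff: F [set T : bop H | rnorm (T0 x - T x) < e] by [].
  apply: filterS FT => T /= TT.
  have <- : (T0 - T : bop H) x = T0 x - T x := bop_subE T0 T x.
  rewrite (le_lt_trans (opnormP _ _))//.
  move: TT; rewrite bop_rnormE ltr_pdivlMr ?ltr_wpDl ?rnorm_ge0// => TT.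
  by rewrite (le_lt_trans _ TT)// ler_wpM2l ?opnorm_ge0// lerDl.
pose L x := lim ((fun T : bop H => T x) @ F).
have LP x e : 0 < e -> F [set T : bop H | rnorm (L x - T x) < e].
  by move=> e0; have /rcvgP := ev x; apply.
have Lb T0 e : F [set T : bop H | rnorm (T0 - T) < e] ->
    forall x, rnorm (L x - T0 x) <= e * rnorm x.
  move=> FT x; apply/ler_addgt0Pl => d d0.
  have [T [/= T1 T2]] := filter_ex (filterI FT (LP x d d0)).
  rewrite -(subrK (T x) (L x)) -addrA (le_trans (rnormD _ _))//.
  rewrite lerD ?(ltW T2)// rdistC.
  have <- : (T0 - T : bop H) x = T0 x - T x := bop_subE T0 T x.
  rewrite (le_trans (opnormP _ _))//.
  by rewrite ler_wpM2r ?rnorm_ge0// ltW.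
have Ll (a : R[i]) x y : L (a *: x + y) = a *: L x + L y.
  apply/cvg_lim => //.
  have -> : (fun T : bop H => T (a *: x + y)) =
            (fun T : bop H => a *: T x + T y).
    by apply/funext => T; rewrite bop_linear.
  by apply: cvgD; [apply: cvgZr|]; exact: ev.
have Lbd : exists M : R, forall x, rnorm (L x) <= M * rnorm x.
  have [T0 FT] := Fc 1 ltr01; exists (1 + opnorm T0) => x.
  rewrite -(subrK (T0 x) (L x)) (le_trans (rnormD _ _))// mulrDl.
  by rewrite lerD ?opnormP// (Lb _ _ FT).
pose LB := Bop Ll Lbd.
apply/cvg_ex; exists LB; apply/rcvgP => e e0.
have e20 : 0 < e / 2 by rewrite divr_gt0.
have [T0 FT] := Fc _ e20; apply: filterS (FT) => T /= TT.
rewrite -(subrK T0 LB) -addrA (le_lt_trans (rnormD _ _))// [ltRHS]splitr.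
rewrite ler_ltD// bop_rnormE opnorm_le// ?ltW// => x.
rewrite bop_subE; exact: Lb.
Qed.

HB.instance Definition _ := Uniform_isComplete.Build (bop H) bop_complete.

End BoundedOperatorsComplete.

Section HilbertSpace.
Variables (R : realType) (H : hilbertType R[i]).
Implicit Types (x y z u v w : H) (a : R[i]).
Local Notation Re := (@complex.Re R).
Local Notation Im := (@complex.Im R).

Lemma ReD (z w : R[i]) : Re (z + w) = Re z + Re w.
Proof. by case: z => ? ?; case: w. Qed.
Lemma ReN (z : R[i]) : Re (- z) = - Re z.
Proof. by case: z. Qed.
Lemma ReJ (z : R[i]) : Re (Num.conj z) = Re z.
Proof. by case: z. Qed.
Lemma Re_scale (r : R) (z : R[i]) : Re (r%:C * z) = r * Re z.
Proof. by case: z => p q /=; rewrite mul0r subr0. Qed.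
Lemma Re_im (z : R[i]) : Re ('i * z) = - Im z.
Proof. by case: z => p q /=; rewrite mul0r mul1r sub0r. Qed.
Lemma eq_ReIm (z w : R[i]) : Re z = Re w -> Im z = Im w -> z = w.
Proof. by case: z => ? ?; case: w => ? ? /= -> ->. Qed.
Lemma conj_real (r : R) : Num.conj (r%:C : R[i]) = r%:C.
Proof. exact: conjc_real. Qed.
Lemma mul_conj (z : R[i]) : Num.conj z * z = (rnorm z ^+ 2)%:C.
Proof. by rewrite mulrC -normCK rnormE rmorphXn. Qed.

Lemma innerDl u v w : inner (u + v) w = inner u w + inner v w.
Proof. by have := inner_linearl 1 u v w; rewrite scale1r mul1r. Qed.
Lemma inner0l w : inner 0 w = 0.
Proof.
by have /esym/eqP := innerDl 0 0 w; rewrite addr0 -subr_eq0 addrK => /eqP.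
Qed.
Lemma innerZl a u w : inner (a *: u) w = a * inner u w.
Proof. by have := inner_linearl a u 0 w; rewrite addr0 inner0l addr0. Qed.
Lemma innerNl u w : inner (- u) w = - inner u w.
Proof. by rewrite -scaleN1r innerZl mulN1r. Qed.
Lemma innerBl u v w : inner (u - v) w = inner u w - inner v w.
Proof. by rewrite innerDl innerNl. Qed.
Lemma innerDr u v w : inner w (u + v) = inner w u + inner w v.
Proof. by rewrite (inner_conj _ w) innerDl rmorphD (inner_conj u) (inner_conj v). Qed.
Lemma innerZr a u w : inner w (a *: u) = Num.conj a * inner w u.
Proof. by rewrite (inner_conj _ w) innerZl rmorphM (inner_conj u). Qed.
Lemma innerNr u w : inner w (- u) = - inner w u.
Proof. by rewrite (inner_conj _ w) innerNl rmorphN (inner_conj u). Qed.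
Lemma innerBr u v w : inner w (u - v) = inner w u - inner w v.
Proof. by rewrite innerDr innerNr. Qed.

Lemma inner_self u : inner u u = (rnorm u ^+ 2)%:C.
Proof. by rewrite inner_norm rnormE rmorphXn. Qed.

Lemma rnorm2E u : rnorm u ^+ 2 = Re (inner u u).
Proof. by rewrite inner_self. Qed.

Lemma rnorm2D u v :
  rnorm (u + v) ^+ 2 = rnorm u ^+ 2 + rnorm v ^+ 2 + 2 * Re (inner u v).
Proof.
rewrite !rnorm2E innerDl !innerDr !ReD (inner_conj u v) ReJ; ring.
Qed.

Lemma rnorm2Zr (r : R) u : rnorm (r%:C *: u) ^+ 2 = r ^+ 2 * rnorm u ^+ 2.
Proof. by rewrite rnormZ rnorm_real exprMn real_normK ?num_real. Qed.

Lemma parallelogram u v :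
  rnorm (u - v) ^+ 2 = 2 * rnorm u ^+ 2 + 2 * rnorm v ^+ 2 - rnorm (u + v) ^+ 2.
Proof. rewrite !rnorm2D innerNr ReN rnormN; ring. Qed.

Lemma cauchy_schwarz u v : rnorm (inner u v) <= rnorm u * rnorm v.
Proof.
have [->|v0] := eqVneq v 0.
  by rewrite inner_conj inner0l rmorph0 !rnorm0 mulr0.
have nv : 0 < rnorm v ^+ 2.
  rewrite exprn_gt0// lt_def rnorm_ge0 andbT; apply/eqP => /rnorm0_eq0.
  exact/eqP.
set n := rnorm (inner u v).
pose w := (rnorm v ^+ 2)%:C *: u + - (inner u v *: v).
have : 0 <= rnorm w ^+ 2 by rewrite exprn_ge0 ?rnorm_ge0.
rewrite /w rnorm2D rnorm2Zr rnormN innerNr innerZl innerZr.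
rewrite ReN Re_scale mul_conj /= rnormZ exprMn -/n => h.
have {h} : 0 <= rnorm v ^+ 2 * (rnorm v ^+ 2 * rnorm u ^+ 2 - n ^+ 2).
  by move: h; congr (_ <= _); ring.
rewrite pmulr_rge0// subr_ge0 -exprMn mulrC => h.
by rewrite -(@ler_pXn2r _ 2)// ?nnegrE ?mulr_ge0// ?rnorm_ge0.
Qed.

Lemma inner_inj u v : (forall x, inner x u = inner x v) -> u = v.
Proof.
move=> h; apply/eqP; rewrite -subr_eq0; apply/eqP/rnorm0_eq0/eqP.
by rewrite -sqrf_eq0 rnorm2E innerBr h subrr.
Qed.

Lemma riesz (f : H -> R[i]) (M : R) :
  (forall a x y, f (a *: x + y) = a * f x + f y) ->
  (forall x, rnorm (f x) <= M * rnorm x) ->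
  exists z, forall x, f x = inner x z.
Proof.
move=> fl fM.
have fD x y : f (x + y) = f x + f y by have := fl 1 x y; rewrite scale1r mul1r.
have f0 : f 0 = 0.
  by have /esym/eqP := fD 0 0; rewrite addr0 -subr_eq0 addrK => /eqP.
have fZ a x : f (a *: x) = a * f x.
  by have := fl a x 0; rewrite addr0 f0 addr0.
have fRe x : Re (f x) <= M * rnorm x.
  by rewrite (le_trans _ (fM x))// (le_trans (ler_norm _))// rnorm_Re.
pose phi z := rnorm z ^+ 2 - 2 * Re (f z).
have philb z : - M ^+ 2 <= phi z.
  rewrite -subr_ge0 /phi; have := sqr_ge0 (rnorm z - M); have := fRe z; nra.
have hinf : has_inf [set phi z | z in [set: H]].
  split; first by exists (phi 0), 0.
  by exists (- M ^+ 2) => _ [z _ <-].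
pose m := inf [set phi z | z in [set: H]].
have mlb z : m <= phi z by apply: ge_inf; [case: hinf|exists z].
have mlt e : 0 < e -> exists z, phi z < m + e.
  move=> e0; have [_ [z _ <-] pz] := inf_adherent e0 hinf; by exists z.
pose F : set_system H := filter_from [set e : R | 0 < e]
  (fun e => [set z | phi z < m + e]).
have FF : ProperFilter F.
  apply: filter_from_proper; last by move=> e /= /mlt [z ez]; exists z.
  apply: filter_from_filter; first by exists 1 => /=.
  move=> e d /= e0 d0; exists (Num.min e d); first by rewrite /= lt_min e0 d0.
  move=> z /= h; split; apply: (lt_le_trans h); rewrite lerD2l.
    by rewrite ge_min lexx.
  by rewrite ge_min lexx orbT.
have phi_close z w e : phi z < m + e -> phi w < m + e ->
    rnorm (z - w) ^+ 2 < 4 * e.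
  move=> hz hw.
  have := mlb ((2^-1)%:C *: (z + w)).
  rewrite /phi rnorm2Zr fZ Re_scale fD ReD => hm.
  rewrite parallelogram.
  move: hz hw hm; rewrite /phi exprVn => hz hw hm; lra.
have : cvg F.
  apply: cauchy_cvg; apply/rcauchyP => e e0.
  have d0 : 0 < e ^+ 2 / 4 by rewrite divr_gt0// exprn_gt0.
  have [z hz] := mlt _ d0; exists z; exists (e ^+ 2 / 4) => // w /= hw.
  rewrite -(@ltr_pXn2r _ 2)// ?nnegrE ?rnorm_ge0 ?(ltW e0)//.
  by rewrite (lt_le_trans (phi_close _ _ _ hz hw))// mulrC divfK.
move=> /cvg_ex [z0] /rcvgP Fz0.
have pz0 : phi z0 <= m.
  apply/ler_addgt0Pl => e e0.
  pose K := 2 * rnorm z0 + 1 + 2 * `|M|.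
  have K0 : 0 < K.
    rewrite /K; have := rnorm_ge0 z0; have := normr_ge0 M; lra.
  pose d := Num.min 1 (e / 2 / K).
  have d0 : 0 < d by rewrite lt_min ltr01 divr_gt0// divr_gt0.
  have d1 : d <= 1 by rewrite ge_min lexx.
  have dK : d * K <= e / 2 by rewrite -ler_pdivlMr// ge_min lexx orbT.
  have e20 : 0 < e / 2 by rewrite divr_gt0.
  have Fe : F [set w | phi w < m + e / 2] by exists (e / 2).
  have [w [/= hw zw]] := filter_ex (filterI Fe (Fz0 d d0)).
  have h1 : rnorm z0 <= rnorm w + d.
    rewrite -{1}(subrK w z0) (le_trans (rnormD _ _))//.
    by rewrite addrC lerD2l ltW.
  have h1' : rnorm w <= rnorm z0 + d.
    rewrite -{1}(subrK z0 w) (le_trans (rnormD _ _))//.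
    by rewrite addrC lerD2l rdistC ltW.
  have h2 : Re (f w) - Re (f z0) <= `|M| * d.
    rewrite -ReN -ReD -mulN1r -fZ scaleN1r -fD (le_trans (fRe _))//.
    rewrite (@le_trans _ _ (`|M| * rnorm (w - z0)))//.
      by rewrite ler_wpM2r ?rnorm_ge0 ?ler_norm.
    by rewrite ler_wpM2l// rdistC ltW.
  have := rnorm_ge0 z0; have := rnorm_ge0 w; move: hw h1 h1' h2 dK.
  rewrite /phi /K; move: (rnorm w) (rnorm z0) (Re (f w)) (Re (f z0)) `|M|.
  move=> p q s t MM hw h1 h1' h2 dK p0 q0.
  have : q ^+ 2 - p ^+ 2 <= d * (2 * q + 1).
    have -> : q ^+ 2 - p ^+ 2 = (q - p) * (q + p) by ring.
    rewrite (@le_trans _ _ (d * (q + p)))//.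
      by rewrite ler_wpM2r ?addr_ge0// lerBlDl.
    by rewrite ler_wpM2l ?(ltW d0)//; lra.
  lra.
have key x : Re (inner x z0) = Re (f x).
  have ht (t : R) :
      0 <= t ^+ 2 * rnorm x ^+ 2 + 2 * t * (Re (inner x z0) - Re (f x)).
    have := le_trans pz0 (mlb (z0 + t%:C *: x)).
    rewrite /phi rnorm2D rnorm2Zr innerZr fD fZ ReD conj_real !Re_scale.
    rewrite (inner_conj x z0) ReJ; lra.
  apply/eqP; rewrite -subr_eq0; set c := _ - _ in ht *; apply/eqP.
  pose N := rnorm x ^+ 2 + 1.
  have N0 : 0 < N by rewrite ltr_wpDl// exprn_ge0// rnorm_ge0.
  have := ht (- c / N).
  have -> : (- c / N) ^+ 2 * rnorm x ^+ 2 + 2 * (- c / N) * c =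
    - (c ^+ 2 * (rnorm x ^+ 2 + 2)) / N ^+ 2.
    rewrite /N; field; exact: lt0r_neq0.
  rewrite mulNr oppr_ge0 pmulr_lle0 ?invr_gt0 ?exprn_gt0// => h.
  have h2 : 0 < rnorm x ^+ 2 + 2 by rewrite ltr_wpDl// exprn_ge0// rnorm_ge0.
  move: h; rewrite pmulr_lle0// => h; apply/eqP; rewrite -sqrf_eq0.
  by rewrite eq_le h sqr_ge0.
exists z0 => x; apply: eq_ReIm; first by rewrite key.
by have := key ('i *: x); rewrite innerZl fZ !Re_im => /oppr_inj.
Qed.

End HilbertSpace.

Section Adjoint.
Variables (R : realType) (H : hilbertType R[i]).
Implicit Types (S T : bop H) (x y z : H).

Lemma adjoint_exists T : exists S, forall x y, inner (T x) y = inner x (S y).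
Proof.
have /choice [s sP] : forall y, exists z, forall x, inner (T x) y = inner x z.
  move=> y; apply: (@riesz _ _ (fun x => inner (T x) y) (opnorm T * rnorm y)).
    by move=> a u v; rewrite bop_linear inner_linearl.
  move=> x; rewrite (le_trans (cauchy_schwarz _ _))// mulrAC ler_wpM2r//.
    exact: rnorm_ge0.
  exact: opnormP.
have sl (a : R[i]) x y : s (a *: x + y) = a *: s x + s y.
  apply: inner_inj => u.
  by rewrite -sP innerDr innerZr !sP innerDr innerZr.
have sb : exists M : R, forall x, rnorm (s x) <= M * rnorm x.
  exists (opnorm T) => z; have [s0|s0] := eqVneq (rnorm (s z)) 0.
    by rewrite s0 mulr_ge0 ?opnorm_ge0 ?rnorm_ge0.
  have s1 : 0 < rnorm (s z) by rewrite lt_def s0 rnorm_ge0.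
  rewrite -(ler_pM2l s1) -expr2 rnorm2E -sP.
  rewrite (le_trans (ler_norm _))// (le_trans (rnorm_Re _))//.
  rewrite (le_trans (cauchy_schwarz _ _))// mulrA ler_wpM2r ?rnorm_ge0//.
  by rewrite mulrC opnormP.
by exists (Bop sl sb) => x y /=.
Qed.

Definition adjoint T : bop H := projT1 (cid (adjoint_exists T)).

Lemma adjointP T x y : inner (T x) y = inner x (adjoint T y).
Proof. by rewrite /adjoint; case: cid. Qed.

Lemma adjoint_uniq S T : (forall x y, inner (T x) y = inner x (S y)) ->
  S = adjoint T.
Proof.
by move=> h; apply: bop_eq => y; apply: inner_inj => x; rewrite -h adjointP.
Qed.

Program Definition bop_id : bop H := @Bop R H id _ _.
Next Obligation. by []. Qed.
Next Obligation. by exists 1 => x; rewrite mul1r. Qed.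

Program Definition bop_comp S T : bop H := @Bop R H (fun x => S (T x)) _ _.
Next Obligation. by move=> S T a x y /=; rewrite !bop_linear. Qed.
Next Obligation.
move=> S T; exists (opnorm S * opnorm T) => x /=.
rewrite (le_trans (opnormP _ _))// -mulrA ler_wpM2l ?opnorm_ge0//.
exact: opnormP.
Qed.

Lemma bop_compA : associative bop_comp.
Proof. by move=> S T U; apply: bop_eq. Qed.

Lemma bop_comp_linearl (a : R[i]) S T U :
  bop_comp (a *: S + T) U = a *: bop_comp S U + bop_comp T U.
Proof. by apply: bop_eq. Qed.

Lemma bop_comp_linearr (a : R[i]) S T U :
  bop_comp U (a *: S + T) = a *: bop_comp U S + bop_comp U T.
Proof. by apply: bop_eq => x; exact: bop_linear. Qed.

Lemma adjoint_antilinear (a : R[i]) S T :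
  adjoint (a *: S + T) = Num.conj a *: adjoint S + adjoint T.
Proof.
apply/esym/adjoint_uniq => x y.
rewrite !bop_addE !bop_scaleE innerDl innerZl innerDr innerZr conjCK.
by rewrite !adjointP.
Qed.

Lemma adjointK : involutive adjoint.
Proof.
move=> T; apply/esym/adjoint_uniq => x y.
by rewrite inner_conj -adjointP -inner_conj.
Qed.

Lemma adjoint_comp S T :
  adjoint (bop_comp S T) = bop_comp (adjoint T) (adjoint S).
Proof. by apply/esym/adjoint_uniq => x y; rewrite /= !adjointP. Qed.

Lemma opnorm_comp S T : opnorm (bop_comp S T) <= opnorm S * opnorm T.
Proof.
apply: opnorm_le => [|x]; first by rewrite mulr_ge0// opnorm_ge0.
apply: (le_trans (opnormP S (T x))); rewrite -mulrA ler_wpM2l ?opnorm_ge0//.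
exact: opnormP.
Qed.

Lemma opnorm2_le T : opnorm T ^+ 2 <= opnorm (bop_comp (adjoint T) T).
Proof.
set N := opnorm (bop_comp _ _); have N0 : 0 <= N by exact: opnorm_ge0.
rewrite -[leRHS]sqr_sqrtr// lerXn2r ?nnegrE ?opnorm_ge0 ?sqrtr_ge0//.
apply: opnorm_le; first exact: sqrtr_ge0.
move=> x; rewrite -(@ler_pXn2r _ 2)// ?nnegrE ?mulr_ge0 ?rnorm_ge0 ?sqrtr_ge0//.
rewrite exprMn sqr_sqrtr// rnorm2E adjointP.
rewrite (le_trans (ler_norm _))// (le_trans (rnorm_Re _))//.
rewrite (le_trans (cauchy_schwarz _ _))// mulrC expr2 mulrA.
by rewrite ler_wpM2r ?rnorm_ge0// (opnormP (bop_comp (adjoint T) T)).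
Qed.

Lemma opnorm_adjoint_le T : opnorm T <= opnorm (adjoint T).
Proof.
have [->|T0] := eqVneq (opnorm T) 0; first exact: opnorm_ge0.
have T1 : 0 < opnorm T by rewrite lt_def T0 opnorm_ge0.
by rewrite -(ler_pM2r T1) -expr2 (le_trans (opnorm2_le T))// opnorm_comp.
Qed.

Lemma opnorm_star T : opnorm (bop_comp (adjoint T) T) = opnorm T ^+ 2.
Proof.
apply/eqP; rewrite eq_le opnorm2_le andbT (le_trans (opnorm_comp _ _))//.
by rewrite expr2 ler_wpM2r ?opnorm_ge0// -{2}(adjointK T) opnorm_adjoint_le.
Qed.

Lemma bop_norm_comp S T : `|bop_comp S T| <= `|S| * `|T|.
Proof. by rewrite !rnormE -rmorphM lecR !bop_rnormE opnorm_comp. Qed.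

Lemma bop_norm_star T : `|bop_comp (adjoint T) T| = `|T| ^+ 2.
Proof. by rewrite !rnormE -rmorphXn !bop_rnormE opnorm_star. Qed.

HB.instance Definition _ := CompleteNormedModule_isCStar.Build R[i] (bop H)
  bop_compA bop_comp_linearl bop_comp_linearr adjoint_antilinear adjointK
  adjoint_comp bop_norm_comp bop_norm_star.

End Adjoint.

Section ComplexComplete.
Variable R : realType.
Local Notation Re := (@complex.Re R).
Local Notation Im := (@complex.Im R).

Lemma rnorm_Im (z : R[i]) : `|Im z| <= rnorm z.
Proof.
have := rnorm_Re ('i * z); rewrite Re_im normrN => /le_trans; apply.
rewrite /rnorm normrM; have -> : `|'i : R[i]| = 1; last by rewrite mul1r.
by rewrite normc_def /= expr0n expr1n add0r sqrtr1.
Qed.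

Lemma rnorm_ReIm (z : R[i]) : rnorm z <= `|Re z| + `|Im z|.
Proof.
rewrite /rnorm normc_def /= -(@ler_pXn2r _ 2)// ?nnegrE ?sqrtr_ge0 ?addr_ge0//.
rewrite sqr_sqrtr ?addr_ge0 ?sqr_ge0// sqrrD !real_normK ?num_real//.
rewrite addrAC lerDl mulrn_wge0// mulr_ge0//.
Qed.

Lemma complex_complete (F : set_system R[i]) :
  ProperFilter F -> cauchy F -> cvg F.
Proof.
move=> FF /rcauchyP Fc.
have cv (p : R[i] -> R) : (forall z w, p (z - w) = p z - p w) ->
    (forall z, `|p z| <= rnorm z) -> cvg (p @ F).
  move=> pB pn; apply: R_complete; apply: cauchy_exP => e e0.
  have [z Fz] := Fc e e0; exists (p z).
  suff: F [set w | ball (p z) e (p w)] by [].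
  apply: filterS Fz => w /= zw; rewrite -ball_normE /= -pB.
  exact: le_lt_trans (pn _) zw.
have ReB z w : Re (z - w) = Re z - Re w by case: z; case: w.
have ImB z w : Im (z - w) = Im z - Im w by case: z; case: w.
have /cvg_ex[a /cvgrPdist_lt Fa] := cv _ ReB (@rnorm_Re R).
have /cvg_ex[b /cvgrPdist_lt Fb] := cv _ ImB rnorm_Im.
apply/cvg_ex; exists (a +i* b); apply/rcvgP => e e0.
have e20 : 0 < e / 2 by rewrite divr_gt0.
have Fa' : F [set z | `|a - Re z| < e / 2] := Fa _ e20.
have Fb' : F [set z | `|b - Im z| < e / 2] := Fb _ e20.
apply: filterS (filterI Fa' Fb') => z /= [h1 h2].
rewrite (le_lt_trans (rnorm_ReIm _))// [ltRHS]splitr ReB ImB.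
exact: ltrD.
Qed.

HB.instance Definition _ := Uniform_isComplete.Build R[i] complex_complete.

End ComplexComplete.

Section Sums.
Variables (R : realType) (I : choiceType).
Implicit Types (f g h : I -> R).
Local Notation Re := (@complex.Re R).
Local Notation Im := (@complex.Im R).

Definition abs_summable f := summable [set: I] (EFin \o f).

Lemma abs_summable_le f g : (forall i, `|f i| <= g i) -> abs_summable g ->
  abs_summable f.
Proof.
move=> fg; apply: le_lt_trans; apply: le_esum => i _ /=.
by rewrite lee_fin (le_trans (fg i))// ler_norm.
Qed.

Lemma abs_summableD f g : abs_summable f -> abs_summable g ->
  abs_summable (fun i => f i + g i).
Proof. exact: summableD. Qed.

Definition ge0_sum f : R := fine (\esum_(i in [set: I]) (f i)%:E).

Lemma ge0_sumE f : (forall i, 0 <= f i) -> abs_summable f ->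
  (\esum_(i in [set: I]) (f i)%:E = (ge0_sum f)%:E)%E.
Proof.
move=> f0 sf; rewrite /ge0_sum fineK// ge0_fin_numE.
  apply: le_lt_trans sf; apply: le_esum => i _ /=.
  by rewrite lee_fin ler_norm.
by apply: esum_ge0 => i _; rewrite lee_fin.
Qed.

Lemma ge0_sum_ge0 f : (forall i, 0 <= f i) -> 0 <= ge0_sum f.
Proof. by move=> f0; apply/fine_ge0/esum_ge0 => i _; rewrite lee_fin. Qed.

Lemma ge0_sumD f g : (forall i, 0 <= f i) -> abs_summable f ->
  (forall i, 0 <= g i) -> abs_summable g ->
  ge0_sum (fun i => f i + g i) = ge0_sum f + ge0_sum g.
Proof.
move=> f0 sf g0 sg; apply: EFin_inj; rewrite EFinD -!ge0_sumE//.
- rewrite -esumD => [||i _]; last by rewrite lee_fin.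
    by apply: eq_esum => i _; rewrite EFinD.
  by move=> i _; rewrite lee_fin.
- by move=> i; rewrite addr_ge0.
- exact: abs_summableD.
Qed.

Lemma ge0_sum_finite f (A : {fset I}) : (forall i, 0 <= f i) ->
  abs_summable f -> \sum_(i <- A) f i <= ge0_sum f.
Proof.
move=> f0 sf; rewrite -lee_fin -ge0_sumE//.
apply: esum_ge; exists [set` A]; first by split.
by rewrite fsbig_finite//= set_fsetK sumEFin.
Qed.

Lemma bounded_summable f M : (forall i, 0 <= f i) ->
  (forall A : {fset I}, \sum_(i <- A) f i <= M) ->
  abs_summable f /\ ge0_sum f <= M.
Proof.
move=> f0 fM; have sM : (\esum_(i in [set: I]) (f i)%:E <= M%:E)%E.
  apply: ge_ereal_sup => _ [A [fA _] <-].
  by rewrite fsbig_finite//= sumEFin lee_fin.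
have sf : abs_summable f.
  apply: (@le_lt_trans _ _ M%:E); last exact: ltry.
  apply: le_trans sM; apply: le_esum => i _ /=.
  by rewrite ger0_norm.
by split=> //; rewrite -lee_fin -ge0_sumE.
Qed.

Lemma abs_summableZ (c : R) f : abs_summable f ->
  abs_summable (fun i => c * f i).
Proof.
move=> sf; suff h : abs_summable (fun i => `|c| * `|f i|).
  by apply: abs_summable_le h => i; rewrite normrM.
have sf' : abs_summable (fun i => `|f i|).
  by move: sf; rewrite /abs_summable /summable /=;
     under [in X in X -> _]eq_esum do rewrite -(normr_id (f _)).
have [i|A|//] := @bounded_summable (fun i => `|c| * `|f i|)
  (`|c| * ge0_sum (fun i => `|f i|)); first exact: mulr_ge0.
by rewrite -mulr_sumr ler_wpM2l// ge0_sum_finite.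
Qed.

Lemma ge0_sumZ (c : R) f : 0 <= c -> (forall i, 0 <= f i) -> abs_summable f ->
  ge0_sum (fun i => c * f i) = c * ge0_sum f.
Proof.
have le (d : R) g : 0 <= d -> (forall i, 0 <= g i) -> abs_summable g ->
    ge0_sum (fun i => d * g i) <= d * ge0_sum g.
  move=> d0 g0 sg; have [|A|//] := @bounded_summable (fun i => d * g i)
    (d * ge0_sum g); first by move=> i; rewrite mulr_ge0.
  by rewrite -mulr_sumr ler_wpM2l// ge0_sum_finite.
rewrite le_eqVlt => /predU1P[<-|c0] f0 sf.
  rewrite mul0r /ge0_sum esum1// => i _; by rewrite mul0r.
apply/eqP; rewrite eq_le le ?(ltW c0)//=.
rewrite -ler_pdivlMl//.
have cf0 i : 0 <= c * f i by rewrite mulr_ge0// ltW.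
have := le c^-1 _ _ cf0 (abs_summableZ c sf); rewrite invr_ge0 (ltW c0).
move=> /(_ isT); congr (_ <= _); congr ge0_sum.
by apply/funext => i; rewrite mulKf// gt_eqF.
Qed.

(* The sum of an absolutely summable family. *)
Definition real_sum f : R :=
  ge0_sum (fun i => Num.max (f i) 0) - ge0_sum (fun i => Num.max (- f i) 0).

Lemma summable_pos f : abs_summable f ->
  abs_summable (fun i => Num.max (f i) 0).
Proof.
move=> sf; apply: abs_summable_le (_ : abs_summable (fun i => `|f i|)).
  move=> i; rewrite ger0_norm ?le_max ?lexx ?orbT//.
  by rewrite ge_max ler_norm normr_ge0.
by move: sf; rewrite /abs_summable /summable /=;
   under [in X in X -> _]eq_esum do rewrite -(normr_id (f _)).
Qed.

Lemma abs_summableN f : abs_summable f -> abs_summable (fun i => - f i).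
Proof. by move=> sf; have := abs_summableZ (-1) sf;
  congr abs_summable; apply/funext => i; rewrite mulN1r. Qed.

Lemma summable_neg f : abs_summable f ->
  abs_summable (fun i => Num.max (- f i) 0).
Proof. by move=> sf; apply/(@summable_pos (fun i => - f i))/abs_summableN. Qed.

Lemma max_ge0 (x : R) : 0 <= Num.max x 0.
Proof. by rewrite le_max lexx orbT. Qed.

Lemma real_sumB g h f : (forall i, 0 <= g i) -> abs_summable g ->
  (forall i, 0 <= h i) -> abs_summable h -> (forall i, f i = g i - h i) ->
  abs_summable f /\ real_sum f = ge0_sum g - ge0_sum h.
Proof.
move=> g0 sg h0 sh fE.
have sf : abs_summable f.
  have -> : f = (fun i => g i + - h i) by apply/funext.
  by apply: abs_summableD => //; exact: abs_summableN.
split=> //; apply/eqP; rewrite /real_sum subr_eq addrAC -subr_eq opprK.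
have m0 := max_ge0.
rewrite -!ge0_sumD//; [|exact: summable_neg|exact: summable_pos].
apply/eqP; congr ge0_sum; apply/funext => i; rewrite fE.
by case: (leP 0 (g i - h i)) => gh; [rewrite max_r|rewrite max_l]; lra.
Qed.

Lemma real_sum_split f : abs_summable f -> forall i,
  f i = Num.max (f i) 0 - Num.max (- f i) 0.
Proof.
move=> sf i; case: (leP 0 (f i)) => h; [rewrite max_r|rewrite max_l]; lra.
Qed.

Lemma real_sumD f g : abs_summable f -> abs_summable g ->
  real_sum (fun i => f i + g i) = real_sum f + real_sum g.
Proof.
move=> sf sg; have m0 := max_ge0.
have [||||i|_ ->] := @real_sumB (fun i => Num.max (f i) 0 + Num.max (g i) 0)
  (fun i => Num.max (- f i) 0 + Num.max (- g i) 0) (fun i => f i + g i).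
- by move=> i; rewrite addr_ge0.
- by apply: abs_summableD; exact: summable_pos.
- by move=> i; rewrite addr_ge0.
- by apply: abs_summableD; exact: summable_neg.
- by rewrite {1}(real_sum_split sf i) {1}(real_sum_split sg i); ring.
rewrite !ge0_sumD//; try exact: summable_pos; try exact: summable_neg.
by rewrite /real_sum; ring.
Qed.

Lemma real_sumZ (c : R) f : abs_summable f ->
  real_sum (fun i => c * f i) = c * real_sum f.
Proof.
move=> sf; have m0 := max_ge0.
have sp := summable_pos sf; have sn := summable_neg sf.
have [c0|c0] := leP 0 c.
  have [||||i|_ ->] := @real_sumB (fun i => c * Num.max (f i) 0)
    (fun i => c * Num.max (- f i) 0) (fun i => c * f i).
  - by move=> i; rewrite mulr_ge0.
  - exact: abs_summableZ.
  - by move=> i; rewrite mulr_ge0.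
  - exact: abs_summableZ.
  - by rewrite {1}(real_sum_split sf i); ring.
  by rewrite !ge0_sumZ// /real_sum; ring.
have nc0 : 0 <= - c by rewrite oppr_ge0 ltW.
have [||||i|_ ->] := @real_sumB (fun i => - c * Num.max (- f i) 0)
  (fun i => - c * Num.max (f i) 0) (fun i => c * f i).
- by move=> i; rewrite mulr_ge0.
- exact: abs_summableZ.
- by move=> i; rewrite mulr_ge0.
- exact: abs_summableZ.
- by rewrite {1}(real_sum_split sf i); ring.
by rewrite !ge0_sumZ// /real_sum; ring.
Qed.

Lemma real_sum_ge0 f : (forall i, 0 <= f i) -> real_sum f = ge0_sum f.
Proof.
move=> f0; rewrite /real_sum [X in _ - X](_ : _ = 0) ?subr0.
  by congr ge0_sum; apply/funext => i; rewrite max_l.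
rewrite /ge0_sum esum1// => i _; by rewrite max_r// oppr_le0.
Qed.

Definition complex_sum (f : I -> R[i]) : R[i] :=
  real_sum (fun i => Re (f i)) +i* real_sum (fun i => Im (f i)).

Implicit Types u v : I -> R[i].
Let csm u := abs_summable (fun i => rnorm (u i)).

Lemma csm_Re u : csm u -> abs_summable (fun i => Re (u i)).
Proof. by apply: abs_summable_le => i; exact: rnorm_Re. Qed.
Lemma csm_Im u : csm u -> abs_summable (fun i => Im (u i)).
Proof. by apply: abs_summable_le => i; exact: rnorm_Im. Qed.

Lemma complex_sumD u v : csm u -> csm v ->
  complex_sum (fun i => u i + v i) = complex_sum u + complex_sum v.
Proof.
move=> su sv; rewrite /complex_sum; apply: eq_ReIm => /=.
  rewrite -real_sumD; try exact: csm_Re.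
  by congr real_sum; apply/funext => i; case: (u i); case: (v i).
rewrite -real_sumD; try exact: csm_Im.
by congr real_sum; apply/funext => i; case: (u i); case: (v i).
Qed.

Lemma complex_sumZ (a : R[i]) u : csm u ->
  complex_sum (fun i => a * u i) = a * complex_sum u.
Proof.
move=> su; have sR := csm_Re su; have sI := csm_Im su.
rewrite /complex_sum; case: a => p q; apply: eq_ReIm => /=.
  rewrite -mulNr -!real_sumZ// -real_sumD; try exact: abs_summableZ.
  by congr real_sum; apply/funext => i; case: (u i) => r s /=; rewrite mulNr.
rewrite -!real_sumZ// -real_sumD; try exact: abs_summableZ.
by congr real_sum; apply/funext => i; case: (u i) => r s /=.
Qed.

Lemma complex_sumJ u : csm u ->
  complex_sum (fun i => Num.conj (u i)) = Num.conj (complex_sum u).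
Proof.
move=> su; rewrite /complex_sum; apply: eq_ReIm => /=.
  by congr real_sum; apply/funext => i; case: (u i).
rewrite -mulN1r -real_sumZ; last exact: csm_Im.
by congr real_sum; apply/funext => i; case: (u i) => r s /=; rewrite mulN1r.
Qed.

End Sums.

Record ell2 (R : realType) (I : choiceType) := Ell2 {
  ell2_fun :> I -> R[i] ;
  ell2_summable : abs_summable (fun i => rnorm (ell2_fun i) ^+ 2)
}.

Section Ell2.
Variables (R : realType) (I : choiceType).
Local Notation L2 := (ell2 R I).
Implicit Types (x y z : L2) (a : R[i]).
Local Notation Re := (@complex.Re R).
Local Notation Im := (@complex.Im R).

Lemma ell2_eq x y : (forall i, x i = y i) -> x = y.
Proof.
case: x y => [f sf] [g sg] /= fg.
have {}fg : f = g by apply/funext.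
by subst g; rewrite (Prop_irrelevance sf sg).
Qed.

HB.instance Definition _ := gen_eqMixin L2.
HB.instance Definition _ := gen_choiceMixin L2.

Lemma sqr_rnorm_ge0 (f : I -> R[i]) i : 0 <= rnorm (f i) ^+ 2.
Proof. exact: sqr_ge0. Qed.

Lemma ell2_summableZ a x : abs_summable (fun i => rnorm (a * x i) ^+ 2).
Proof.
have -> : (fun i => rnorm (a * x i) ^+ 2) =
          (fun i => rnorm a ^+ 2 * rnorm (x i) ^+ 2).
  by apply/funext => i; rewrite (rnormZ a (x i : R[i]^o)) exprMn.
exact/abs_summableZ/ell2_summable.
Qed.

Lemma ell2_summableD x y : abs_summable (fun i => rnorm (x i + y i) ^+ 2).
Proof.
apply: (@abs_summable_le _ _ _
  (fun i => 2 * rnorm (x i) ^+ 2 + 2 * rnorm (y i) ^+ 2)).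
  move=> i; rewrite ger0_norm ?sqr_ge0//.
  have := rnormD (x i) (y i); have := rnorm_ge0 (x i + y i).
  have := sqr_ge0 (rnorm (x i) - rnorm (y i)); nra.
by apply: abs_summableD; apply/abs_summableZ/ell2_summable.
Qed.

Lemma ell2_summable0 : abs_summable (fun i : I => rnorm (0 : R[i]) ^+ 2).
Proof.
rewrite /abs_summable /summable esum1// => i _ /=.
by rewrite rnorm0 expr0n normr0.
Qed.

Definition ell2_zero : L2 := Ell2 ell2_summable0.
Definition ell2_add x y : L2 := Ell2 (ell2_summableD x y).
Definition ell2_scale a x : L2 := Ell2 (ell2_summableZ a x).

Lemma ell2_addA : associative ell2_add.
Proof. by move=> x y z; apply: ell2_eq => i /=; rewrite addrA. Qed.
Lemma ell2_addC : commutative ell2_add.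
Proof. by move=> x y; apply: ell2_eq => i /=; rewrite addrC. Qed.
Lemma ell2_add0 : left_id ell2_zero ell2_add.
Proof. by move=> x; apply: ell2_eq => i /=; rewrite add0r. Qed.
Lemma ell2_addN : left_inverse ell2_zero (ell2_scale (-1)) ell2_add.
Proof. by move=> x; apply: ell2_eq => i /=; rewrite mulN1r addNr. Qed.

HB.instance Definition _ :=
  GRing.isZmodule.Build L2 ell2_addA ell2_addC ell2_add0 ell2_addN.

Lemma ell2_scaleA a b x : ell2_scale a (ell2_scale b x) = ell2_scale (a * b) x.
Proof. by apply: ell2_eq => i /=; rewrite mulrA. Qed.
Lemma ell2_scale1 : left_id 1 ell2_scale.
Proof. by move=> x; apply: ell2_eq => i /=; rewrite mul1r. Qed.
Lemma ell2_scaleDr : right_distributive ell2_scale +%R.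
Proof. by move=> a x y; apply: ell2_eq => i /=; rewrite mulrDr. Qed.
Lemma ell2_scaleDl x : {morph ell2_scale^~ x : a b / a + b}.
Proof. by move=> a b; apply: ell2_eq => i /=; rewrite mulrDl. Qed.

HB.instance Definition _ := GRing.Zmodule_isLmodule.Build R[i] L2
  ell2_scaleA ell2_scale1 ell2_scaleDr ell2_scaleDl.

Lemma ell2_addE x y i : (x + y : L2) i = x i + y i. Proof. by []. Qed.
Lemma ell2_scaleE a x i : (a *: x : L2) i = a * x i. Proof. by []. Qed.
Lemma ell2_subE x y i : (x - y : L2) i = x i - y i.
Proof. by rewrite ell2_addE; congr (_ + _); exact: mulN1r. Qed.

Definition ell2_inner x y : R[i] :=
  complex_sum (fun i => x i * Num.conj (y i)).

Definition ell2_norm2 x : R := ge0_sum (fun i => rnorm (x i) ^+ 2).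

Lemma ell2_inner_summable x y :
  abs_summable (fun i => rnorm (x i * Num.conj (y i))).
Proof.
apply: (@abs_summable_le _ _ _ (fun i => rnorm (x i) ^+ 2 + rnorm (y i) ^+ 2)).
  move=> i; rewrite ger0_norm ?rnorm_ge0//.
  rewrite (rnormZ (x i) (Num.conj (y i) : R[i]^o)) rnormJ.
  have := rnorm_ge0 (x i); have := rnorm_ge0 (y i).
  have := sqr_ge0 (rnorm (x i) - rnorm (y i)); nra.
by apply: abs_summableD; exact: ell2_summable.
Qed.

Lemma ell2_inner_linearl a x y z :
  ell2_inner (a *: x + y) z = a * ell2_inner x z + ell2_inner y z.
Proof.
rewrite /ell2_inner -complex_sumZ ?ell2_inner_summable// -complex_sumD.
- by congr complex_sum; apply/funext => i /=; rewrite mulrDl mulrA.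
- have := ell2_inner_summable (a *: x) z; congr abs_summable.
  by apply/funext => i /=; rewrite mulrA.
- exact: ell2_inner_summable.
Qed.

Lemma ell2_inner_conj x y : ell2_inner y x = Num.conj (ell2_inner x y).
Proof.
rewrite /ell2_inner -complex_sumJ ?ell2_inner_summable//.
congr complex_sum; apply/funext => i.
rewrite rmorphM /= mulrC; congr (_ * _); exact/esym/conjcK.
Qed.

Lemma ell2_norm2_ge0 x : 0 <= ell2_norm2 x.
Proof. by apply: ge0_sum_ge0 => i; exact: sqr_ge0. Qed.

Lemma ell2_inner_self x : ell2_inner x x = (ell2_norm2 x)%:C.
Proof.
rewrite /ell2_inner /complex_sum /ell2_norm2.
have e i : x i * Num.conj (x i) = (rnorm (x i) ^+ 2)%:C.
  by rewrite mulrC mul_conj.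
apply: eq_ReIm => /=.
  rewrite -real_sum_ge0; last by move=> i; exact: sqr_ge0.
  by congr real_sum; apply/funext => i; rewrite e.
rewrite real_sum_ge0; last by move=> i; rewrite e.
rewrite /ge0_sum esum1// => i _; by rewrite e.
Qed.

Lemma ell2_coord x i : rnorm (x i) ^+ 2 <= ell2_norm2 x.
Proof.
have := ge0_sum_finite [fset i]%fset (sqr_rnorm_ge0 x) (ell2_summable x).
by rewrite big_seq_fset1.
Qed.

Lemma ell2_norm2_eq0 x : ell2_norm2 x = 0 -> x = 0.
Proof.
move=> x0; apply: ell2_eq => i; apply: rnorm0_eq0; apply/eqP.
by rewrite -sqrf_eq0 eq_le sqr_ge0 andbT -x0 ell2_coord.
Qed.

Lemma ell2_norm2D x y :
  ell2_norm2 (x + y) = ell2_norm2 x + ell2_norm2 y + 2 * Re (ell2_inner x y).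
Proof.
have n2 z : ell2_norm2 z = Re (ell2_inner z z) by rewrite ell2_inner_self.
have Dl u v w : ell2_inner (u + v) w = ell2_inner u w + ell2_inner v w.
  by have := ell2_inner_linearl 1 u v w; rewrite scale1r mul1r.
rewrite !n2 Dl !ReD [ell2_inner x (x + y)]ell2_inner_conj.
rewrite [ell2_inner y (x + y)]ell2_inner_conj !ReJ !Dl !ReD.
by rewrite [ell2_inner y x]ell2_inner_conj ReJ; ring.
Qed.

Lemma ell2_norm2Z a x : ell2_norm2 (a *: x) = rnorm a ^+ 2 * ell2_norm2 x.
Proof.
rewrite /ell2_norm2 -ge0_sumZ ?sqr_ge0//; last exact: ell2_summable.
  congr ge0_sum; apply/funext => i.
  by rewrite ell2_scaleE (rnormZ a (x i : R[i]^o)) exprMn.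
by move=> i; exact: sqr_ge0.
Qed.

Lemma ell2_innerZr (r : R) x y :
  Re (ell2_inner x (r%:C *: y)) = r * Re (ell2_inner x y).
Proof.
rewrite ell2_inner_conj ReJ.
have := ell2_inner_linearl r%:C y 0 x.
have -> : ell2_inner 0 x = 0.
  have := ell2_inner_linearl 1 0 0 x.
  rewrite scale1r mul1r addr0 => /esym/eqP.
  by rewrite -subr_eq0 addrK => /eqP.
by rewrite !addr0 => ->; rewrite Re_scale [ell2_inner x y]ell2_inner_conj ReJ.
Qed.

Let nrm x : R := Num.sqrt (ell2_norm2 x).

Lemma ell2_nrmD x y : nrm (x + y) <= nrm x + nrm y.
Proof.
have x0 := ell2_norm2_ge0 x; have y0 := ell2_norm2_ge0 y.
have xy0 := ell2_norm2_ge0 (x + y).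
rewrite -(@ler_pXn2r _ 2)// ?nnegrE ?addr_ge0 ?sqrtr_ge0//.
rewrite sqrrD !sqr_sqrtr// ell2_norm2D addrAC lerD2r.
rewrite -mulr_natl; rewrite addrC -subr_ge0.
have -> : forall p q r : R, p - (q + r) = p - q - r by move=> *; ring.
have := sqrtr_ge0 (ell2_norm2 x); have := sqrtr_ge0 (ell2_norm2 y).
have := sqr_sqrtr x0; have := sqr_sqrtr y0; rewrite -/(nrm x) -/(nrm y).
set p := nrm x; set q := nrm y => hq hp q0 p0.
suff : Re (ell2_inner x y) <= p * q by move: (Re _) => r; lra.
have [p_eq0|p_neq0] := eqVneq p 0.
  have /ell2_norm2_eq0 -> : ell2_norm2 x = 0 by rewrite -hp p_eq0 expr0n.
  have -> : ell2_inner 0 y = 0.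
    have := ell2_inner_linearl 1 0 0 y.
    rewrite scale1r mul1r addr0 => /esym/eqP.
    by rewrite -subr_eq0 addrK => /eqP.
  by rewrite mulr_ge0.
have p1 : 0 < p by rewrite lt_def p_neq0.
have [q_eq0|q_neq0] := eqVneq q 0.
  have /ell2_norm2_eq0 -> : ell2_norm2 y = 0 by rewrite -hq q_eq0 expr0n.
  have := ell2_innerZr 0 x 0; rewrite scaler0 mul0r => ->.
  by rewrite mulr_ge0.
have q1 : 0 < q by rewrite lt_def q_neq0.
have := ell2_norm2_ge0 (q%:C *: x + (- p)%:C *: y).
rewrite ell2_norm2D !ell2_norm2Z !rnorm_real !real_normK ?num_real//.
rewrite ell2_innerZr ell2_inner_conj ReJ ell2_innerZr [ell2_inner y x]ell2_inner_conj ReJ.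
rewrite sqrrN -hp -hq => h.
have {h} : 0 <= 2 * (p * q) * (p * q - Re (ell2_inner x y)).
  by move: h; congr (_ <= _); ring.
by rewrite pmulr_rge0 ?subr_ge0// mulr_gt0// mulr_gt0.
Qed.

Let ell2_norm x : R[i] := (nrm x)%:C.

Lemma ell2_normD x y : ell2_norm (x + y) <= ell2_norm x + ell2_norm y.
Proof. by rewrite /ell2_norm -rmorphD lecR ell2_nrmD. Qed.
Lemma ell2_normZ (a : R[i]) x : ell2_norm (a *: x) = `|a| * ell2_norm x.
Proof.
rewrite /ell2_norm /nrm ell2_norm2Z sqrtrM ?sqr_ge0// sqrtr_sqr.
by rewrite ger0_norm ?rnorm_ge0// rmorphM rnormE.
Qed.
Lemma ell2_norm0_eq0 x : ell2_norm x = 0 -> x = 0.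
Proof.
move=> /(congr1 Re)/= /eqP; rewrite sqrtr_eq0 => x0.
by apply: ell2_norm2_eq0; apply/eqP; rewrite eq_le x0 ell2_norm2_ge0.
Qed.

HB.instance Definition _ := Lmodule_isNormed.Build R[i] L2
  ell2_normD ell2_normZ ell2_norm0_eq0.

Lemma ell2_rnormE x : rnorm x = Num.sqrt (ell2_norm2 x).
Proof. by []. Qed.

Lemma ell2_rnorm2 x : rnorm x ^+ 2 = ell2_norm2 x.
Proof. by rewrite ell2_rnormE sqr_sqrtr ?ell2_norm2_ge0. Qed.

Lemma ell2_rcoord x i : rnorm (x i) <= rnorm x.
Proof.
by rewrite -(@ler_pXn2r _ 2)// ?nnegrE ?rnorm_ge0// ell2_rnorm2 ell2_coord.
Qed.

Lemma ell2_complete (F : set_system L2) : ProperFilter F -> cauchy F -> cvg F.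
Proof.
move=> FF /rcauchyP Fc.
have ev i : cvg ((fun x : L2 => x i) @ F).
  apply: cauchy_cvg; apply/rcauchyP => e e0.
  have [x0 Fx] := Fc _ e0; exists (x0 i).
  suff: F [set x : L2 | rnorm (x0 i - x i) < e] by [].
  apply: filterS Fx => x /= xx; have <- := ell2_subE x0 x i.
  exact: le_lt_trans (ell2_rcoord _ _) xx.
pose y i : R[i] := lim ((fun x : L2 => x i) @ F).
have yP i e : 0 < e -> F [set x : L2 | rnorm (y i - x i) < e].
  by move=> e0; have /rcvgP := ev i; apply.
have key (x0 : L2) e : 0 < e -> F [set x : L2 | rnorm (x0 - x) < e] ->
    forall A : {fset I}, \sum_(i <- A) rnorm (x0 i - y i) ^+ 2 <= e ^+ 2.
  move=> e0 Fx A.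
  have cv i : (fun x : L2 => rnorm (x0 i - x i) ^+ 2) @ F -->
              rnorm (x0 i - y i) ^+ 2.
    apply: (cvg_comp (fun x : L2 => rnorm (x0 i - x i)) (fun r : R => r ^+ 2));
      last exact: exprn_continuous.
    apply/cvgrPdist_lt => d d0; apply: filterS (yP i d d0) => x /= h.
    apply: le_lt_trans h.
    rewrite ler_norml; apply/andP; split.
      rewrite lerBrDl lerBlDr.
      have -> : x0 i - x i = (x0 i - y i) + (y i - x i).
        by rewrite addrA subrK.
      exact: rnormD.
    rewrite lerBlDl.
    have -> : x0 i - y i = (x0 i - x i) + (x i - y i) by rewrite addrA subrK.
    by rewrite [rnorm (y i - x i)]rdistC rnormD.
  have cvs : (fun x : L2 => \sum_(i <- A) rnorm (x0 i - x i) ^+ 2) @ F -->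
             \sum_(i <- A) rnorm (x0 i - y i) ^+ 2.
    elim: (enum_fset A) => [|i s IHs].
      have -> : (fun x : L2 => \sum_(i <- [::]) rnorm (x0 i - x i) ^+ 2) =
                (fun=> 0) by apply/funext => x; rewrite big_nil.
      by rewrite big_nil; exact: cvg_cst.
    have -> : (fun x : L2 => \sum_(j <- i :: s) rnorm (x0 j - x j) ^+ 2) =
        (fun x : L2 => rnorm (x0 i - x i) ^+ 2 +
           \sum_(j <- s) rnorm (x0 j - x j) ^+ 2).
      by apply/funext => x; rewrite big_cons.
    by rewrite big_cons; exact: cvgD (cv i) IHs.
  apply/ler_addgt0Pl => d d0; move/cvgrPdist_lt: cvs => /(_ d d0) h.
  have [x [/= h1 h2]] := filter_ex (filterI h Fx).
  move: h1; rewrite ltr_norml => /andP[_]; rewrite ltrBlDr => h1.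
  apply: (le_trans (ltW h1)); rewrite lerD2l.
  have -> : \sum_(i <- A) rnorm (x0 i - x i) ^+ 2 =
            \sum_(i <- A) rnorm ((x0 - x : L2) i) ^+ 2.
    by apply: eq_bigr => i _; rewrite ell2_subE.
  apply: (@le_trans _ _ (ell2_norm2 (x0 - x))).
    apply: ge0_sum_finite; last exact: ell2_summable.
    by move=> i; exact: sqr_ge0.
  rewrite -ell2_rnorm2 lerXn2r ?nnegrE ?rnorm_ge0 ?(ltW e0)//.
  exact: ltW.
have bnd (x0 : L2) e : 0 < e -> F [set x : L2 | rnorm (x0 - x) < e] ->
    abs_summable (fun i => rnorm (x0 i - y i) ^+ 2) /\
    ge0_sum (fun i => rnorm (x0 i - y i) ^+ 2) <= e ^+ 2.
  move=> e0 Fx; apply: bounded_summable; last exact: key.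
  by move=> i; exact: sqr_ge0.
have [x1 Fx1] := Fc 1 ltr01.
have [sx1 _] := bnd x1 1 ltr01 Fx1.
have sy : abs_summable (fun i => rnorm (y i) ^+ 2).
  have := ell2_summableD x1 (ell2_scale (-1) (Ell2 sx1)).
  congr abs_summable; apply/funext => i /=.
  by rewrite mulN1r opprB addrC subrK.
pose Y := Ell2 sy.
apply/cvg_ex; exists Y; apply/rcvgP => e e0.
have e20 : 0 < e / 2 by rewrite divr_gt0.
have [x0 Fx0] := Fc _ e20; apply: filterS (Fx0) => x /= xx.
rewrite -(subrK x0 Y) -addrA (le_lt_trans (rnormD _ _))// [ltRHS]splitr.
rewrite ler_ltD//.
have [_ h] := bnd x0 _ e20 Fx0.
rewrite -(@ler_pXn2r _ 2)// ?nnegrE ?rnorm_ge0 ?(ltW e20)// rdistC ell2_rnorm2.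
apply: le_trans h; rewrite le_eqVlt; apply/orP; left; apply/eqP.
by congr ge0_sum; apply/funext => i; rewrite ell2_subE.
Qed.

HB.instance Definition _ := Uniform_isComplete.Build L2 ell2_complete.

Lemma ell2_inner_norm x : ell2_inner x x = `|x| ^+ 2.
Proof. by rewrite ell2_inner_self rnormE -rmorphXn ell2_rnorm2. Qed.

HB.instance Definition _ := CompleteNormedModule_isHilbert.Build R[i] L2
  ell2_inner_linearl ell2_inner_conj ell2_inner_norm.

Lemma ell2_basis_summable (i : I) :
  abs_summable (fun j => rnorm ((i == j)%:R : R[i]) ^+ 2).
Proof.
have [j|A|//] := @bounded_summable _ _
  (fun j => rnorm ((i == j)%:R : R[i]) ^+ 2) 1; first exact: sqr_ge0.
rewrite (eq_bigr (fun j => if i == j then 1 : R else 0)); last first.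
  move=> j _; case: eqP => _; last by rewrite rnorm0 expr0n.
  by rewrite /rnorm normr1 expr1n.
rewrite -big_mkcond /= big_const_seq iter_addr_0 -[leRHS]/(1%:R) -mulr_natr.
rewrite mul1r ler_nat; rewrite (@eq_count _ _ (pred1 i)).
  by rewrite count_uniq_mem ?leq_b1// fset_uniq.
by move=> j; rewrite /= eq_sym.
Qed.

Definition ell2_basis (i : I) : L2 := Ell2 (ell2_basis_summable i).

End Ell2.

Section StarHomomorphisms.
Variables (C : numClosedFieldType).
Implicit Types A B : cstarAlgType C.

Definition star_hom A B (f : A -> B) :=
  [/\ forall (a : C) (x y : A), f (a *: x + y) = a *: f x + f y,
      forall x y : A, f (cmul x y) = cmul (f x) (f y)
    & forall x : A, f (cstar x) = cstar (f x)].

Definition closed_ideal A (J : set A) :=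
  [/\ closed J, J 0,
      forall (a : C) (x y : A), J x -> J y -> J (a *: x + y)
    & forall x y : A, J y -> J (cmul x y) /\ J (cmul y x)].

Definition algebra_unit A (e : A) := forall x, cmul e x = x /\ cmul x e = x.

End StarHomomorphisms.

Section ControlledPropagation.
Variables (R : realType).
Implicit Types A Q : cstarAlgType R[i].

Definition mx_entry (I : choiceType) (T : bop (ell2 R I)) (i j : I) : R[i] :=
  inner (T (ell2_basis R j)) (ell2_basis R i).

(* S_m(I). *)
Definition propagation_le (I : choiceType) (m : nat) : set (bop (ell2 R I)) :=
  [set T | (forall i, [set j | mx_entry T i j != 0] #<= `I_m)%card /\
           (forall j, [set i | mx_entry T i j != 0] #<= `I_m)%card].

(* S(I): the norm closure of the operators of finite propagation. *)
Definition controlled_operators (I : choiceType) : set (bop (ell2 R I)) :=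
  closure (\bigcup_(m in [set m | (1 <= m)%N]) @propagation_le I m).

Definition controlled_propagation A :=
  exists (I : choiceType) (rho : A -> bop (ell2 R I)),
    [/\ star_hom rho, injective rho & range rho `<=` @controlled_operators I].

Definition uncontrolled_propagation A := ~ controlled_propagation A.

(* [Q], with the map [p : A -> Q], is the quotient C*-algebra of [A] by [J].
   That A / J is a C*-algebra is not obvious (it uses that J is self-adjoint),
   so the quotient is described up to isomorphism instead of being built. *)
Definition quotient_algebra A (J : set A) Q (p : A -> Q) :=
  [/\ star_hom p, range p = setT, forall x, p x = 0 <-> J x
    & forall x, rnorm (p x) = inf [set rnorm (x + k) | k in J]].

Definition finite_dimensional (V : lmodType R[i]) :=
  exists (n : nat) (e : 'I_n -> V),
    forall v, exists c : 'I_n -> R[i], v = \sum_i c i *: e i.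

Definition commutant (H : hilbertType R[i]) (M : set (bop H)) : set (bop H) :=
  [set T | forall S, M S -> bop_comp S T = bop_comp T S].

(* A self-adjoint set equal to its double commutant is automatically a unital
   subalgebra. *)
Definition von_neumann_on (H : hilbertType R[i]) (M : set (bop H)) :=
  (forall T, M T -> M (adjoint T)) /\ commutant (commutant M) = M.

(* [A] is, through [rho], a von Neumann algebra acting on [H]. *)
Definition von_neumann_algebra A :=
  exists (H : hilbertType R[i]) (rho : A -> bop H),
    [/\ star_hom rho, injective rho & von_neumann_on (range rho)].

(* Every isometry is unitary. *)
Definition finite_algebra A := forall e v : A, algebra_unit e ->
  cmul (cstar v) v = e -> cmul v (cstar v) = e.

End ControlledPropagation.

(* Groupoids. The unit space is the type [X], embedded in the arrow space by
   [gid]; since [gid] and [gsrc] are continuous, the topology of [X] is the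
   subspace topology of the set of units. The product [gmul a b] is meaningful
   only when [gsrc a = grng b]. *)
Record topGroupoid (X : topologicalType) := TopGroupoid {
  arrow :> topologicalType ;
  gsrc : arrow -> X ;
  grng : arrow -> X ;
  gid : X -> arrow ;
  gmul : arrow -> arrow -> arrow ;
  ginv : arrow -> arrow ;
  gsrc_id : forall x, gsrc (gid x) = x ;
  grng_id : forall x, grng (gid x) = x ;
  gsrc_mul : forall a b, gsrc a = grng b -> gsrc (gmul a b) = gsrc b ;
  grng_mul : forall a b, gsrc a = grng b -> grng (gmul a b) = grng a ;
  gmulA : forall a b c, gsrc a = grng b -> gsrc b = grng c ->
    gmul a (gmul b c) = gmul (gmul a b) c ;
  gmul1l : forall a, gmul (gid (grng a)) a = a ;
  gmul1r : forall a, gmul a (gid (gsrc a)) = a ;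
  gsrc_inv : forall a, gsrc (ginv a) = grng a ;
  grng_inv : forall a, grng (ginv a) = gsrc a ;
  gmulVl : forall a, gmul (ginv a) a = gid (gsrc a) ;
  gmulVr : forall a, gmul a (ginv a) = gid (grng a) ;
  gsrc_continuous : continuous gsrc ;
  grng_continuous : continuous grng ;
  gid_continuous : continuous gid ;
  gmul_continuous :
    {within [set ab : arrow * arrow | gsrc ab.1 = grng ab.2],
      continuous (fun ab => gmul ab.1 ab.2)} ;
  ginv_continuous : continuous ginv
}.

Definition local_homeomorphism (S T : topologicalType) (f : S -> T) :=
  forall x, exists U : set S,
    [/\ open U, U x, set_inj U f, {within U, continuous f}
      & forall V : set S, V `<=` U -> open V -> open (f @` V)].

Definition etale (X : topologicalType) (G : topGroupoid X) :=
  local_homeomorphism (@gsrc X G).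

(* The library's [locally_compact] asks for closed compact neighbourhoods,
   which is too strong for non-Hausdorff spaces. *)
Definition locally_compact_space (T : topologicalType) :=
  forall x : T, exists2 K : set T, nbhs x K & compact K.

Definition circle (R : realType) : set R[i] := [set z | `|z| = 1].

Section Twists.
Variables (R : realType) (X : topologicalType).
Implicit Types (G S : topGroupoid X).

Definition circle_act S (incl : X -> R[i] -> S) (z : R[i]) (s : S) : S :=
  gmul (incl (grng s) z) s.

(* [phi] is a T-equivariant homeomorphism from U x T onto p^-1(U), with
   inverse (p, psi). *)
Definition trivialization G S (incl : X -> R[i] -> S) (proj : S -> G)
    (U : set G) (phi : G -> R[i] -> S) (psi : S -> R[i]) :=
  [/\ {within [set gz : G * R[i] | U gz.1 /\ circle gz.2],
        continuous (fun gz => phi gz.1 gz.2)},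
      {within proj @^-1` U, continuous psi},
      forall g z, U g -> circle z -> proj (phi g z) = g /\ psi (phi g z) = z,
      forall s, U (proj s) -> circle (psi s) /\ phi (proj s) (psi s) = s
    & forall g z w, U g -> circle z -> circle w ->
        phi g (w * z) = circle_act incl w (phi g z)].

(* [tw_incl] is the map from X x T, which only matters on [circle]. The unit
   space of the total space is X itself, and [tw_proj] is the identity on it. *)
Record twist G := Twist {
  tw_total :> topGroupoid X ;
  tw_incl : X -> R[i] -> tw_total ;
  tw_proj : tw_total -> G ;
  tw_incl_src : forall x z, circle z -> gsrc (tw_incl x z) = x ;
  tw_incl_rng : forall x z, circle z -> grng (tw_incl x z) = x ;
  tw_incl1 : forall x, tw_incl x 1 = gid tw_total x ;
  tw_inclM : forall x z w, circle z -> circle w ->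
    tw_incl x (z * w) = gmul (tw_incl x z) (tw_incl x w) ;
  tw_incl_inj : forall x z w, circle z -> circle w ->
    tw_incl x z = tw_incl x w -> z = w ;
  tw_incl_continuous :
    {within [set xz : X * R[i] | circle xz.2],
      continuous (fun xz => tw_incl xz.1 xz.2)} ;
  tw_proj_src : forall s, gsrc (tw_proj s) = gsrc s ;
  tw_proj_rng : forall s, grng (tw_proj s) = grng s ;
  tw_proj_id : forall x, tw_proj (gid tw_total x) = gid G x ;
  tw_projM : forall s t, gsrc s = grng t ->
    tw_proj (gmul s t) = gmul (tw_proj s) (tw_proj t) ;
  tw_proj_continuous : continuous tw_proj ;
  tw_bundle : forall g, exists (U : set G) phi psi,
    [/\ open U, U g & trivialization tw_incl tw_proj U phi psi] ;
  tw_exact : tw_proj @^-1` range (gid G) =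
    [set s | exists x z, circle z /\ s = tw_incl x z] ;
  tw_central : forall s z, circle z ->
    gmul (tw_incl (grng s) z) s = gmul s (tw_incl (gsrc s) z)
}.

End Twists.

Section FellBundle.
Variables (R : realType) (X : topologicalType) (G : topGroupoid X).
Variable E : twist R G.
Implicit Types (s t : E) (a b z w : R[i]) (g : G).

Local Notation act := (circle_act (@tw_incl _ _ _ E)).

Lemma circle1 : circle (1 : R[i]).
Proof. by rewrite /circle /= normr1. Qed.

Lemma circleM z w : circle z -> circle w -> circle (z * w).
Proof. by rewrite /circle /= normrM => -> ->; rewrite mulr1. Qed.

Lemma circleJ z : circle z -> circle (Num.conj z).
Proof. by rewrite /circle /= norm_conjC. Qed.

Lemma circleVJ z : circle z -> Num.conj z * z = 1.
Proof. by rewrite /circle /= mul_conj rnormE => -[->]; rewrite expr1n. Qed.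

Lemma act1 s : act 1 s = s.
Proof. by rewrite /circle_act tw_incl1 gmul1l. Qed.

Lemma actM z w s : circle z -> circle w -> act z (act w s) = act (z * w) s.
Proof.
move=> cz cw; rewrite /circle_act grng_mul ?tw_incl_src// tw_incl_rng//.
by rewrite gmulA ?tw_incl_src ?tw_incl_rng// -tw_inclM.
Qed.

Definition fell_rel (p q : E * R[i]) : bool :=
  `[< exists z, [/\ circle z, q.1 = act z p.1 & q.2 = Num.conj z * p.2] >].

Lemma fell_rel_refl : reflexive fell_rel.
Proof.
move=> [s a]; apply/asboolP; exists 1; split=> /=; first exact: circle1.
  by rewrite act1.
by rewrite rmorph1 mul1r.
Qed.

Lemma fell_rel_imp p q : fell_rel p q -> fell_rel q p.
Proof.
case: p q => [s a] [t b] /asboolP[z [cz /= -> ->]].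
apply/asboolP; exists (Num.conj z); split=> /=; first exact: circleJ.
  by rewrite actM ?circleVJ ?act1//; exact: circleJ.
by rewrite mulrA -rmorphM circleVJ// rmorph1 mul1r.
Qed.

Lemma fell_rel_sym : symmetric fell_rel.
Proof. by move=> p q; apply/idP/idP; exact: fell_rel_imp. Qed.

Lemma fell_rel_trans : transitive fell_rel.
Proof.
move=> [t b] [s a] [u c] /asboolP[z [cz /= -> ->]] /asboolP[w [cw /= -> ->]].
apply/asboolP; exists (w * z); split=> /=; first exact: circleM.
  by rewrite actM.
by rewrite rmorphM mulrA.
Qed.

Definition fell_equiv : equiv_rel (E * R[i])%type :=
  EquivRel fell_rel fell_rel_refl fell_rel_sym fell_rel_trans.

Definition fell : topologicalType := quotient_topology {eq_quot fell_equiv}.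

Definition fell_class s a : fell := \pi_fell (s, a).

Implicit Types l m : fell.

Definition fell_proj l : G := tw_proj (repr l).1.
Definition fell_norm l : R := rnorm (repr l).2.
Definition fell_mul l m : fell :=
  fell_class (gmul (repr l).1 (repr m).1) ((repr l).2 * (repr m).2).
Definition fell_star l : fell :=
  fell_class (ginv (repr l).1) (Num.conj (repr l).2).

(* [fell_coord s l] is the scalar [a] with [l = [s, a]], for [l] in the fibre
   over [tw_proj s]; it transports the linear structure of the fibre to the
   scalars. *)
Definition fell_coord s l : R[i] := xget 0 [set a | fell_class s a = l].
Definition fell_scale a l : fell := fell_class (repr l).1 (a * (repr l).2).
Definition fell_add l m : fell :=
  fell_class (repr l).1 ((repr l).2 + fell_coord (repr l).1 m).

Lemma tw_proj_surj g : exists s : E, tw_proj s = g.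
Proof.
have [U [phi [psi [_ Ug [_ _ h _ _]]]]] := tw_bundle E g.
by exists (phi g 1); have [] := h g 1 Ug circle1.
Qed.

Definition tw_lift g : E := projT1 (cid (tw_proj_surj g)).

Lemma tw_liftK g : tw_proj (tw_lift g) = g.
Proof. by rewrite /tw_lift; case: cid. Qed.

Definition fell_zero g : fell := fell_class (tw_lift g) 0.

(* The sum, in the fibre over [g], of a finitely supported family of elements
   of that fibre. *)
Definition fell_sum (T : choiceType) g (D : set T) (F : T -> fell) : fell :=
  fell_class (tw_lift g) (\sum_(i \in D) fell_coord (tw_lift g) (F i)).

(* The operations above are independent of the chosen representatives. *)

Lemma fell_classP s a t b : fell_class s a = fell_class t b <->
  exists z, [/\ circle z, t = act z s & b = Num.conj z * a].
Proof.
rewrite -[_ = _ :> fell]/((s, a) = (t, b) %[mod {eq_quot fell_equiv}]).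
split=> [/eqP|h]; first by rewrite eqquotE /= => /asboolP.
by apply/eqP; rewrite eqquotE; apply/asboolP.
Qed.

Lemma repr_fell_class s a : exists z,
  [/\ circle z, (repr (fell_class s a)).1 = act z s
    & (repr (fell_class s a)).2 = Num.conj z * a].
Proof. by apply/fell_classP; rewrite /fell_class -surjective_pairing reprK. Qed.

Lemma tw_proj_act z s : circle z -> tw_proj (act z s) = tw_proj s.
Proof.
move=> cz; rewrite /circle_act tw_projM ?tw_incl_src//.
have : (@tw_proj _ _ _ E @^-1` range (gid G)) (tw_incl E (grng s) z).
  by rewrite tw_exact; exists (grng s), z.
move=> [x _ xE]; rewrite -xE.
have : grng (gid G x) = grng s by rewrite xE tw_proj_rng tw_incl_rng.
by rewrite grng_id -tw_proj_rng => ->; rewrite gmul1l.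
Qed.

Lemma fell_proj_class s a : fell_proj (fell_class s a) = tw_proj s.
Proof.
by have [z [cz e _]] := repr_fell_class s a; rewrite /fell_proj e tw_proj_act.
Qed.

Lemma fell_norm_class s a : fell_norm (fell_class s a) = rnorm a.
Proof.
have [z [cz _ e]] := repr_fell_class s a.
by rewrite /fell_norm e /rnorm normrM norm_conjC cz mul1r.
Qed.

Lemma act_mul z w s t : circle z -> circle w -> gsrc s = grng t ->
  gmul (act z s) (act w t) = act (z * w) (gmul s t).
Proof.
move=> cz cw st; have cwz := circleM cw cz; rewrite mulrC.
rewrite /circle_act grng_mul// -gmulA; last 2 first.
- by rewrite tw_incl_src.
- by rewrite st grng_mul ?tw_incl_src ?tw_incl_rng.
rewrite [gmul s _]gmulA ?tw_incl_rng ?tw_incl_src// -st.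
rewrite -(tw_central s cw) -gmulA ?tw_incl_src//.
rewrite gmulA ?tw_incl_src ?tw_incl_rng ?grng_mul//.
by rewrite -tw_inclM// mulrC.
Qed.

Lemma fell_mul_class s a t b : gsrc s = grng t ->
  fell_mul (fell_class s a) (fell_class t b) = fell_class (gmul s t) (a * b).
Proof.
move=> st; have [z [cz e1 e2]] := repr_fell_class s a.
have [w [cw e3 e4]] := repr_fell_class t b.
rewrite /fell_mul e1 e2 e3 e4 act_mul//; apply/esym/fell_classP.
exists (z * w); split=> //; first exact: circleM.
by rewrite rmorphM mulrACA.
Qed.

Lemma act_inj z s : circle z -> act z s = s -> z = 1.
Proof.
move=> cz /(congr1 (fun t => gmul t (ginv s))); rewrite /circle_act.
rewrite -gmulA ?tw_incl_src ?grng_inv// gmulVr => h.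
apply: (@tw_incl_inj _ _ _ E (grng s)) => //; first exact: circle1.
rewrite tw_incl1 -h -[in gid E _](@tw_incl_src _ _ _ E (grng s) z)//.
by rewrite gmul1r.
Qed.

Lemma fell_class_inj s a b : fell_class s a = fell_class s b -> a = b.
Proof.
move=> /fell_classP[z [cz /esym/(act_inj cz) -> ->]].
by rewrite rmorph1 mul1r.
Qed.

Lemma fell_coord_class s a : fell_coord s (fell_class s a) = a.
Proof.
apply: (@fell_class_inj s).
exact: (@xgetPex _ 0 [set b | fell_class s b = fell_class s a]
  (ex_intro _ a erefl)).
Qed.

Lemma fell_star_class s a :
  fell_star (fell_class s a) = fell_class (ginv s) (Num.conj a).
Proof.
have [z [cz e1 e2]] := repr_fell_class s a.
rewrite /fell_star e1 e2; apply/esym/fell_classP; exists (Num.conj z).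
have cz' := circleJ cz; split=> //; last by rewrite rmorphM.
set t := act z s.
have st : gsrc t = gsrc s by rewrite /t /circle_act gsrc_mul ?tw_incl_src.
have rt : grng t = grng s.
  by rewrite /t /circle_act grng_mul ?tw_incl_src ?tw_incl_rng.
have h : gmul (act (Num.conj z) (ginv s)) t = gid E (gsrc t).
  rewrite /t act_mul ?gsrc_inv// circleVJ// act1 gmulVl.
  by rewrite -[in RHS]/t st.
have sr : gsrc (act (Num.conj z) (ginv s)) = grng t.
  by rewrite rt /circle_act gsrc_mul ?tw_incl_src// gsrc_inv.
rewrite -[RHS]gmul1r sr -gmulVr gmulA// ?grng_inv// h.
by rewrite -[ginv t in LHS]gmul1l grng_inv.
Qed.

Lemma fell_scale_class a s b :
  fell_scale a (fell_class s b) = fell_class s (a * b).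
Proof.
have [z [cz e1 e2]] := repr_fell_class s b.
rewrite /fell_scale e1 e2; apply/esym/fell_classP; exists z; split=> //.
by rewrite mulrCA.
Qed.

Lemma fell_add_class s a b :
  fell_add (fell_class s a) (fell_class s b) = fell_class s (a + b).
Proof.
have [z [cz e1 e2]] := repr_fell_class s a.
rewrite /fell_add e1 e2; apply/esym/fell_classP; exists z; split=> //.
have -> : fell_class s b = fell_class (act z s) (Num.conj z * b).
  by apply/fell_classP; exists z.
by rewrite fell_coord_class mulrDr.
Qed.

End FellBundle.

Section ReducedAlgebras.
Variables (R : realType) (X : topologicalType) (G : topGroupoid X).
Variable E : twist R G.
Local Notation L := (fell E).
Implicit Types (f h xi : G -> L) (g : G) (u : X).

Definition is_section f := forall g, fell_proj (f g) = g.

(* The section [a f + h]. *)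
Definition section_lin (a : R[i]) f h : G -> L :=
  fun g => fell_add (fell_scale a (f g)) (h g).

Definition convolution f h : G -> L := fun g =>
  fell_sum g [set ab : G * G | gsrc ab.1 = grng ab.2 /\ gmul ab.1 ab.2 = g]
    (fun ab => fell_mul (f ab.1) (h ab.2)).

Definition involution f : G -> L := fun g => fell_star (f (ginv g)).

Definition nonzero_set f : set G := [set g | f g <> fell_zero E g].

(* The extension by zero of a continuous section on the open Hausdorff set [U]
   whose support, i.e. the closure in [U] of its set of nonzeros, is compact. *)
Definition elementary_section f :=
  is_section f /\ exists U : set G,
    [/\ open U, hausdorff_space (subspace U), {within U, continuous f},
        nonzero_set f `<=` U & compact (closure (nonzero_set f) `&` U)].

(* The linear span of the elementary sections; it is the space of compactly
   supported continuous sections when [G] is Hausdorff. *)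
Definition Cc : set (G -> L) := [set f | exists (n : nat) (c : 'I_n -> R[i])
  (h : 'I_n -> G -> L), (forall k, elementary_section (h k)) /\
  forall g, f g = fell_sum g [set: 'I_n] (fun k => fell_scale (c k) (h k g))].

Definition Bc : set (G -> L) := [set f |
  [/\ is_section f, exists M : R, forall g, fell_norm (f g) <= M,
      forall V : set L, open V -> <<s [set U : set G | open U] >> (f @^-1` V)
    & exists K : set G, compact K /\ nonzero_set f `<=` K]].

(* Vectors of the Hilbert space H_u are represented by functions on [G], of
   which only the values on G_u matter. *)
Definition l2norm u xi : \bar R :=
  ((\esum_(g in [set g | gsrc g = u]) (fell_norm (xi g) ^+ 2)%:E) `^ 2^-1)%E.

Definition unit_ball u : set (G -> L) := [set xi |
  (forall g, gsrc g = u -> fell_proj (xi g) = g) /\ (l2norm u xi <= 1)%E].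

Definition regular_rep u f xi : G -> L := fun g =>
  fell_sum g [set k | gsrc k = u]
    (fun k => fell_mul (f (gmul g (ginv k))) (xi k)).

Definition regular_norm u f : \bar R :=
  ereal_sup [set l2norm u (regular_rep u f xi) | xi in unit_ball u].

(* The 0 only matters when the unit space is empty. *)
Definition reduced_norm f : \bar R :=
  ereal_sup ([set 0%E] `|` [set regular_norm u f | u in [set: X]]).

(* [A] is the completion of the *-algebra [S] for the reduced norm, [j] being
   the canonical map (only its values on [S] matter). These data are unique up
   to an isometric *-isomorphism. *)
Definition reduced_completion (S : set (G -> L)) (A : cstarAlgType R[i])
    (j : (G -> L) -> A) :=
  [/\ forall a f h, S f -> S h -> j (section_lin a f h) = a *: j f + j h,
      forall f h, S f -> S h -> j (convolution f h) = cmul (j f) (j h),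
      forall f, S f -> j (involution f) = cstar (j f),
      forall f, S f -> (rnorm (j f))%:E = reduced_norm f
    & closure (j @` S) = setT].

End ReducedAlgebras.

(* Main.v *)
Require Import Defs.
From HB Require Import structures.
From mathcomp Require Import all_boot all_order all_algebra.
From mathcomp Require Import all_classical all_reals all_analysis.
From mathcomp Require Import generic_quotient finmap complex.
From mathcomp Require Import ring lra.

(* Parts (2) and (3) rest on one obstruction.  Let [q] be a projection and let
   [w k] satisfy [w k^* w l = delta_kl q].  If every sequence [v k] of isometries
   from [q] into [q] has the form [w k^* T w k] for a single [T], then any
   *-homomorphism [pi] into the controlled operators kills [q].  Indeed, take
   [v k = n_k^(-1/2) sum_(l < n_k) +- w l]; for random signs Khintchine's
   inequality spreads [pi (v k) delta_i] over about [n_k] coordinates, whereas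
   [pi (w k)^* pi T pi (w k)] is close to a matrix whose sparsity does not depend
   on [n_k].  Such a [q] comes from any family of infinite systems of matrix
   units, by summing strongly.  In [B(H)] a maximal family of orthonormal
   sequences leaves only a finite-rank complement, which is killed with [q]; in a
   von Neumann algebra with a proper isometry [v] and [p = 1 - v v^*], the matrix
   units [v^i p (v^j)^*] force [pi p = 0].

   In (1), the direct sum of the regular representations acts on [l^2(G)], and a
   compact set meets each source and range fibre in boundedly many points, so
   compactly supported sections act by matrices with boundedly many nonzero
   entries per row and column.  This isometric representation extends to the
   completion.  That the two spaces of sections are closed under convolution is
   seen by cutting a section into pieces supported in bisections, with continuous
   bump functions or with indicator functions of open sets. *)

Set Implicit Arguments.
Unset Strict Implicit.
Unset Printing Implicit Defensive.

Import Order.TTheory GRing.Theory Num.Theory.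
Import numFieldNormedType.Exports.

Local Open Scope classical_set_scope.
Local Open Scope ring_scope.
Local Open Scope complex_scope.
Local Open Scope quotient_scope.

(** * Strong sums of operators *)

(** A *-homomorphism need not be strongly continuous, so nothing about [pi T] can be read off from
    the sum defining [T]. Only algebraic identities such as [w k^* T w k = v k] survive under [pi];
    hence infinitely many spread isometries are packed into one operator. The order of choices is
    decisive: an approximant of [pi (w k)] fixes a sparsity m_k; then n_k is taken so large that
    [pi (v k) delta_i] is far from all vectors with k m_k^2 + 1 nonzero coordinates; only then is
    [T] formed and [pi T] approximated, with a sparsity M not known before. For k >= M, m_k M m_k is
    at most k m_k^2. Strong sums may leave a norm-closed algebra. Those used here commute with
    whatever commutes with their building blocks, so a double commutant contains them. The arrow
    space in (1) need not be Hausdorff: compact sets need not be closed, and a bump function on a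
    bisection, extended by zero, may be discontinuous elsewhere. Closedness and continuity are
    therefore taken relative to open Hausdorff sets. *)

Section SingleSum.
Variables (R : realType) (I : choiceType).

Lemma ge0_sum_single (f : I -> R) j : (forall i, 0 <= f i) ->
  (forall i, i != j -> f i = 0) -> ge0_sum f = f j.
Proof.
move=> f0 fj; have sum_le (A : {fset I}) : \sum_(i <- A) f i <= f j.
  have [jA|jA] := boolP (j \in A).
    by rewrite (big_fsetD1 j)//= big_seq big1 ?addr0// => i;
       rewrite in_fsetD1 => /andP[/fj].
  rewrite big_seq big1 ?f0// => i iA; apply: fj.
  by apply: contraNneq jA => <-.
have [sf le] := bounded_summable f0 sum_le.
apply/eqP; rewrite eq_le le /=.
by have := ge0_sum_finite [fset j]%fset f0 sf; rewrite big_seq_fset1.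
Qed.

Lemma real_sum_single (f : I -> R) j :
  (forall i, i != j -> f i = 0) -> real_sum f = f j.
Proof.
move=> fj; rewrite /real_sum !(@ge0_sum_single _ j)//.
- by case: (leP 0 (f j)) => h; [rewrite max_r|rewrite max_l]; lra.
- by move=> i; rewrite le_max lexx orbT.
- by move=> i /fj ->; rewrite oppr0 maxxx.
- by move=> i; rewrite le_max lexx orbT.
- by move=> i /fj ->; rewrite maxxx.
Qed.

Lemma complex_sum_single (f : I -> R[i]) j :
  (forall i, i != j -> f i = 0) -> complex_sum f = f j.
Proof.
move=> fj; rewrite /complex_sum.
by apply: eq_ReIm => /=; rewrite (real_sum_single (j := j))// => i /fj ->.
Qed.

Lemma real_sum0 : real_sum (fun _ : I => 0) = 0 :> R.
Proof.
by rewrite /real_sum /ge0_sum !esum1 ?subrr// => i _; rewrite ?oppr0 maxxx.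
Qed.

Lemma complex_sum0 : complex_sum (fun _ : I => 0) = 0 :> R[i].
Proof. by apply: eq_ReIm; rewrite /= real_sum0. Qed.

Lemma real_sum_le (f g : I -> R) : (forall i, `|f i| <= g i) ->
  abs_summable g -> `|real_sum f| <= ge0_sum g.
Proof.
move=> fg sg; have sf := abs_summable_le fg sg.
have m0 := @max_ge0 R.
have sp := summable_pos sf; have sn := summable_neg sf.
have : ge0_sum (fun i => Num.max (f i) 0 + Num.max (- f i) 0) <= ge0_sum g.
  have [i|A|//] := @bounded_summable R I
    (fun i => Num.max (f i) 0 + Num.max (- f i) 0) (ge0_sum g).
  - by rewrite addr_ge0.
  - apply: le_trans (ge0_sum_finite A _ sg); last first.
      by move=> i; apply: le_trans (fg i).
    apply: ler_sum => i _; apply: le_trans (fg i).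
    by case: (leP 0 (f i)) => h; [rewrite ger0_norm// max_r|rewrite ltr0_norm// max_l]; lra.
rewrite ge0_sumD// /real_sum.
have p0 : 0 <= ge0_sum (fun i => Num.max (f i) 0) by exact: ge0_sum_ge0.
have n0 : 0 <= ge0_sum (fun i => Num.max (- f i) 0) by exact: ge0_sum_ge0.
rewrite ler_norml => h; apply/andP; split; lra.
Qed.

(** The factor 2 comes from bounding real and imaginary parts separately; it is harmless, since this
    only serves to show that a form is bounded. *)
Lemma complex_sum_le (f : I -> R[i]) (g : I -> R) :
  (forall i, rnorm (f i) <= g i) -> abs_summable g ->
  rnorm (complex_sum f) <= 2 * ge0_sum g.
Proof.
move=> fg sg; apply: (le_trans (rnorm_ReIm _)); rewrite mulr_natl mulr2n.
by apply: lerD; apply: real_sum_le => // i; apply: le_trans (fg i);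
  [exact: rnorm_Re|exact: rnorm_Im].
Qed.

End SingleSum.

Lemma le1_of_sqr (R : realFieldType) (a b : R) : 0 <= a -> a ^+ 2 <= b -> b <= 1 -> a <= 1.
Proof. by move=> a0 ab b1; case: (leP a 1) => // a1; nra. Qed.

Lemma rnormM (R : realType) (a b : R[i]) : rnorm (a * b) = rnorm a * rnorm b.
Proof. exact: (rnormZ a (b : R[i]^o)). Qed.

Section Operators.
Variables (R : realType) (H : hilbertType R[i]).
Implicit Types (S T X Y : bop H) (x y z : H).

Definition projection (q : bop H) := adjoint q = q /\ bop_comp q q = q.

Lemma bop_inner_eq S T : (forall x y, inner (S x) y = inner (T x) y) -> S = T.
Proof.
move=> h; apply: bop_eq => x; apply: inner_inj => y.
by rewrite inner_conj h -inner_conj.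
Qed.

Lemma bop_comp0l S : bop_comp 0 S = 0.
Proof. exact: bop_eq. Qed.
Lemma bop_comp0r S : bop_comp S 0 = 0.
Proof. by apply: bop_eq => x; exact: bop0. Qed.
Lemma bop_comp1l S : bop_comp (bop_id H) S = S.
Proof. exact: bop_eq. Qed.
Lemma adjoint0 : adjoint (0 : bop H) = 0.
Proof. by apply/esym/adjoint_uniq => x y; rewrite inner0l inner_conj inner0l rmorph0. Qed.

Lemma projection_norm q : projection q -> opnorm q <= 1.
Proof.
move=> [qs qq]; have := opnorm_star q; rewrite qs qq => h.
have := opnorm_ge0 q; move: (opnorm q) h {qs qq} => N h N0.
by case: (leP N 1) => // N1; nra.
Qed.

Lemma isometry_norm q v : projection q -> bop_comp (adjoint v) v = q ->
  opnorm v <= 1.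
Proof.
move=> /projection_norm q1 vq; have := opnorm_star v; rewrite vq => h.
by apply: le1_of_sqr (opnorm_ge0 v) _ q1; rewrite h.
Qed.

Lemma projection_inner q x : projection q -> rnorm (q x) ^+ 2 = complex.Re (inner (q x) x).
Proof. by move=> [qs qq]; rewrite rnorm2E !adjointP qs -[q (q x)]/(bop_comp q q x) qq. Qed.

Variable J : choiceType.
Implicit Types (p r : J -> bop H).

Definition orth_projections p := (forall j, projection (p j)) /\
  (forall i j, i != j -> bop_comp (p i) (p j) = 0).

(** For s the sum of the [p j x], orthogonality makes both |s|^2 and Re <s, x> equal to the
    left-hand side, and Cauchy-Schwarz then gives |s| <= |x|. *)
Lemma orth_projections_bessel p (A : seq J) x : orth_projections p ->
  uniq A -> \sum_(j <- A) rnorm (p j x) ^+ 2 <= rnorm x ^+ 2.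
Proof.
move=> [pP pO] uA; pose s (B : seq J) := \sum_(j <- B) p j x.
pose n (B : seq J) := \sum_(j <- B) rnorm (p j x) ^+ 2.
have h1 B : complex.Re (inner (s B) x) = n B.
  rewrite /s /n; elim: B => [|j B IH]; first by rewrite !big_nil inner0l.
  by rewrite !big_cons innerDl ReD IH projection_inner.
have h2 : rnorm (s A) ^+ 2 = n A.
  rewrite /s /n; elim: A uA => [_|j B IH /= /andP[jB uB]].
    by rewrite !big_nil rnorm0 expr0n.
  rewrite !big_cons rnorm2D IH//.
  suff -> : inner (p j x) (\sum_(i <- B) p i x) = 0 by rewrite mulr0 addr0.
  elim: B jB {IH uB} => [|i B IH]; first by rewrite big_nil inner_conj inner0l rmorph0.
  rewrite in_cons negb_or => /andP[ji jB]; rewrite big_cons innerDr IH// addr0.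
  have [ps _] := pP j.
  by rewrite adjointP ps -[p j _]/(bop_comp (p j) (p i) x) pO// inner_conj inner0l rmorph0.
have := cauchy_schwarz (s A) x.
have := ler_norm (complex.Re (inner (s A) x)).
have := rnorm_Re (inner (s A) x).
rewrite h1 -/(n _) -h2.
have := rnorm_ge0 (s A); have := rnorm_ge0 x.
move: (rnorm (s _)) (rnorm x) (rnorm (inner _ _)) `|_| => a b c d.
move=> b0 a0 h3 h4 h5.
have [->|a1] := eqVneq a 0; first by rewrite expr0n sqr_ge0.
have ap : 0 < a by rewrite lt_def a1.
have : a <= b by rewrite -(ler_pM2l ap) -expr2; lra.
by move=> ab; rewrite lerXn2r.
Qed.

Lemma orth_projections_summable p x : orth_projections p ->
  abs_summable (fun j => rnorm (p j x) ^+ 2) /\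
  ge0_sum (fun j => rnorm (p j x) ^+ 2) <= rnorm x ^+ 2.
Proof.
move=> pP; apply: bounded_summable => [j|A]; first exact: sqr_ge0.
exact/orth_projections_bessel/fset_uniq.
Qed.

(** Phrased through matrix coefficients, so that a fixed factor on the right is absorbed in [u] and
    one on the left, by its adjoint, in [v]: products pass through the sum without any limit
    argument. *)
Definition strong_sum (x : J -> bop H) X := forall u v,
  inner (X u) v = complex_sum (fun j => inner (x j u) v).

Lemma strong_sum_uniq (x : J -> bop H) X Y :
  strong_sum x X -> strong_sum x Y -> X = Y.
Proof. by move=> hX hY; apply: bop_inner_eq => u v; rewrite hX hY. Qed.

Lemma strong_sum_compl S (x : J -> bop H) X : strong_sum x X ->
  strong_sum (fun j => bop_comp S (x j)) (bop_comp S X).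
Proof.
move=> hX u v; rewrite /= adjointP hX; congr complex_sum.
by apply/funext => j; rewrite -adjointP.
Qed.

Lemma strong_sum_compr S (x : J -> bop H) X : strong_sum x X ->
  strong_sum (fun j => bop_comp (x j) S) (bop_comp X S).
Proof. by move=> hX u v; rewrite /= hX. Qed.

Lemma strong_sum_single (x : J -> bop H) j : (forall i, i != j -> x i = 0) ->
  strong_sum x (x j).
Proof.
move=> xj u v; rewrite (@complex_sum_single _ _ _ j)// => i /xj ->.
exact: inner0l.
Qed.

Lemma strong_sum_zero (x : J -> bop H) : (forall i, x i = 0) -> strong_sum x 0.
Proof.
move=> x0 u v; rewrite inner0l -[LHS](@complex_sum0 R J).
by congr complex_sum; apply/funext => i; rewrite x0 inner0l.
Qed.

(* The sum is built from its sesquilinear form: the bound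
   |<x_j u, v>| <= |p_j u| |r_j v| and Bessel's inequality make the form
   bounded. *)
Lemma strong_sum_exists p r (x : J -> bop H) :
  orth_projections p -> orth_projections r ->
  (forall j, bop_comp (r j) (bop_comp (x j) (p j)) = x j) ->
  (forall j, opnorm (x j) <= 1) -> exists X, strong_sum x X.
Proof.
move=> pP rP xE x1.
have bd u v j : rnorm (inner (x j u) v) <= rnorm (p j u) * rnorm (r j v).
  rewrite -xE /= adjointP; have [-> _] := rP.1 j.
  rewrite (le_trans (cauchy_schwarz _ _))// ler_wpM2r ?rnorm_ge0//.
  by rewrite (le_trans (opnormP _ _))// ler_piMl ?rnorm_ge0.
have bd2 u v j : rnorm (inner (x j u) v) <=
    2^-1 * (rnorm (p j u) ^+ 2) + 2^-1 * (rnorm (r j v) ^+ 2).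
  apply: (le_trans (bd u v j)).
  have := sqr_ge0 (rnorm (p j u) - rnorm (r j v)); nra.
have sb u v : abs_summable
    (fun j => 2^-1 * (rnorm (p j u) ^+ 2) + 2^-1 * (rnorm (r j v) ^+ 2)).
  by apply: abs_summableD; apply: abs_summableZ;
     [have [] := orth_projections_summable u pP|
      have [] := orth_projections_summable v rP].
have sm u v : abs_summable (fun j => rnorm (inner (x j u) v)).
  apply: abs_summable_le (sb u v) => j.
  by rewrite ger0_norm ?rnorm_ge0.
pose B u v := complex_sum (fun j => inner (x j u) v).
have BB u v : rnorm (B u v) <= rnorm u ^+ 2 + rnorm v ^+ 2.
  apply: (le_trans (complex_sum_le (bd2 u v) (sb u v))).
  have [su lu] := orth_projections_summable u pP.
  have [sv lv] := orth_projections_summable v rP.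
  rewrite ge0_sumD; first last.
  - exact: abs_summableZ.
  - by move=> i; rewrite mulr_ge0 ?sqr_ge0 ?invr_ge0.
  - exact: abs_summableZ.
  - by move=> i; rewrite mulr_ge0 ?sqr_ge0 ?invr_ge0.
  rewrite !ge0_sumZ ?invr_ge0//; try by move=> i; exact: sqr_ge0.
  by move: lu lv; set s := ge0_sum _; set t := ge0_sum _; lra.
have Bl (a : R[i]) u u' v : B (a *: u + u') v = a * B u v + B u' v.
  rewrite /B -complex_sumZ ?sm// -complex_sumD.
  - by congr complex_sum; apply/funext => j; rewrite bop_linear inner_linearl.
  - by have := sm (a *: u) v; congr abs_summable; apply/funext => j;
       rewrite bopZ innerZl.
  - exact: sm.
have BJ u v : Num.conj (B u v) = complex_sum (fun j => inner v (x j u)).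
  rewrite /B -complex_sumJ ?sm//; congr complex_sum.
  by apply/funext => j; rewrite -inner_conj.
have sm' u v : abs_summable (fun j => rnorm (inner v (x j u))).
  have := sm u v; congr abs_summable; apply/funext => j.
  by rewrite inner_conj rnormJ.
have BJl (a : R[i]) u v v' :
    Num.conj (B u (a *: v + v')) = a * Num.conj (B u v) + Num.conj (B u v').
  rewrite !BJ -complex_sumZ ?sm'// -complex_sumD ?sm'//.
    by congr complex_sum; apply/funext => j; rewrite inner_linearl.
  by have := sm' u (a *: v); congr abs_summable; apply/funext => j;
     rewrite innerZl.
have B0l v : B 0 v = 0.
  rewrite /B -[RHS](@complex_sum0 R J); congr complex_sum.
  by apply/funext => j; rewrite bop0 inner0l.
have BZl (a : R[i]) u v : B (a *: u) v = a * B u v.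
  by have := Bl a u 0 v; rewrite addr0 B0l addr0.
have BJZ (a : R[i]) u v : Num.conj (B u (a *: v)) = a * Num.conj (B u v).
  have := BJl a u v 0; rewrite addr0 => ->.
  suff -> : Num.conj (B u 0) = 0 by rewrite addr0.
  by rewrite BJ -[RHS](@complex_sum0 R J); congr complex_sum;
     apply/funext => j; rewrite inner0l.
(* Scaling [u] and [v] to unit vectors turns the quadratic bound [BB] into boundedness of the
   form. *)
have Bb u v : rnorm (B u v) <= 2 * rnorm u * rnorm v.
  have [->|u0] := eqVneq u 0; first by rewrite B0l !rnorm0 mulr0 mul0r.
  have [->|v0] := eqVneq v 0.
    rewrite rnorm0 mulr0 -rnormJ -(scale0r v) BJZ mul0r rnorm0//.
  have nu : 0 < rnorm u by rewrite lt_def rnorm_ge0 andbT; apply: contraNneq u0 => /rnorm0_eq0 ->.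
  have nv : 0 < rnorm v by rewrite lt_def rnorm_ge0 andbT; apply: contraNneq v0 => /rnorm0_eq0 ->.
  pose a := (rnorm u)^-1; pose b := (rnorm v)^-1.
  have a0 : 0 < a by rewrite invr_gt0.
  have b0 : 0 < b by rewrite invr_gt0.
  have := BB (a%:C *: u) (b%:C *: v).
  have au : a * rnorm u = 1 by rewrite mulVf// gt_eqF.
  have bv : b * rnorm v = 1 by rewrite mulVf// gt_eqF.
  rewrite !rnorm2Zr -!exprMn au bv expr1n BZl rnormM -[rnorm (B u _)]rnormJ BJZ.
  rewrite rnormM rnormJ !rnorm_real !gtr0_norm// => le2.
  have -> : rnorm (B u v) = rnorm u * rnorm v * (a * (b * rnorm (B u v))).
    transitivity ((a * rnorm u) * (b * rnorm v) * rnorm (B u v)); last by ring.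
    by rewrite au bv !mul1r.
  have -> : 2 * rnorm u * rnorm v = rnorm u * rnorm v * 2 by ring.
  by rewrite ler_pM2l ?mulr_gt0// (le_trans le2).
(* [B u] is antilinear in [v], so the Riesz theorem is applied to its conjugate. *)
have /choice [X XP] : forall u, exists z, forall v, Num.conj (B u v) = inner v z.
  move=> u; apply: (@riesz _ _ (fun v => Num.conj (B u v)) (2 * rnorm u)).
    by move=> a v v'; exact: BJl.
  by move=> v; rewrite rnormJ.
have XE u v : inner (X u) v = B u v by rewrite inner_conj -XP conjCK.
have Xl (a : R[i]) u v : X (a *: u + v) = a *: X u + X v.
  apply: inner_inj => z; rewrite inner_conj XE Bl.
  by rewrite [RHS]inner_conj inner_linearl !XE.
have Xb : exists M : R, forall u, rnorm (X u) <= M * rnorm u.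
  exists 2 => u; have [->|z0] := eqVneq (rnorm (X u)) 0.
    by rewrite mulr_ge0 ?rnorm_ge0.
  have zp : 0 < rnorm (X u) by rewrite lt_def z0 rnorm_ge0.
  rewrite -(ler_pM2r zp) -expr2 rnorm2E XE.
  by rewrite (le_trans (ler_norm _))// (le_trans (rnorm_Re _)).
by exists (Bop Xl Xb) => u v; rewrite /= XE.
Qed.

End Operators.

(** * Isometries assembled from matrix units *)

Section MatrixUnits.
Variables (R : realType) (H : hilbertType R[i]) (A : choiceType).
Variable u : A -> nat -> nat -> bop H.
Hypothesis uJ : forall a i j, adjoint (u a i j) = u a j i.
Hypothesis uM : forall a b i j k l, bop_comp (u a i j) (u b k l) =
  if (a == b) && (j == k) then u a i l else 0.

Lemma matrix_units_diag (f : nat -> nat) : injective f ->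
  orth_projections (fun n : A * nat => u n.1 (f n.2) (f n.2)).
Proof.
move=> fI; split=> [[a j]|[a i] [b j] ne] /=.
  by split; rewrite ?uJ// uM !eqxx.
rewrite uM; case: ifP => // /andP[/eqP ab /eqP/fI ij].
by rewrite ab ij eqxx in ne.
Qed.

(** [q] sums the diagonal units, and [w k] sums the units that move row j to row [c k j] in every
    system, so that the [w k] map the range of [q] into mutually orthogonal subspaces. The last two
    clauses are the traces of strong convergence used later: annihilating, or commuting with, all
    units passes to the sums. *)
Lemma matrix_units_isometries : exists (q : bop H) (w : nat -> bop H),
  [/\ projection q,
      forall k l, bop_comp (adjoint (w k)) (w l) = if k == l then q else 0,
      forall k, bop_comp q (w k) = w k /\ bop_comp (w k) q = w k,
      (forall a i j, bop_comp q (u a i j) = u a i j) /\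
      (forall S, (forall a i j, bop_comp S (u a i j) = 0) -> bop_comp S q = 0)
    & forall S, (forall a i j, bop_comp S (u a i j) = bop_comp (u a i j) S) ->
        bop_comp S q = bop_comp q S /\
        forall k, bop_comp S (w k) = bop_comp (w k) S].
Proof.
(* The maps [c k] are injective with pairwise disjoint images: they carve infinitely many infinite
   sets of rows out of one. *)
pose c (k j : nat) : nat := choice.pickle (k, j).
have cI k : injective (c k) by move=> i j /(pcan_inj (@choice.pickleK _)) [].
have cE k l i j : (c k i == c l j) = (k == l) && (i == j).
  apply/eqP/andP => [/(pcan_inj (@choice.pickleK _)) [-> ->]|[/eqP-> /eqP->]//].
  by rewrite !eqxx.
pose p (n : A * nat) := u n.1 n.2 n.2.
pose x k (n : A * nat) := u n.1 (c k n.2) n.2.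
pose r k (n : A * nat) := u n.1 (c k n.2) (c k n.2).
have pP : orth_projections p := matrix_units_diag (@inj_id nat).
have rP k : orth_projections (r k) := matrix_units_diag (cI k).
have xs k n : bop_comp (adjoint (x k n)) (x k n) = p n.
  by rewrite uJ uM !eqxx.
have x1 k n : opnorm (x k n) <= 1 by apply: isometry_norm (xs k n); exact: pP.1.
have p1 n : opnorm (p n) <= 1 by exact/projection_norm/pP.1.
have [n|q qP] := strong_sum_exists pP pP _ p1; first by rewrite !(uM, eqxx).
have /choice[w wP] k : exists X, strong_sum (x k) X.
  by apply: (strong_sum_exists pP (rP k)) => // n; rewrite !(uM, eqxx).
(* Model for the identities below: multiply the sum termwise by a fixed operator, see that one term
   survives (or none, or that the family is unchanged), and conclude by uniqueness of strong
   sums. *)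
have qu a i j : bop_comp q (u a i j) = u a i j.
  apply: strong_sum_uniq (strong_sum_compr (u a i j) qP) _.
  have := @strong_sum_single _ _ _ (fun n => bop_comp (p n) (u a i j)) (a, i).
  rewrite {2}/p uM !eqxx; apply => -[b k] ne.
  by rewrite uM -[_ && _]/((b, k) == (a, i)) (negPf ne).
have uq a i j : bop_comp (u a i j) q = u a i j.
  apply: strong_sum_uniq (strong_sum_compl (u a i j) qP) _.
  have := @strong_sum_single _ _ _ (fun n => bop_comp (u a i j) (p n)) (a, j).
  rewrite {2}/p uM !eqxx; apply => -[b k] ne.
  by rewrite uM -[_ && _]/((a, j) == (b, k)) eq_sym (negPf ne).
have qw k : bop_comp q (w k) = w k.
  apply: strong_sum_uniq (strong_sum_compl q (wP k)) _.
  by have := wP k; congr strong_sum; apply/funext => n; rewrite qu.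
have qq : bop_comp q q = q.
  apply: strong_sum_uniq (strong_sum_compl q qP) _.
  by have := qP; congr strong_sum; apply/funext => n; rewrite qu.
have qs : adjoint q = q.
  (* [q^* q] is self-adjoint, so this avoids taking the adjoint of a strong sum. *)
  suff h : bop_comp (adjoint q) q = q by rewrite -h adjoint_comp adjointK h.
  apply: strong_sum_uniq (strong_sum_compl (adjoint q) qP) _.
  have := qP; congr strong_sum; apply/funext => n.
  by rewrite -(adjointK (p n)) -adjoint_comp uJ uq.
have xw k l n : bop_comp (adjoint (x l n)) (w k) = if k == l then p n else 0.
  rewrite uJ; apply: strong_sum_uniq (strong_sum_compl (u n.1 n.2 (c l n.2)) (wP k)) _.
  have [<-|kl] := eqVneq k l; last first.
    apply: strong_sum_zero => m; rewrite uM cE eq_sym eq_sym.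
    by case: ifP => // /and3P[_]; rewrite eq_sym (negPf kl).
  have := @strong_sum_single _ _ _
    (fun m => bop_comp (u n.1 n.2 (c k n.2)) (x k m)) n.
  rewrite {2}/x uM !eqxx; apply => -[b i] ne; rewrite uM.
  case: ifP => // /andP[/eqP ab /eqP/cI ki].
  by case: n ab ki ne => a' j /= -> ->; rewrite eqxx.
exists q, w; split=> //.
- move=> k l; apply: strong_sum_uniq (strong_sum_compl (adjoint (w k)) (wP l)) _.
  have E n : bop_comp (adjoint (w k)) (x l n) = if k == l then p n else 0.
    rewrite -(adjointK (x l n)) -adjoint_comp xw.
    by case: ifP; rewrite ?adjoint0 ?uJ.
  case: eqP E => [_|_] E; first by have := qP; congr strong_sum; apply/funext.
  exact: strong_sum_zero.
- move=> k; split=> //; apply: strong_sum_uniq (strong_sum_compr q (wP k)) _.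
  have := wP k; congr strong_sum; apply/funext => n.
  by rewrite uq.
- split=> // S uS; apply: strong_sum_uniq (strong_sum_compl S qP) _.
  by apply: strong_sum_zero => n; rewrite uS.
- move=> S uS; split=> [|k].
    apply: strong_sum_uniq (strong_sum_compl S qP) _.
    have := strong_sum_compr S qP; congr strong_sum; apply/funext => n.
    by rewrite uS.
  apply: strong_sum_uniq (strong_sum_compl S (wP k)) _.
  have := strong_sum_compr S (wP k); congr strong_sum; apply/funext => n.
  by rewrite uS.
Qed.

End MatrixUnits.

(** [T] is block diagonal, the strong sum of the [w k v k w k^*]; compression by [w k] picks out one
    block. The commutation clause is what later places [T] in a double commutant. *)
Lemma strong_sum_dilation (R : realType) (H : hilbertType R[i]) (q : bop H)
    (w v : nat -> bop H) :
  projection q ->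
  (forall k l, bop_comp (adjoint (w k)) (w l) = if k == l then q else 0) ->
  (forall k, bop_comp (w k) q = w k) ->
  (forall k, bop_comp (adjoint (v k)) (v k) = q) ->
  (forall k, bop_comp q (v k) = v k /\ bop_comp (v k) q = v k) ->
  exists T, (forall k, bop_comp (adjoint (w k)) (bop_comp T (w k)) = v k) /\
    forall S, (forall k, bop_comp S (w k) = bop_comp (w k) S) ->
      (forall k, bop_comp S (adjoint (w k)) = bop_comp (adjoint (w k)) S) ->
      (forall k, bop_comp S (v k) = bop_comp (v k) S) ->
      bop_comp S T = bop_comp T S.
Proof.
move=> qP wM wq vs vq.
pose p k := bop_comp (w k) (adjoint (w k)).
have wK k : bop_comp (p k) (w k) = w k by rewrite -bop_compA wM eqxx wq.
have wJ k : bop_comp (adjoint (w k)) (p k) = adjoint (w k).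
  by rewrite bop_compA wM eqxx -[in LHS](proj1 qP) -adjoint_comp wq.
have pP : orth_projections p.
  split=> [k|k l kl]; first split.
  - by rewrite adjoint_comp adjointK.
  - by rewrite bop_compA wK.
  - by rewrite -bop_compA [X in bop_comp _ X]bop_compA wM (negPf kl) bop_comp0l bop_comp0r.
pose x k := bop_comp (w k) (bop_comp (v k) (adjoint (w k))).
have w1 k : opnorm (w k) <= 1.
  by apply: (isometry_norm qP); rewrite wM eqxx.
have w1' k : opnorm (adjoint (w k)) <= 1.
  by apply: le_trans (opnorm_adjoint_le _) _; rewrite adjointK.
have v1 k : opnorm (v k) <= 1 by exact: isometry_norm qP _.
have x1 k : opnorm (x k) <= 1.
  apply: le_trans (opnorm_comp _ _) _; rewrite mulr_ile1 ?opnorm_ge0//.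
  by apply: le_trans (opnorm_comp _ _) _; rewrite mulr_ile1 ?opnorm_ge0.
have [k|T TP] := strong_sum_exists pP pP _ x1.
  by rewrite /x bop_compA [X in bop_comp X _]bop_compA wK -!bop_compA wJ.
have Tw k : bop_comp T (w k) = bop_comp (w k) (v k).
  apply: strong_sum_uniq (strong_sum_compr (w k) TP) _.
  have := @strong_sum_single _ _ _ (fun m => bop_comp (x m) (w k)) k.
  rewrite {2}/x -!bop_compA wM eqxx (vq k).2; apply => l lk.
  by rewrite -!bop_compA wM (negPf lk) !bop_comp0r.
exists T; split=> [k|S Sw Sw' Sv]; first by rewrite Tw bop_compA wM eqxx (vq k).1.
apply: strong_sum_uniq (strong_sum_compl S TP) _.
have := strong_sum_compr S TP; congr strong_sum; apply/funext => k.
by rewrite /x -!bop_compA -Sw' [RHS]bop_compA Sw -[RHS]bop_compA;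
   congr bop_comp; rewrite bop_compA -Sv -!bop_compA.
Qed.

(** * Sparsity and spread isometries *)

Section Sparse.
Variables (R : realType) (I : choiceType).
Local Notation L2 := (ell2 R I).
Local Notation delta := (@ell2_basis R I).
Implicit Types (x y z : L2) (T S : bop L2).

Definition sparse m x := exists s : seq I,
  (size s <= m)%N /\ forall i, i \notin s -> x i = 0.

Lemma ell2_inner_basis x i : inner x (delta i) = x i.
Proof.
rewrite -[LHS]/(complex_sum _) (@complex_sum_single _ _ _ i) /= => [|j ji].
  by rewrite eqxx rmorph1 mulr1.
by rewrite eq_sym (negPf ji) rmorph0 mulr0.
Qed.

Lemma ell2_basis_norm i : rnorm (delta i) = 1.
Proof.
apply/eqP; rewrite -(eqrXn2 (n := 2))// ?rnorm_ge0// expr1n rnorm2E.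
by rewrite ell2_inner_basis /= eqxx.
Qed.

Lemma mx_entryE T i j : mx_entry T i j = T (delta j) i.
Proof. exact: ell2_inner_basis. Qed.

Lemma mx_entry_adjoint T i j :
  mx_entry (adjoint T) i j = Num.conj (mx_entry T j i).
Proof. by rewrite /mx_entry inner_conj -adjointP. Qed.

Lemma bop_eq0_basis T : (forall i, T (delta i) = 0) -> T = 0.
Proof.
move=> T0; rewrite -(adjointK T); suff -> : adjoint T = 0 by rewrite adjoint0.
apply: bop_eq => y; apply: ell2_eq => i.
by rewrite -ell2_inner_basis inner_conj -adjointP T0 inner0l rmorph0.
Qed.

Lemma sparse_sum m x : sparse m x -> exists2 s : seq I, (size s <= m)%N &
  x = \sum_(i <- s) x i *: delta i.
Proof.
move=> [s [sm xs]]; exists (undup s); first exact: leq_trans (size_undup s) sm.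
apply: ell2_eq => j.
have sumE (t : seq I) :
    (\sum_(i <- t) x i *: delta i : L2) j = \sum_(i <- t) x i * (i == j)%:R.
  by elim: t => [|i t IH]; rewrite ?big_nil// !big_cons ell2_addE IH.
rewrite sumE; have [js|js] := boolP (j \in undup s).
  rewrite (bigD1_seq j)//= ?undup_uniq// eqxx mulr1 big1 ?addr0// => i.
  by move=> /negPf ->; rewrite mulr0.
have -> : x j = 0 by apply: xs; rewrite -mem_undup.
rewrite big_seq big1// => i it.
by case: eqP => [ij|_]; rewrite ?mulr0//; rewrite -ij it in js.
Qed.

Lemma sparse_le m n x : (m <= n)%N -> sparse m x -> sparse n x.
Proof. by move=> mn [s [sm xs]]; exists s; split=> //; exact: leq_trans mn. Qed.

Lemma sparseD m n x y : sparse m x -> sparse n y -> sparse (m + n) (x + y).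
Proof.
move=> [s [sm xs]] [t [tn yt]]; exists (s ++ t); split.
  by rewrite size_cat leq_add.
move=> i; rewrite mem_cat negb_or => /andP[si ti].
by rewrite ell2_addE xs// yt// addr0.
Qed.

Lemma sparseZ m (a : R[i]) x : sparse m x -> sparse m (a *: x).
Proof.
move=> [s [sm xs]]; exists s; split=> // i si.
by rewrite ell2_scaleE xs// mulr0.
Qed.

Lemma sparse_bop k m T x : (forall i, sparse m (T (delta i))) ->
  sparse k x -> sparse (k * m) (T x).
Proof.
move=> Tm /sparse_sum[s sk ->]; apply: (@sparse_le (size s * m)).
  by rewrite leq_mul2r sk orbT.
elim: s (x) {sk} => [|i s IH] y; first by rewrite big_nil bop0; exists [::].
by rewrite big_cons bopD bopZ /= mulSn; apply: sparseD (sparseZ _ (Tm i)) (IH y).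
Qed.

Lemma propagation_col m T j : propagation_le m T -> sparse m (T (delta j)).
Proof.
move=> [_ /(_ j)] h; exists (fset_set [set i | mx_entry T i j != 0]).
split; first by apply: geq_card_fset_set.
move=> i; rewrite in_fset_set; last exact: card_le_finite h (finite_II m).
by rewrite notin_setE /= mx_entryE => /negP; rewrite negbK => /eqP.
Qed.

Lemma propagation_adjoint m T : propagation_le m T -> propagation_le m (adjoint T).
Proof.
have E i j : (mx_entry (adjoint T) i j != 0) = (mx_entry T j i != 0).
  by rewrite mx_entry_adjoint conjC_eq0.
by move=> [h1 h2]; split=> i; under eq_set do rewrite E; [exact: h2|exact: h1].
Qed.

Lemma controlled_approx T e : controlled_operators T -> 0 < e ->
  exists m T', propagation_le m T' /\ opnorm (T - T') < e.
Proof.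
move=> Tc e0; have /Tc : nbhs T [set S : bop L2 | rnorm (T - S) < e].
  by have /rcvgP := @cvg_id _ (nbhs T); apply.
by move=> [S [[m _ Sm] ST]]; exists m, S.
Qed.

End Sparse.

(** * Sums over sign patterns and their moments *)

Section Signs.
Variable R : realType.

Definition set_sign (sigma : nat -> bool) n b : nat -> bool :=
  fun k => if k == n then b else sigma k.

(** The 2^n patterns on the indices below [n], all equal to [false] beyond; a sum over this list is
    2^n times an expectation over independent random signs. *)
Fixpoint signs n : seq (nat -> bool) :=
  if n is n'.+1 then
    [seq set_sign sigma n' true | sigma <- signs n'] ++
    [seq set_sign sigma n' false | sigma <- signs n']
  else [:: fun=> false].

Lemma sum_signs_const n (c : R) : \sum_(sigma <- signs n) c = 2 ^+ n * c.
Proof.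
elim: n => [|n IH]; first by rewrite /= big_seq1 expr0 mul1r.
by rewrite /= big_cat !big_map /= IH exprS; ring.
Qed.

Definition sign_sum (V : lmodType R[i]) (a : nat -> V) n (sigma : nat -> bool) : V :=
  \sum_(k < n) (-1) ^+ sigma k *: a k.

Lemma sign_sumS (V : lmodType R[i]) (a : nat -> V) n sigma b :
  sign_sum a n.+1 (set_sign sigma n b) = sign_sum a n sigma + (-1) ^+ b *: a n.
Proof.
rewrite /sign_sum big_ord_recr /= /set_sign eqxx; congr (_ + _).
by apply: eq_bigr => k _; rewrite ltn_eqF.
Qed.

(** The factor n^(-1/2) makes this an isometry when the [a k] are isometries with orthogonal ranges:
    cross terms vanish and the n diagonal terms are equal. *)
Definition spread (V : lmodType R[i]) (a : nat -> V) n sigma : V :=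
  ((Num.sqrt n%:R)^-1)%:C *: sign_sum a n sigma.

Lemma rnorm2_ReIm (z : R[i]) :
  rnorm z ^+ 2 = complex.Re z ^+ 2 + complex.Im z ^+ 2.
Proof.
by case: z => a b; rewrite /rnorm normc_def /= sqr_sqrtr// addr_ge0 ?sqr_ge0.
Qed.

Lemma rnorm2_sign (z w : R[i]) :
  rnorm (z + w) ^+ 2 + rnorm (z - w) ^+ 2 = 2 * rnorm z ^+ 2 + 2 * rnorm w ^+ 2.
Proof. by rewrite !rnorm2_ReIm; case: z => a b; case: w => c d /=; ring. Qed.

(** The mixed terms are 4 |z|^2 |w|^2 plus 8 times the square of the real inner product of z and w.
    Lagrange's identity bounds that square by |z|^2 |w|^2, with defect (ad - bc)^2; hence 12 = 4 +
    8. *)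
Lemma rnorm4_sign (z w : R[i]) :
  rnorm (z + w) ^+ 4 + rnorm (z - w) ^+ 4 <=
  2 * rnorm z ^+ 4 + 12 * (rnorm w ^+ 2 * rnorm z ^+ 2) + 2 * rnorm w ^+ 4.
Proof.
have e4 (x : R) : x ^+ 4 = (x ^+ 2) ^+ 2 by rewrite -exprM.
rewrite !e4 !rnorm2_ReIm; case: z => a b; case: w => c d /=.
have := sqr_ge0 (a * d - b * c); rewrite -subr_ge0 => h.
rewrite -subr_ge0 (_ : _ - _ = 8 * ((a * d - b * c) ^+ 2 - 0)); last by ring.
by rewrite mulr_ge0.
Qed.

Lemma sign_sum_moment2 (a : nat -> R[i]) n :
  \sum_(sigma <- signs n) rnorm (sign_sum (a : nat -> R[i]^o) n sigma) ^+ 2 =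
  2 ^+ n * \sum_(k < n) rnorm (a k) ^+ 2.
Proof.
elim: n => [|n IH].
  by rewrite /= big_seq1 /sign_sum !big_ord0 rnorm0 expr0n mulr0.
rewrite /= big_cat !big_map /= -big_split /= big_ord_recr /= mulrDr exprS -mulrA.
rewrite -IH mulr_sumr -[X in _ = _ + X](_ : \sum_(s <- signs n) 2 * rnorm (a n) ^+ 2 = _).
  rewrite -big_split; apply: eq_bigr => sigma _ /=.
  rewrite !sign_sumS expr1 expr0 scaleN1r scale1r addrC; exact: rnorm2_sign.
by rewrite sum_signs_const; ring.
Qed.

(* Khintchine's inequality for the fourth moment. *)
Lemma sign_sum_moment4 (a : nat -> R[i]) n :
  \sum_(sigma <- signs n) rnorm (sign_sum (a : nat -> R[i]^o) n sigma) ^+ 4 <=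
  2 ^+ n * (3 * (\sum_(k < n) rnorm (a k) ^+ 2) ^+ 2).
Proof.
elim: n => [|n IH].
  by rewrite /= big_seq1 /sign_sum !big_ord0 rnorm0 !expr0n !mulr0.
rewrite /= big_cat !big_map /= -big_split /= big_ord_recr /=.
set Q := \sum_(k < n) _ in IH *; set y := rnorm (a n).
have le4 sigma : rnorm (sign_sum (a : nat -> R[i]^o) n.+1 (set_sign sigma n true)) ^+ 4 +
    rnorm (sign_sum (a : nat -> R[i]^o) n.+1 (set_sign sigma n false)) ^+ 4 <=
    2 * rnorm (sign_sum (a : nat -> R[i]^o) n sigma) ^+ 4 +
    12 * (y ^+ 2 * rnorm (sign_sum (a : nat -> R[i]^o) n sigma) ^+ 2) + 2 * y ^+ 4.
  rewrite !sign_sumS expr1 expr0 scaleN1r scale1r addrC; exact: rnorm4_sign.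
apply: (le_trans (ler_sum _ (fun sigma _ => le4 sigma))).
rewrite !big_split /= sum_signs_const -!mulr_sumr sign_sum_moment2 -/Q.
rewrite [2 ^+ n.+1]exprS; set N := 2 ^+ n in IH *.
have N0 : 0 <= N by rewrite exprn_ge0.
have : 0 <= N * y ^+ 4 by rewrite mulr_ge0// exprn_ge0// rnorm_ge0.
move: IH; set E4 := \sum_(_ <- _) _ => IH yN.
(* The mixed term 12 y^2 Q N is matched exactly, which dictates the constant 3; the fourth powers of
   the new coefficient leave slack, 2 against 6. *)
have -> : 2 * N * (3 * (Q + y ^+ 2) ^+ 2) =
  2 * (N * (3 * Q ^+ 2)) + 12 * (y ^+ 2 * (N * Q)) + 6 * (N * y ^+ 4) by ring.
have -> : N * (2 * y ^+ 4) = 2 * (N * y ^+ 4) by ring.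
by lra.
Qed.

End Signs.

(** * Spread vectors are far from sparse ones *)

Section SpreadIsometry.
Variables (R : realType) (I : choiceType).
Local Notation L2 := (ell2 R I).
Local Notation delta := (@ell2_basis R I).

(** Pythagoras for the splitting of [y] along [s]. The part off [s] is given by its coordinates: it
    is the only [z] meeting both conditions. *)
Lemma ell2_rnorm2_le (y : L2) (s : seq I) (d : R) : uniq s ->
  (forall z : L2, (forall i, i \notin s -> z i = y i) ->
     (forall i, i \in s -> z i = 0) -> rnorm z ^+ 2 <= d) ->
  rnorm y ^+ 2 <= \sum_(i <- s) rnorm (y i) ^+ 2 + d.
Proof.
move=> us h; pose x := \sum_(i <- s) y i *: delta i.
have sumE (t : seq I) j :
    (\sum_(i <- t) y i *: delta i : L2) j = \sum_(i <- t) y i * (i == j)%:R.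
  by elim: t => [|i t IH]; rewrite ?big_nil// !big_cons ell2_addE IH.
have xs j : j \in s -> x j = y j.
  move=> js; rewrite sumE (bigD1_seq j)//= eqxx mulr1 big1 ?addr0// => i.
  by move=> /negPf ->; rewrite mulr0.
have xn j : j \notin s -> x j = 0.
  move=> js; rewrite sumE big_seq big1// => i it.
  by case: eqP => [ij|_]; rewrite ?mulr0//; rewrite -ij it in js.
have zd : rnorm (y - x) ^+ 2 <= d.
  by apply: h => i si; rewrite ell2_subE; [rewrite xn ?subr0|rewrite xs ?subrr].
have innerx (z : L2) : inner x z = \sum_(i <- s) y i * Num.conj (z i).
  rewrite /x; elim: (s) => [|i t IH]; first by rewrite !big_nil inner0l.
  rewrite !big_cons innerDl innerZl IH; congr (_ * _ + _).
  by rewrite inner_conj ell2_inner_basis.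
have xy0 : inner x (y - x) = 0.
  rewrite innerx big_seq big1// => i si.
  by rewrite ell2_subE xs// subrr rmorph0 mulr0.
have xx : rnorm x ^+ 2 = \sum_(i <- s) rnorm (y i) ^+ 2.
  rewrite rnorm2E innerx (big_morph (@complex.Re R) (@ReD R) (erefl _)).
  by apply: eq_big_seq => i si; rewrite xs// mulrC mul_conj.
have -> : rnorm y ^+ 2 = rnorm x ^+ 2 + rnorm (y - x) ^+ 2.
  by rewrite -{1}(subrK x y) addrC rnorm2D xy0 mulr0 addr0.
by rewrite xx lerD2l.
Qed.

Lemma ell2_rnorm2_mono (y z : L2) : (forall i, rnorm (y i) <= rnorm (z i)) ->
  rnorm y ^+ 2 <= rnorm z ^+ 2.
Proof.
move=> yz; rewrite !ell2_rnorm2 /ell2_norm2.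
have [i|A|//] := @bounded_summable R I (fun i => rnorm (y i) ^+ 2)
  (ge0_sum (fun i => rnorm (z i) ^+ 2)); first exact: sqr_ge0.
apply: le_trans (ge0_sum_finite A (sqr_rnorm_ge0 z) (ell2_summable z)).
by apply: ler_sum => i _; rewrite lerXn2r ?nnegrE ?rnorm_ge0.
Qed.

(** Off the support of [z] the vectors [y] and [y - z] agree, so [y] has at most a quarter of its
    mass there. *)
Lemma sparse_mass (y z : L2) m : sparse m z -> rnorm (y - z) <= rnorm y / 2 ->
  exists s, [/\ uniq s, (size s <= m)%N &
    3 / 4 * rnorm y ^+ 2 <= \sum_(i <- s) rnorm (y i) ^+ 2].
Proof.
move=> [s [sm zs]] yz; exists (undup s); split; first exact: undup_uniq.
  exact: leq_trans (size_undup s) sm.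
have := @ell2_rnorm2_le y (undup s) (rnorm y ^+ 2 / 4) (undup_uniq s).
have h (x : L2) : (forall i, i \notin undup s -> x i = y i) ->
    (forall i, i \in undup s -> x i = 0) -> rnorm x ^+ 2 <= rnorm y ^+ 2 / 4.
  move=> x1 x2; apply: (@le_trans _ _ (rnorm (y - z) ^+ 2)).
    apply: ell2_rnorm2_mono => i; rewrite ell2_subE.
    have [si|si] := boolP (i \in undup s); first by rewrite x2// rnorm0 rnorm_ge0.
    by rewrite x1// zs ?subr0// -mem_undup.
  have -> : rnorm y ^+ 2 / 4 = (rnorm y / 2) ^+ 2 by field.
  by rewrite lerXn2r ?nnegrE ?rnorm_ge0// divr_ge0 ?rnorm_ge0.
by move=> /(_ h); move: (rnorm y ^+ 2) (\sum_(_ <- _) _) => a b; lra.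
Qed.

Variables (q : bop L2) (w : nat -> bop L2).
Hypothesis qP : projection q.
Hypothesis wM : forall k l,
  bop_comp (adjoint (w k)) (w l) = if k == l then q else 0.
Hypothesis wq : forall k, bop_comp (w k) q = w k.

Lemma range_projections : orth_projections (fun k => bop_comp (w k) (adjoint (w k))).
Proof.
split=> [k|k l kl]; first split.
- by rewrite adjoint_comp adjointK.
- by rewrite bop_compA -[X in bop_comp X _]bop_compA wM eqxx wq.
- by rewrite -bop_compA [X in bop_comp _ X]bop_compA wM (negPf kl) bop_comp0l bop_comp0r.
Qed.

(** Bessel for the range projections: |<w k x, y>| is at most |w k^* y|, the norm of the projection
    of [y] to the range of [w k]. *)
Lemma isometry_bessel (x y : L2) n : rnorm x <= 1 ->
  \sum_(k < n) rnorm (inner (w k x) y) ^+ 2 <= rnorm y ^+ 2.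
Proof.
move=> x1; have := @orth_projections_bessel _ _ _ _ (index_iota 0 n) y range_projections (iota_uniq _ _).
rewrite big_mkord; apply: le_trans.
apply: ler_sum => k _; rewrite lerXn2r ?nnegrE ?rnorm_ge0// adjointP.
rewrite (le_trans (cauchy_schwarz _ _))// (@le_trans _ _ (rnorm (adjoint (w k) y)))//.
  by rewrite ler_piMl ?rnorm_ge0.
rewrite -(@ler_pXn2r _ 2)// ?nnegrE ?rnorm_ge0//.
have -> := projection_inner y (range_projections.1 k).
by rewrite -[inner _ y]/(inner (w k (adjoint (w k) y)) y) adjointP -rnorm2E.
Qed.

Lemma sign_sum_coord (a : nat -> L2) n sigma j :
  (sign_sum a n sigma) j = sign_sum (fun k => a k j : R[i]^o) n sigma.
Proof.
by rewrite /sign_sum; elim/big_rec2: _ => // k y x _ <-.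
Qed.

(** Compare fourth moments. If every sign pattern gave a vector within c/2 of an m-sparse one, each
    would carry mass M = 3/4 c^2 on m coordinates, hence a sum of fourth powers of at least M^2/m.
    By Khintchine the average of these sums is at most 3 c^2/n. Together n c^2 <= 16/3 m, which the
    constant 6 excludes. *)
Lemma spread_not_sparse i n m : 0 < rnorm (q (delta i)) -> (0 < m)%N ->
  6 * m%:R < n%:R * rnorm (q (delta i)) ^+ 2 ->
  (forall sigma, rnorm (spread (fun k => w k (delta i)) n sigma) = rnorm (q (delta i))) ->
  exists sigma, forall z, sparse m z ->
    rnorm (q (delta i)) / 2 < rnorm (spread (fun k => w k (delta i)) n sigma - z).
Proof.
set c := rnorm _ => c0 m0 nm yc; apply: contrapT => /forallNP h.
pose y := spread (fun k => w k (delta i)) n.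
have n0 : (0 < n%:R :> R).
  have : 0 < n%:R * c ^+ 2 by apply: lt_trans nm; rewrite mulr_gt0// ltr0n.
  by rewrite pmulr_lgt0// exprn_gt0.
have /choice[s sP] sigma : exists s, [/\ uniq s, (size s <= m)%N &
    3 / 4 * c ^+ 2 <= \sum_(j <- s) rnorm (y sigma j) ^+ 2].
  have /existsNP[z /not_implyP[zm /negP]] := h sigma.
  rewrite -leNgt -(yc sigma) => yz; exact: sparse_mass zm yz.
pose S := undup (flatten [seq s sigma | sigma <- signs n]).
(* [t] is the average mass per coordinate in the extremal case. Summing the tangent inequality a^2
   >= 2 t a - t^2 over at most m coordinates of total at least M yields M^2/m. *)
pose M := 3 / 4 * c ^+ 2; pose t := M / m%:R.
have m0' : 0 < m%:R :> R by rewrite ltr0n.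
have M0 : 0 < M by rewrite /M mulr_gt0// exprn_gt0.
have t0 : 0 < t by rewrite divr_gt0.
have lb sigma : sigma \in signs n -> M ^+ 2 / m%:R <= \sum_(j <- S) rnorm (y sigma j) ^+ 4.
  move=> sn; have [us ss sM] := sP sigma.
  apply: (@le_trans _ _ (\sum_(j <- s sigma) rnorm (y sigma j) ^+ 4)); last first.
    have pe : perm_eq (s sigma) [seq j <- S | j \in s sigma].
      apply: uniq_perm => //; first by rewrite filter_uniq// undup_uniq.
      move=> j; rewrite mem_filter mem_undup; apply/idP/andP => [js|[]//].
      by split=> //; apply/flatten_mapP; exists sigma.
    rewrite (perm_big _ pe) big_filter [leRHS](bigID (mem (s sigma)))/= lerDl.
    by apply: sumr_ge0 => j _; rewrite exprn_ge0// rnorm_ge0.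
  apply: (@le_trans _ _ (\sum_(j <- s sigma) (2 * t * rnorm (y sigma j) ^+ 2 - t ^+ 2))).
    rewrite sumrB -mulr_sumr big_const_seq count_predT iter_addr_0.
    apply: (@le_trans _ _ (2 * t * M - t ^+ 2 *+ m)).
      rewrite -mulr_natr /t le_eqVlt; apply/orP; left; apply/eqP.
      by field; rewrite gt_eqF.
    apply: lerB; first by rewrite ler_wpM2l// mulr_ge0// ltW.
    by rewrite ler_wpMn2l// sqr_ge0.
  apply: ler_sum => j _; have := sqr_ge0 (rnorm (y sigma j) ^+ 2 - t).
  have -> : rnorm (y sigma j) ^+ 4 = (rnorm (y sigma j) ^+ 2) ^+ 2 by rewrite -exprM.
  by move: (rnorm _ ^+ 2) => a; lra.
pose x k j := w k (delta i) j.
pose B j := \sum_(k < n) rnorm (x k j) ^+ 2.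
have B0 j : 0 <= B j by apply: sumr_ge0 => k _; exact: sqr_ge0.
(* Orthogonality of the ranges enters here: on one coordinate the [n] vectors [w k delta_i] share at
   most unit mass, so the square in Khintchine's bound costs nothing. *)
have B1 j : B j <= 1.
  have := @isometry_bessel (delta i) (delta j) n.
  rewrite !ell2_basis_norm expr1n => /(_ (lexx _)); apply: le_trans.
  by apply: ler_sum => k _; rewrite ell2_inner_basis.
have ub j : \sum_(sigma <- signs n) rnorm (y sigma j) ^+ 4 <=
    2 ^+ n * (3 / n%:R ^+ 2) * B j.
  have -> : \sum_(sigma <- signs n) rnorm (y sigma j) ^+ 4 = n%:R ^- 2 *
      \sum_(sigma <- signs n) rnorm (sign_sum (fun k => x k j : R[i]^o) n sigma) ^+ 4.
    rewrite mulr_sumr; apply: eq_bigr => sigma _.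
    rewrite /y /spread ell2_scaleE sign_sum_coord rnormM exprMn; congr (_ * _).
    rewrite rnorm_real gtr0_norm ?invr_gt0 ?sqrtr_gt0// exprVn; congr _^-1.
    by rewrite (exprM _ 2 2) sqr_sqrtr// ltW.
  apply: (@le_trans _ _ (n%:R ^- 2 * (2 ^+ n * (3 * B j ^+ 2)))).
    apply: ler_wpM2l; first by rewrite invr_ge0 exprn_ge0// ltW.
    exact: sign_sum_moment4.
  have -> : n%:R ^- 2 * (2 ^+ n * (3 * B j ^+ 2)) =
     2 ^+ n * (3 / n%:R ^+ 2) * (B j * B j) :> R by rewrite expr2; ring.
  apply: ler_wpM2l; last by rewrite ler_piMr.
  by rewrite mulr_ge0 ?exprn_ge0// divr_ge0// exprn_ge0// ltW.
have sB : \sum_(j <- S) B j <= n%:R * c ^+ 2.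
  rewrite /B exchange_big /=.
  apply: (@le_trans _ _ (\sum_(k < n) c ^+ 2)); last first.
    by rewrite big_const_ord iter_addr_0 mulr_natl.
  apply: ler_sum => k _.
  have -> : c ^+ 2 = rnorm (w k (delta i)) ^+ 2.
    rewrite [RHS]rnorm2E adjointP -[adjoint _ _]/(bop_comp (adjoint (w k)) (w k) _).
    by rewrite wM eqxx /c projection_inner// adjointP (proj1 qP).
  rewrite ell2_rnorm2.
  have := ge0_sum_finite [fset j in S]%fset (sqr_rnorm_ge0 (w k (delta i)))
    (ell2_summable (w k (delta i))).
  apply: le_trans; rewrite le_eqVlt; apply/orP; left; apply/eqP; apply: perm_big.
  apply: uniq_perm; rewrite ?undup_uniq ?fset_uniq// => j.
  by rewrite in_fset /=.
have : \sum_(sigma <- signs n) M ^+ 2 / m%:R <=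
    \sum_(j <- S) \sum_(sigma <- signs n) rnorm (y sigma j) ^+ 4.
  by rewrite exchange_big /= big_seq [leRHS]big_seq; apply: ler_sum => sigma /lb.
rewrite sum_signs_const => /le_trans/(_ (ler_sum _ (fun j _ => ub j))).
rewrite -mulr_sumr -[leRHS]mulrA ler_pM2l ?exprn_gt0// => h1.
have : M ^+ 2 / m%:R <= 3 / n%:R ^+ 2 * (n%:R * c ^+ 2).
  by apply: le_trans h1 _; apply: ler_wpM2l.
have -> : 3 / n%:R ^+ 2 * (n%:R * c ^+ 2) = 3 * c ^+ 2 / n%:R.
  by field; rewrite gt_eqF.
rewrite ler_pdivrMr// mulrAC ler_pdivlMr//.
have c20 : 0 < c ^+ 2 by rewrite exprn_gt0.
have -> : M ^+ 2 * n%:R = c ^+ 2 * (9 / 16 * (n%:R * c ^+ 2)) by rewrite /M; field.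
have -> : 3 * c ^+ 2 * m%:R = c ^+ 2 * (3 * m%:R) by ring.
rewrite ler_pM2l// => h2.
by move: nm h2; move: (n%:R * c ^+ 2) (m%:R : R) m0' => a b b0; lra.
Qed.

End SpreadIsometry.

Section LinearMaps.
Variables (C : pzRingType) (V W : lmodType C) (f : V -> W).
Hypothesis fl : forall (a : C) (x y : V), f (a *: x + y) = a *: f x + f y.

Lemma linear0_fun : f 0 = 0.
Proof.
by have /esym/eqP := fl 1 0 0; rewrite !scale1r addr0 -subr_eq0 addrK => /eqP.
Qed.

Lemma linearD_fun x y : f (x + y) = f x + f y.
Proof. by have := fl 1 x y; rewrite !scale1r. Qed.

Lemma linearZ_fun a x : f (a *: x) = a *: f x.
Proof. by have := fl a x 0; rewrite !addr0 linear0_fun addr0. Qed.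

Lemma linearB_fun x y : f (x - y) = f x - f y.
Proof. by rewrite linearD_fun -scaleN1r linearZ_fun scaleN1r. Qed.

Lemma linear_sum_fun n (c : 'I_n -> C) (x : 'I_n -> V) :
  f (\sum_(k < n) c k *: x k) = \sum_(k < n) c k *: f (x k).
Proof.
rewrite (big_morph f linearD_fun linear0_fun).
by apply: eq_bigr => k _; exact: linearZ_fun.
Qed.

End LinearMaps.

Section SpreadAlgebra.
Variables (R : realType) (A : cstarAlgType R[i]) (q : A) (w : nat -> A).

Lemma cmul0l (x : A) : cmul 0 x = 0.
Proof. exact: (@linear0_fun _ _ _ (fun y : A => cmul y x) (fun a y z => cmul_linearl a y z x)). Qed.

Lemma cmul0r (x : A) : cmul x 0 = 0.
Proof. exact: (@linear0_fun _ _ _ (cmul x) (fun a y z => cmul_linearr a y z x)). Qed.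

Lemma cmulZl (a : R[i]) (x y : A) : cmul (a *: x) y = a *: cmul x y.
Proof. exact: (@linearZ_fun _ _ _ (fun z : A => cmul z y) (fun b z z' => cmul_linearl b z z' y)). Qed.

Lemma cmulZr (a : R[i]) (x y : A) : cmul x (a *: y) = a *: cmul x y.
Proof. exact: (@linearZ_fun _ _ _ (cmul x) (fun b z z' => cmul_linearr b z z' x)). Qed.

Lemma cstar0 : cstar (0 : A) = 0.
Proof.
by have := cstar_antilinear 0 (0 : A) 0; rewrite scale0r rmorph0 scale0r !add0r => /esym;
   have := cstar_antilinear 1 (0 : A) 0; rewrite scale1r rmorph1 scale1r addr0 => /esym/eqP;
   rewrite -subr_eq0 addrK => /eqP.
Qed.

Lemma cstarZ (a : R[i]) (x : A) : cstar (a *: x) = Num.conj a *: cstar x.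
Proof. by have := cstar_antilinear a x 0; rewrite !addr0 cstar0 addr0. Qed.

Lemma cstarD (x y : A) : cstar (x + y) = cstar x + cstar y.
Proof. by have := cstar_antilinear 1 x y; rewrite !scale1r rmorph1 scale1r. Qed.

Lemma cmul_spreadl (x : A) n sigma : (forall k, cmul x (w k) = w k) ->
  cmul x (spread w n sigma) = spread w n sigma.
Proof.
move=> xw; rewrite /spread cmulZr; congr (_ *: _).
rewrite (linear_sum_fun (f := cmul x))//; last by move=> a y z; exact: cmul_linearr.
by apply: eq_bigr => k _; rewrite xw.
Qed.

Lemma cmul_spreadr (x : A) n sigma : (forall k, cmul (w k) x = w k) ->
  cmul (spread w n sigma) x = spread w n sigma.
Proof.
move=> xw; rewrite /spread cmulZl; congr (_ *: _).
rewrite (linear_sum_fun (f := fun y => cmul y x))//; last first.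
  by move=> a y z; exact: cmul_linearl.
by apply: eq_bigr => k _; rewrite xw.
Qed.

Lemma spread_isometry n sigma : (0 < n)%N ->
  (forall k l, cmul (cstar (w k)) (w l) = if k == l then q else 0) ->
  cmul (cstar (spread w n sigma)) (spread w n sigma) = q.
Proof.
move=> n0 wM.
have sC (b : bool) : Num.conj ((-1) ^+ b : R[i]) = (-1) ^+ b.
  by rewrite rmorphXn rmorphN rmorph1.
have Sw l : (l < n)%N -> cmul (cstar (sign_sum w n sigma)) (w l) = (-1) ^+ sigma l *: q.
  move=> ln; have -> : cstar (sign_sum w n sigma) =
      \sum_(k < n) (-1) ^+ sigma k *: cstar (w k).
    rewrite /sign_sum (big_morph (@cstar _ A) cstarD cstar0).
    by apply: eq_bigr => k _; rewrite cstarZ sC.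
  rewrite (linear_sum_fun (f := fun y => cmul y (w l))); last first.
    by move=> a y z; exact: cmul_linearl.
  rewrite (bigD1 (Ordinal ln))//= wM eqxx big1 ?addr0// => k kl.
  by rewrite wM -val_eqE /= in kl *; rewrite (negPf kl) scaler0.
have SS : cmul (cstar (sign_sum w n sigma)) (sign_sum w n sigma) = n%:R *: q.
  rewrite {2}/sign_sum (linear_sum_fun (f := cmul (cstar (sign_sum w n sigma)))); last first.
    by move=> a y z; exact: cmul_linearr.
  rewrite (eq_bigr (fun=> q)); last first.
    by move=> k _; rewrite Sw// scalerA -signr_addb addbb expr0 scale1r.
  by rewrite big_const_ord iter_addr_0 scaler_nat.
rewrite /spread cstarZ cmulZl cmulZr SS !scalerA conj_real -rmorphM.
rewrite -invfM -expr2 sqr_sqrtr ?ler0n//.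
have -> : (n%:R : R[i]) = (n%:R : R)%:C by rewrite rmorph_nat.
by rewrite -rmorphM mulVf ?pnatr_eq0 -?lt0n// rmorph1 scale1r.
Qed.

End SpreadAlgebra.

(** * No controlled dilation of spread isometries *)

Section NoDilation.
Variables (R : realType) (I : choiceType) (A : cstarAlgType R[i]).
Local Notation L2 := (ell2 R I).
Local Notation delta := (@ell2_basis R I).

(** Telescoping: the right [P], then [T], then the left [P] is replaced. With |W| <= 2 and |B| <= K
    + 1 the errors are K d, 2 e and 2 (K + 1) d. *)
Lemma opnorm_comp3 (P T S W B : bop L2) (d e K : R) :
  opnorm P <= 1 -> opnorm T <= K -> opnorm (P - W) <= d -> opnorm (T - B) <= e ->
  d <= 1 -> e <= 1 -> S = bop_comp (adjoint P) (bop_comp T P) ->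
  opnorm (S - bop_comp (adjoint W) (bop_comp B W)) <= (3 * K + 2) * d + 2 * e.
Proof.
move=> P1 TK PW TB d1 e1 ->.
have adjB (U V : bop L2) : adjoint (U - V) = adjoint U - adjoint V.
  have -> : U - V = (-1) *: V + U by rewrite scaleN1r addrC.
  by rewrite adjoint_antilinear rmorphN rmorph1 scaleN1r addrC.
have opadj (U : bop L2) : opnorm (adjoint U) = opnorm U.
  apply/eqP; rewrite eq_le opnorm_adjoint_le -{2}(adjointK U).
  by rewrite opnorm_adjoint_le.
have opsub (U V : bop L2) : opnorm U <= opnorm (V) + opnorm (V - U).
  rewrite -{1}(subrK V U); apply: le_trans (opnormD _ _) _.
  by rewrite addrC lerD2l -[opnorm (U - V)]/(rnorm (U - V)) rdistC.
have W2 : opnorm W <= 2.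
  by apply: le_trans (opsub W P) _; apply: lerD => //; exact: le_trans PW _.
have BK : opnorm B <= K + 1.
  by apply: le_trans (opsub B T) _; apply: lerD => //; exact: le_trans TB _.
have -> : bop_comp (adjoint P) (bop_comp T P) - bop_comp (adjoint W) (bop_comp B W) =
  bop_comp (adjoint P) (bop_comp T (P - W)) +
  (bop_comp (adjoint P) (bop_comp (T - B) W) +
   bop_comp (adjoint (P - W)) (bop_comp B W)).
  apply: bop_eq => x; rewrite adjB bop_subE !bop_addE /=.
  by rewrite !bopD !bopZ !scaleN1r !subrKA.
have K0 : 0 <= K by apply: le_trans TK; exact: opnorm_ge0.
have nn := @opnorm_ge0 R L2.
have c3 (U V Z : bop L2) a b c : opnorm U <= a -> opnorm V <= b -> opnorm Z <= c ->
    opnorm (bop_comp U (bop_comp V Z)) <= a * (b * c).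
  move=> Ua Vb Zc; apply: le_trans (opnorm_comp _ _) _.
  apply: ler_pM => //; apply: le_trans (opnorm_comp _ _) _; exact: ler_pM.
have P1' : opnorm (adjoint P) <= 1 by rewrite opadj.
have PW' : opnorm (adjoint (P - W)) <= d by rewrite opadj.
have h1 := c3 _ _ _ _ _ _ P1' TK PW.
have h2 := c3 _ _ _ _ _ _ P1' TB W2.
have h3 := c3 _ _ _ _ _ _ PW' BK W2.
apply: le_trans (opnormD _ _) _; apply: le_trans (lerD h1 (opnormD _ _)) _.
apply: le_trans (lerD (lexx _) (lerD h2 h3)) _.
by rewrite le_eqVlt; apply/orP; left; apply/eqP; ring.
Qed.

(* A single operator [T] compresses to every member of a sequence [v k] of
   spread isometries, each chosen so spread out that the propagation of [pi T],
   of [pi (w k)] and of its adjoint cannot account for it. *)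
Lemma dilation_kernel (q : A) (w : nat -> A) (pi : A -> bop L2) :
  cstar q = q -> cmul q q = q ->
  (forall k l, cmul (cstar (w k)) (w l) = if k == l then q else 0) ->
  (forall k, cmul q (w k) = w k /\ cmul (w k) q = w k) ->
  (forall v : nat -> A, (forall k, cmul (cstar (v k)) (v k) = q) ->
     (forall k, cmul q (v k) = v k /\ cmul (v k) q = v k) ->
     exists T, forall k, cmul (cstar (w k)) (cmul T (w k)) = v k) ->
  star_hom pi -> range pi `<=` @controlled_operators R I -> pi q = 0.
Proof.
move=> qs qq wM wq dil [pil piM piS] pic; apply: bop_eq0_basis => i.
apply: contrapT => /eqP qi0.
pose c := rnorm (pi q (delta i)).
have c0 : 0 < c.
  by rewrite lt_def rnorm_ge0 andbT; apply: contraNneq qi0 => /rnorm0_eq0 ->.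
have qP : projection (pi q).
  by split; [rewrite -[LHS]piS qs|rewrite -[LHS]piM qq].
have pi0 : pi 0 = 0 by exact: linear0_fun pil.
have wM' k l : bop_comp (adjoint (pi (w k))) (pi (w l)) = if k == l then pi q else 0.
  rewrite -[LHS]/(cmul (cstar (pi (w k))) (pi (w l))) -piS -piM wM.
  by case: ifP.
have wq' k : bop_comp (pi (w k)) (pi q) = pi (w k).
  by rewrite -[LHS]/(cmul (pi (w k)) (pi q)) -piM (wq k).2.
have w1 k : opnorm (pi (w k)) <= 1.
  by apply: (isometry_norm qP); rewrite wM' eqxx.
have c1 : c <= 1.
  rewrite /c; apply: le_trans (opnormP _ _) _.
  by rewrite ell2_basis_norm mulr1; exact: projection_norm.
(* The errors tend to 0 with [k], but nothing controls how [m k] grows. *)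
have /choice[m mP] k : exists m, exists W : bop L2, propagation_le m W /\
    opnorm (pi (w k) - W) < k.+1%:R^-1.
  by apply: controlled_approx; [apply: pic; exists (w k)|rewrite invr_gt0].
have {mP} /choice[W WP] := mP.
(* A column of [W k^* B (W k)] has at most [m k * M * m k] nonzero entries when [B] has propagation
   M; [k] stands in for the M still unknown. The successor makes the sparsity positive, as
   [spread_not_sparse] demands. *)
pose N k := (k * (m k * m k)).+1.
have /choice[n nP] k : exists n, 6 * (N k)%:R < n%:R * c ^+ 2.
  have c20 : 0 < c ^+ 2 by rewrite exprn_gt0.
  exists (Num.bound (6 * (N k)%:R / c ^+ 2)); rewrite -ltr_pdivrMr//.
  by apply: archi_boundP; rewrite divr_ge0 ?mulr_ge0// ltW.
have n0 k : (0 < n k)%N.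
  rewrite lt0n; apply/negP => /eqP nk0; move: (nP k); rewrite nk0 mul0r.
  by apply/negP; rewrite -leNgt mulr_ge0.
have spP k sigma : spread (fun l => pi (w l) (delta i)) (n k) sigma =
    pi (spread w (n k) sigma) (delta i).
  rewrite /spread (linearZ_fun pil) bop_scaleE; congr (_ *: _).
  rewrite /sign_sum (linear_sum_fun pil).
  rewrite (linear_sum_fun (f := fun T : bop L2 => T (delta i)))//.
have iso k sigma : cmul (cstar (spread w (n k) sigma)) (spread w (n k) sigma) = q.
  by apply: spread_isometry.
have /choice[sg sgP] k : exists sigma, forall z, sparse (N k) z ->
    c / 2 < rnorm (pi (spread w (n k) sigma) (delta i) - z).
  have [||||sigma h] := @spread_not_sparse R I (pi q) (fun l => pi (w l)) qP wM' wq' i (n k) (N k) => //.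
    exact: nP.
    move=> sigma; rewrite spP; apply/eqP; rewrite -(eqrXn2 (n := 2)) ?rnorm_ge0//.
    rewrite rnorm2E adjointP -[adjoint _ _]/(cmul (cstar (pi (spread w (n k) sigma)))
      (pi (spread w (n k) sigma)) (delta i)) -piS -piM iso.
    by rewrite projection_inner// adjointP (proj1 qP).
  by exists sigma => z /h; rewrite spP.
pose v k := spread w (n k) (sg k).
have [k|k|T TP] := dil v; first exact: iso.
  by split; [apply: cmul_spreadl => l; exact: (wq l).1|
             apply: cmul_spreadr => l; exact: (wq l).2].
have vE k : pi (v k) = bop_comp (adjoint (pi (w k))) (bop_comp (pi T) (pi (w k))).
  by rewrite -TP piM piS piM.
pose K := opnorm (pi T).
have [M [B [BM TB]]] : exists m B, propagation_le m B /\ opnorm (pi T - B) < c / 8.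
  by apply: controlled_approx; [apply: pic; exists T|rewrite divr_gt0].
have K0 : 0 <= K := opnorm_ge0 _.
have x0 : 0 < 4 * (3 * K + 2) / c by rewrite divr_gt0// mulr_gt0//; lra.
(* The first argument makes [N k] dominate the sparsity; the second makes the error from [W k] at
   most c/4. The error from [B] is below 2 (c/8) = c/4, so the total stays within c/2. *)
pose k := maxn M (Num.bound (4 * (3 * K + 2) / c)).
have kM : (M <= k)%N by rewrite leq_maxl.
have kc : (3 * K + 2) * k.+1%:R^-1 <= c / 4.
  have : 4 * (3 * K + 2) / c <= k.+1%:R.
    apply: le_trans (ltW (archi_boundP (ltW x0))) _.
    by rewrite ler_nat (leq_trans (leq_maxr M _))//.
  rewrite ler_pdivrMr// ler_pdivrMr ?ltr0n// => h.
  by move: h; set a := k.+1%:R; lra.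
have [Wm Wd] := WP k.
have k1 : k.+1%:R^-1 <= 1 :> R by rewrite invf_le1 ?ltr0n// ler1n.
have c81 : c / 8 <= 1 by lra.
have := opnorm_comp3 (w1 k) (lexx _) (ltW Wd) (ltW TB) k1 c81 (vE k).
rewrite -/K => bound.
set Z := bop_comp (adjoint (W k)) (bop_comp B (W k)) in bound.
have Zs : sparse (N k) (Z (delta i)).
  apply: (@sparse_le _ _ (m k * M * m k)).
    by apply: leqW; rewrite -mulnA mulnCA leq_mul2r kM orbT.
  rewrite /Z /=; apply: sparse_bop => [j|].
    exact/propagation_col/propagation_adjoint.
  by apply: sparse_bop => [j|]; exact: propagation_col.
have := sgP k _ Zs; rewrite ltNge => /negP; apply.
rewrite -[pi _ _]/(pi (v k) (delta i)) -bop_subE.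
apply: le_trans (opnormP _ _) _; rewrite ell2_basis_norm mulr1.
apply: le_trans bound _; apply: le_trans (lerD kc (lexx _)) _.
by lra.
Qed.

End NoDilation.

(** * Kernels of homomorphisms into controlled operators *)

Section MatrixUnitKernel.
Variables (R : realType) (H : hilbertType R[i]) (A : cstarAlgType R[i]).
Variable rho : A -> bop H.
Hypotheses (rhoH : star_hom rho) (rho_inj : injective rho).
Hypothesis rho_vN : commutant (commutant (range rho)) `<=` range rho.

(** The strong sums are formed on [H]. They commute with the commutant of [rho A], so the double
    commutant hypothesis returns [q], the [w k] and each dilation [T] to [A], where
    [dilation_kernel] applies. *)
Lemma matrix_unit_kernel (B I : choiceType) (u : B -> nat -> nat -> A)
    (pi : A -> bop (ell2 R I)) :
  star_hom pi -> range pi `<=` @controlled_operators R I ->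
  (forall a i j, cstar (u a i j) = u a j i) ->
  (forall a b i j k l, cmul (u a i j) (u b k l) =
     if (a == b) && (j == k) then u a i l else 0) ->
  exists q : A, [/\ cstar q = q /\ cmul q q = q, forall a i j, cmul q (u a i j) = u a i j,
    forall x, (forall a i j, cmul x (u a i j) = 0) -> cmul x q = 0
    & pi q = 0].
Proof.
move=> piH pic uJ uM; have [rhol rhoM rhoS] := rhoH.
have rho0 : rho 0 = 0 by exact: linear0_fun rhol.
have uJ' a i j : adjoint (rho (u a i j)) = rho (u a j i).
  by rewrite -[LHS]rhoS uJ.
have uM' a b i j k l : bop_comp (rho (u a i j)) (rho (u b k l)) =
    if (a == b) && (j == k) then rho (u a i l) else 0.
  by rewrite -[LHS]rhoM uM; case: ifP.
have [q [w [qP wM wq [qu q0] com]]] := matrix_units_isometries uJ' uM'.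
have ucom S : commutant (range rho) S ->
    forall a i j, bop_comp S (rho (u a i j)) = bop_comp (rho (u a i j)) S.
  by move=> cS a i j; rewrite cS//; exists (u a i j).
have [q' _ q'E] : range rho q.
  by apply: rho_vN => S cS; have [-> _] := com _ (ucom S cS).
have /choice[w' w'E] k : exists x, rho x = w k.
  suff [x _ <-] : range rho (w k) by exists x.
  by apply: rho_vN => S cS; have [_ ->] := com _ (ucom S cS).
have qs : cstar q' = q' by apply: rho_inj; rewrite rhoS q'E; exact: qP.1.
have qq : cmul q' q' = q' by apply: rho_inj; rewrite rhoM q'E; exact: qP.2.
exists q'; split=> //.
- by move=> a i j; apply: rho_inj; rewrite rhoM q'E; exact: qu.
- move=> x xu; apply: rho_inj; rewrite rhoM q'E rho0; apply: q0 => a i j.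
  by rewrite -[LHS]rhoM xu rho0.
apply: (dilation_kernel qs qq _ _ _ piH pic (w := w')).
- move=> k l; apply: rho_inj; rewrite rhoM rhoS !w'E -[LHS]/(bop_comp _ _) wM.
  by case: ifP; rewrite ?q'E ?rho0.
- by move=> k; split; apply: rho_inj; rewrite rhoM q'E w'E; [exact: (wq k).1|exact: (wq k).2].
- move=> v vs vq.
  have [k|k|T [TE Tcom]] := strong_sum_dilation qP wM (fun k => (wq k).2) (v := rho \o v).
  - by rewrite -[LHS]/(cmul (cstar (rho (v k))) (rho (v k))) -rhoS -rhoM vs.
  - by have [vq1 vq2] := vq k; split; rewrite -q'E -[LHS]rhoM /= ?vq1 ?vq2.
  have [T' _ T'E] : range rho T.
    apply: rho_vN => S cS; apply: Tcom => k; [|rewrite -w'E|].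
    + by have [_ ->] := com _ (ucom S cS).
    + by rewrite cS//; exists (cstar (w' k)) => //; rewrite rhoS.
    + by rewrite cS//; exists (v k).
  exists T' => k; apply: rho_inj; rewrite !rhoM rhoS w'E T'E; exact: TE.
Qed.

End MatrixUnitKernel.

Section VonNeumann.
Variables (R : realType) (A : cstarAlgType R[i]).

Lemma controlled_vN_finite : von_neumann_algebra A ->
  controlled_propagation A -> finite_algebra A.
Proof.
move=> [H [rho [rhoH rho_inj [_ rho_vN]]]] [I [pi [piH pi_inj pic]]] e v eU vv.
have es : cstar e = e.
  by have := (eU (cstar e)).1 => /(congr1 (@cstar _ A)); rewrite cstarM cstarK (eU _).1.
pose g := e - cmul v (cstar v).
have subl (x y z : A) : cmul (x - y) z = cmul x z - cmul y z.
  exact: (@linearB_fun _ _ _ (fun t : A => cmul t z) (fun a s t => cmul_linearl a s t z)).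
have subr (x y z : A) : cmul z (x - y) = cmul z x - cmul z y.
  exact: (@linearB_fun _ _ _ (cmul z) (fun a s t => cmul_linearr a s t z)).
have gv : cmul g v = 0 by rewrite subl (eU v).1 -cmulA vv (eU v).2 subrr.
have gs : cstar g = g.
  by rewrite /g -[- _]scaleN1r addrC cstar_antilinear rmorphN rmorph1 cstarM cstarK es.
have gg : cmul g g = g.
  by rewrite {2}/g subr (eU g).2 cmulA gv cmul0l subr0.
(* [x i] is v^i g. From v^* v = e and g v = 0 the [x i] are partial isometries with common initial
   projection [g] and orthogonal ranges, so the products [x i x j^*] form one system of matrix
   units, indexed by [unit]. *)
pose x i := iter i (cmul v) g.
have xg i : cmul (x i) g = x i.
  by elim: i => [//|i IH]; rewrite /x iterS -cmulA IH.
have xx i j : cmul (cstar (x i)) (x j) = if i == j then g else 0.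
  elim: i j => [|i IH] [|j].
  - by rewrite /= gs gg.
  - by rewrite /= gs cmulA gv cmul0l.
  - by rewrite /= cstarM -cmulA -[cmul (cstar v) g]cstarK cstarM cstarK gs gv cstar0 cmul0r.
  - by rewrite /= cstarM -cmulA [cmul (cstar v) _]cmulA vv (eU _).1 IH eqSS.
pose u (a : unit) i j := cmul (x i) (cstar (x j)).
have [] := matrix_unit_kernel rhoH rho_inj _ (u := u) piH pic.
- by rewrite rho_vN.
- by move=> a i j; rewrite /u cstarM cstarK.
- move=> a b i j k l; rewrite /u cmulA -[cmul (cmul _ _) (x k)]cmulA xx.
  have -> : a == b by case: a; case: b.
  by case: ifP => _; rewrite ?xg ?cmul0r ?cmul0l.
move=> q [_ qu _ pq0]; have q0 : q = 0.
  by apply: pi_inj; rewrite pq0 (linear0_fun (f := pi))//; case: piH.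
(* The unit with indices 0, 0 is [g] itself, so [q = 0] forces [g = 0]. *)
have := qu tt 0 0; rewrite q0 cmul0l /u /x /= gs gg => /esym/eqP.
by rewrite subr_eq0 => /eqP.
Qed.

End VonNeumann.

(** * Rank-one operators and homomorphisms from B(H) *)

Section RankOne.
Variables (R : realType) (H : hilbertType R[i]).
Implicit Types (x y z : H).

Lemma rank_one_exists x y : exists T : bop H, forall z, T z = inner z y *: x.
Proof.
have l (a : R[i]) z z' : inner (a *: z + z') y *: x =
    a *: (inner z y *: x) + inner z' y *: x.
  by rewrite inner_linearl scalerDl scalerA.
have b : exists M : R, forall z, rnorm (inner z y *: x) <= M * rnorm z.
  exists (rnorm x * rnorm y) => z; rewrite rnormZ mulrC -mulrA ler_wpM2l ?rnorm_ge0//.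
  by rewrite mulrC cauchy_schwarz.
by exists (Bop l b).
Qed.

Definition rank_one x y : bop H := projT1 (cid (rank_one_exists x y)).

Lemma rank_oneE x y z : rank_one x y z = inner z y *: x.
Proof. by rewrite /rank_one; case: cid. Qed.

Lemma rank_one_adjoint x y : adjoint (rank_one x y) = rank_one y x.
Proof.
apply/esym/adjoint_uniq => z t.
by rewrite !rank_oneE innerZl innerZr -inner_conj mulrC.
Qed.

Lemma rank_one_comp x y x' y' :
  bop_comp (rank_one x y) (rank_one x' y') = inner x' y *: rank_one x y'.
Proof.
apply: bop_eq => z; rewrite bop_scaleE /= !rank_oneE innerZl !scalerA.
by rewrite mulrC.
Qed.

Lemma bop_comp_rank_one (T : bop H) x y : bop_comp T (rank_one x y) = rank_one (T x) y.
Proof. by apply: bop_eq => z; rewrite /= !rank_oneE bopZ. Qed.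

(** Either every finite orthonormal list in the kernel extends, and iteration gives a sequence, or
    some list cannot be extended; then it is a basis of the kernel, because the normalized residual
    of any other kernel vector would extend it. *)
Lemma kernel_orthonormal (q : bop H) :
  (exists g : nat -> H, (forall n, q (g n) = 0) /\
     forall m n, inner (g m) (g n) = (m == n)%:R) \/
  (exists s : seq H, (forall i, (i < size s)%N -> q s`_i = 0) /\
     forall x, q x = 0 -> x = \sum_(i < size s) inner x s`_i *: s`_i).
Proof.
pose ON (s : seq H) := (forall i, (i < size s)%N -> q s`_i = 0) /\
  forall i j, (i < size s)%N -> (j < size s)%N -> inner s`_i s`_j = (i == j)%:R.
have [ext|/existsNP[s /not_implyP[[sq sO] next]]] :=
  pselect (forall s, ON s -> exists x, ON (rcons s x)); [left|right].
  (* A total extension function, with value 0 on lists that are not orthonormal; the iteration below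
     starts from the empty list and stays among the orthonormal ones. *)
  have /choice[e eP] s : exists x, ON s -> ON (rcons s x).
    have [/ext[x xs]|ns] := pselect (ON s); first by exists x.
    by exists 0.
  pose t n := iter n (fun s => rcons s (e s)) [::].
  pose g n := e (t n).
  have tE n : t n = mkseq g n.
    elim: n => // n IH; rewrite /t iterS -/(t n) IH /mkseq -[in RHS]addn1 iotaD.
    by rewrite map_cat /= cats1 add0n /g IH.
  have tON n : ON (mkseq g n).
    by rewrite -tE; elim: n => [|n IH]; [split|rewrite /t iterS; exact: eP].
  exists g; split=> [n|m n].
    have [h _] := tON n.+1; have := h n; rewrite size_mkseq nth_mkseq//; exact.
  have [_ h] := tON (maxn m n).+1; have := h m n.
  by rewrite size_mkseq !nth_mkseq ?ltnS ?leq_maxl ?leq_maxr//; exact.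
exists s; split=> // x qx.
pose y := x - \sum_(i < size s) inner x s`_i *: s`_i.
have qy : q y = 0.
  rewrite bopB qx (linear_sum_fun (bop_linear q)) big1 ?subrr// => i _.
  by rewrite sq// scaler0.
have ys j : (j < size s)%N -> inner y s`_j = 0.
  move=> js; rewrite innerBl; apply/eqP; rewrite subr_eq0; apply/eqP.
  rewrite (@linear_sum_fun _ _ (R[i]^o) (fun z => inner z s`_j)); last first.
    by move=> a u v; exact: inner_linearl.
  rewrite (bigD1 (Ordinal js))//= sO// eqxx big1 ?addr0 => [|i ij].
    exact/esym/mulr1.
  rewrite sO// -[_ == j]/(i == Ordinal js) (negPf ij).
  exact: mulr0.
have [y0|y0] := eqVneq y 0; first by apply/eqP; rewrite -subr_eq0; apply/eqP.
case: next; exists ((rnorm y)^-1%:C *: y).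
have ny : rnorm y != 0 by apply: contraNneq y0 => /rnorm0_eq0 ->.
split=> [i|i j]; rewrite size_rcons !ltnS.
  rewrite leq_eqVlt nth_rcons => /predU1P[->|lt].
    by rewrite ltnn eqxx bopZ qy scaler0.
  by rewrite lt sq.
rewrite leq_eqVlt => /predU1P[->|lti]; rewrite leq_eqVlt => /predU1P[->|ltj];
  rewrite !nth_rcons ?ltnn ?eqxx ?lti ?ltj.
- rewrite innerZl innerZr inner_self conj_real -!rmorphM.
  by rewrite expr2 mulrA mulrACA mulVf// mulr1 // mulVf.
- by rewrite innerZl ys// mulr0 gtn_eqF.
- by rewrite innerZr inner_conj ys// rmorph0 mulr0 ltn_eqF.
- exact: sO.
Qed.

(** It suffices that [pi] kills 1. Zorn's lemma makes [q] the projection of a maximal family of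
    orthonormal sequences, and maximality leaves no infinite orthonormal sequence in its kernel; the
    identity is then [q] plus finitely many rank-one operators. *)
Lemma bop_hom_controlled0 (I : choiceType) (pi : bop H -> bop (ell2 R I)) :
  ~ finite_dimensional H -> star_hom pi ->
  range pi `<=` @controlled_operators R I -> forall T, pi T = 0.
Proof.
move=> Hinf piH pic; have [pil piM piS] := piH.
have pi0 : pi 0 = 0 by exact: linear0_fun pil.
pose ON (F : set (nat -> H)) := forall f g, F f -> F g -> forall m n,
  inner (f m) (g n) = (`[< f = g >] && (m == n))%:R.
have [|F [FO Fmax]] := @Zorn_bigcup (nat -> H) ON.
  move=> C CON Ctot f g [X CX Xf] [Y CY Yg].
  by have [XY|YX] := Ctot _ _ CX CY; [apply: (CON Y) => //|apply: (CON X) => //]; auto.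
(* Indexing by all sequences, with zero units outside [F], spares a subtype; zero satisfies the
   matrix unit relations. *)
pose u (f : {classic (nat -> H)}) i j : bop H :=
  if `[< F f >] then rank_one (f i) (f j) else 0.
have uJ a i j : adjoint (u a i j) = u a j i.
  by rewrite /u; case: ifP; rewrite ?adjoint0// rank_one_adjoint.
have uM a b i j k l : bop_comp (u a i j) (u b k l) =
    if (a == b) && (j == k) then u a i l else 0.
  rewrite /u; case: asboolP => Fa; last by rewrite bop_comp0l; case: ifP.
  case: asboolP => Fb; last first.
    rewrite bop_comp0r; case: eqP => //= ab; by rewrite ab in Fa.
  rewrite rank_one_comp FO//.
  have -> : `[< b = a >] = (a == b) by apply/asboolP/eqP.
  rewrite [k == j]eq_sym; case: ifP => [/andP[/eqP -> _]|_].
    by rewrite scale1r.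
  by rewrite scale0r.
have idH : star_hom (@id (bop H)) by [].
have [] := matrix_unit_kernel idH (@inj_id _) _ (u := u) piH pic uJ uM.
  by move=> T _; exists T.
move=> q [[qs qq'] qu q0 pq].
have qF f n : F f -> q (f n) = f n.
  move=> Ff; have := congr1 (fun T : bop H => T (f n)) (qu f n n).
  rewrite /u; case: asboolP => // _; rewrite -[LHS]/(q (rank_one _ _ _)).
  by rewrite rank_oneE FO// eqxx (asboolT erefl) scale1r.
suff pi1 : pi (bop_id H) = 0.
  by move=> T; rewrite -(bop_comp1l T) -[bop_comp _ _]/(cmul _ _) piM pi1 cmul0l.
have [[g [gq gO]]|[s [sq sE]]] := kernel_orthonormal q.
  (* In the infinite case [g] is orthogonal to every member of [F], as [q] fixes those and kills
     [g]; adding [g] would enlarge the maximal family. *)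
  have gF : ~ F g.
    move=> Fg; have := gO 0 0; rewrite -(qF g 0 Fg) gq inner0l => /esym/eqP.
    by rewrite eqxx oner_eq0.
  have fg f m n : F f -> inner (f m) (g n) = 0.
    move=> Ff; rewrite -(qF f m Ff) adjointP -[adjoint q]/(cstar q) qs gq.
    by rewrite inner_conj inner0l rmorph0.
  case: (Fmax (F `|` [set g])).
    split=> [f Ff|h]; first by left.
    by apply/gF/h; right.
  move=> f h [Ff|->] [Fh|->] m n.
  - exact: FO.
  - by rewrite fg//; case: asboolP => // e; rewrite e in Ff.
  - rewrite inner_conj fg// rmorph0; case: asboolP => // e.
    by rewrite -e in Fh.
  - by rewrite gO (asboolT erefl).
(* With [F] empty all units vanish, so [q = 0], and its finite-dimensional kernel is all of [H]. *)
have [[f Ff]|F0] := pselect (F !=set0); last first.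
  case: Hinf; exists (size s), (fun i => s`_i) => v.
  exists (fun i => inner v s`_i); apply: sE.
  rewrite -[q]bop_comp1l -[bop_comp _ _]/(cmul _ _) q0// => a i j.
  by rewrite /u; case: asboolP => [Fa|_]; [case: F0; exists a|exact: cmul0r].
(* Every rank-one operator factors through the unit vector [f 0], which lies in the range of [q]. *)
have ppi x y : pi (rank_one x y) = 0.
  have -> : rank_one x y = cmul (rank_one x (f 0)) (cmul q (rank_one (f 0) y)).
    rewrite -[cmul q _]/(bop_comp q _) bop_comp_rank_one qF//.
    rewrite -[RHS]/(bop_comp _ _) rank_one_comp FO// eqxx (asboolT erefl).
    by rewrite scale1r.
  by rewrite !piM pq cmul0l cmul0r.
have -> : bop_id H = q + \sum_(i < size s) 1 *: rank_one s`_i s`_i.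
  apply: bop_eq => z; rewrite bop_addE.
  have -> : (\sum_(i < size s) 1 *: rank_one s`_i s`_i : bop H) z =
      \sum_(i < size s) 1 *: (inner z s`_i *: s`_i).
    rewrite (linear_sum_fun (f := fun T : bop H => T z))//.
    by apply: eq_bigr => i _; rewrite rank_oneE.
  apply/eqP; rewrite addrC -subr_eq; apply/eqP.
  have qq : q (q z) = q z.
    exact: (congr1 (fun T : bop H => T z) qq').
  rewrite [LHS]sE; last by rewrite bopB qq subrr.
  apply: eq_bigr => i _; rewrite scale1r innerBl [X in _ - X]adjointP -[adjoint q]/(cstar q) qs.
  by rewrite sq// [inner z 0]inner_conj inner0l rmorph0 subr0.
rewrite (linearD_fun pil) pq add0r (linear_sum_fun pil) big1// => i _.
by rewrite ppi scaler0.
Qed.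

End RankOne.

(** * The regular representation *)

Section CStarNorm.
Variables (R : realType) (A : cstarAlgType R[i]).
Implicit Types x y : A.

Lemma rnorm_cmul x y : rnorm (cmul x y) <= rnorm x * rnorm y.
Proof. by have := cnormM x y; rewrite !rnormE -rmorphM lecR. Qed.

Lemma rnorm_cstar x : rnorm (cstar x) = rnorm x.
Proof.
have le (z : A) : rnorm z <= rnorm (cstar z).
  have := cnorm_star z; rewrite !rnormE -rmorphXn => -[e].
  have := rnorm_cmul (cstar z) z; rewrite e.
  have [->|z0] := eqVneq (rnorm z) 0; first by rewrite rnorm_ge0.
  by rewrite expr2 ler_pM2r// lt_def z0 rnorm_ge0.
by apply/eqP; rewrite eq_le le -{2}(cstarK x) le.
Qed.

Lemma cmulBB x y x' y' : cmul x y - cmul x' y' = cmul (x - x') y + cmul x' (y - y').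
Proof.
rewrite (@linearB_fun _ _ _ (cmul x') (fun a s t => cmul_linearr a s t x')).
by rewrite (@linearB_fun _ _ _ (cmul^~ y) (fun a s t => cmul_linearl a s t y)) subrKA.
Qed.

End CStarNorm.

(* The extension sends [a] to the unique [b] such that [(a, b)] is a limit of
   pairs [(j f, t f)]. *)
Lemma isometric_extension (R : realType) (A B : cstarAlgType R[i]) (Y : Type)
    (S : set Y) (lin : R[i] -> Y -> Y -> Y) (mul : Y -> Y -> Y) (inv : Y -> Y)
    (j : Y -> A) (t : Y -> B) :
  (forall a f h, S f -> S h -> [/\ S (lin a f h),
     j (lin a f h) = a *: j f + j h & t (lin a f h) = a *: t f + t h]) ->
  (forall f h, S f -> S h -> [/\ S (mul f h),
     j (mul f h) = cmul (j f) (j h) & t (mul f h) = cmul (t f) (t h)]) ->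
  (forall f, S f -> [/\ S (inv f),
     j (inv f) = cstar (j f) & t (inv f) = cstar (t f)]) ->
  (forall f, S f -> rnorm (t f) = rnorm (j f)) ->
  closure (j @` S) = setT ->
  exists rho : A -> B, [/\ star_hom rho, injective rho &
    range rho `<=` closure (t @` S)].
Proof.
move=> linP mulP invP iso dense.
pose near a b e f := [/\ S f, rnorm (a - j f) < e & rnorm (b - t f) < e].
pose apx a b := forall e, 0 < e -> exists f, near a b e f.
have nbhsA (C : cstarAlgType R[i]) (a : C) e : 0 < e ->
    nbhs a [set x | rnorm (a - x) < e].
  by move=> e0; have /rcvgP := @cvg_id _ (nbhs a); apply.
have dense' a e : 0 < e -> exists2 f, S f & rnorm (a - j f) < e.
  move=> e0; have : closure (j @` S) a by rewrite dense.
  by move=> /(_ _ (nbhsA _ a e e0))[_ [[f Sf <-]]]; exists f.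
have dist f h : S f -> S h -> rnorm (t f - t h) = rnorm (j f - j h).
  move=> Sf Sh; have [Sl jl tl] := linP (-1) h f Sh Sf.
  by have := iso _ Sl; rewrite jl tl !scaleN1r ![- _ + _]addrC.
have ex a : exists b, apx a b.
  pose F : set_system B := filter_from [set e : R | 0 < e]
    (fun e => t @` [set f | S f /\ rnorm (a - j f) < e]).
  have FF : ProperFilter F.
    apply: filter_from_proper.
      apply: filter_from_filter; first by exists 1 => /=.
      move=> e d /= e0 d0; exists (Num.min e d); first by rewrite /= lt_min e0 d0.
      move=> _ [f [Sf fe] <-]; split; exists f => //; split=> //;
        by rewrite (lt_le_trans fe)// ge_min lexx ?orbT.
    by move=> e /= /(dense' a)[f Sf fe]; exists (t f), f.
  have : cvg F.
    apply: cauchy_cvg; apply/rcauchyP => e e0.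
    have e20 : 0 < e / 2 by rewrite divr_gt0.
    have [f Sf fe] := dense' a _ e20; exists (t f), (e / 2) => //.
    move=> _ [h [Sh he] <-] /=; rewrite dist// -(subrKA a) (le_lt_trans (rnormD _ _))//.
    by rewrite [ltRHS]splitr ltrD// rdistC.
  move=> /cvg_ex[b /rcvgP Fb]; exists b => e e0.
  have [d d0 db] := Fb e e0.
  have m0 : 0 < Num.min e d by rewrite lt_min e0.
  have [f Sf fm] := dense' a _ m0; exists f; split=> //.
    by rewrite (lt_le_trans fm)// ge_min lexx.
  by apply: db; exists f => //; split=> //; rewrite (lt_le_trans fm)// ge_min lexx orbT.
(* Applied to differences, this gives both the uniqueness of the limit and the injectivity of the
   extension. *)
have apx_norm a b : apx a b -> rnorm b = rnorm a.
  move=> ab; suff h (u v : R) : (forall e, 0 < e -> u <= v + e) -> u <= v.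
    apply/eqP; rewrite eq_le; apply/andP; split; apply: h => e e0;
      have e20 : 0 < e / 2 by [rewrite divr_gt0].
      have [f [Sf af bf]] := ab _ e20.
      rewrite -(subrK (t f) b) (le_trans (rnormD _ _))// iso//.
      have := rnormD (j f - a) a; rewrite subrK rdistC => h.
      by move: af bf h; move: (rnorm (a - _)) (rnorm (b - _)) (rnorm (j f)) (rnorm a) => p q r s; lra.
    have [f [Sf af bf]] := ab _ e20.
    rewrite -(subrK (j f) a) (le_trans (rnormD _ _))// -iso//.
    have := rnormD (t f - b) b; rewrite subrK rdistC => h.
    by move: af bf h; move: (rnorm (a - _)) (rnorm (b - _)) (rnorm (t f)) (rnorm b) => p q r s; lra.
  by move=> huv; apply/ler_addgt0Pr.
have apx_lin c a b a' b' : apx a b -> apx a' b' -> apx (c *: a + a') (c *: b + b').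
  move=> ab ab' e e0; pose d := e / (rnorm c + 1).
  have c0 := rnorm_ge0 c; have c1 : 0 < rnorm c + 1 by rewrite ltr_wpDl.
  have d0 : 0 < d by rewrite divr_gt0.
  have [f [Sf af bf]] := ab d d0; have [h [Sh ah bh]] := ab' d d0.
  have [Sl jl tl] := linP c f h Sf Sh.
  have key (V : cstarAlgType R[i]) (x x' y y' : V) : rnorm (x - y) < d ->
      rnorm (x' - y') < d -> rnorm (c *: x + x' - (c *: y + y')) < e.
    move=> h1 h2; rewrite opprD addrACA -scalerBr (le_lt_trans (rnormD _ _))// rnormZ.
    have -> : e = rnorm c * d + d by rewrite /d; field; rewrite gt_eqF.
    by rewrite ler_ltD// ler_wpM2l// ltW.
  by exists (lin c f h); split; rewrite ?jl ?tl//; apply: key.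
have apx_mul a b a' b' : apx a b -> apx a' b' -> apx (cmul a a') (cmul b b').
  move=> ab ab' e e0; pose K := 1 + rnorm a + rnorm a'.
  have a0 := rnorm_ge0 a; have a0' := rnorm_ge0 a'.
  have K0 : 0 < K by rewrite /K -addrA ltr_wpDr ?addr_ge0.
  pose d := Num.min 1 (e / (2 * K)).
  have d0 : 0 < d by rewrite lt_min ltr01 divr_gt0// mulr_gt0.
  have d1 : d <= 1 by rewrite ge_min lexx.
  have dK : d * (2 * K) <= e by rewrite -ler_pdivlMr ?mulr_gt0// ge_min lexx orbT.
  have [f [Sf af bf]] := ab d d0; have [h [Sh ah bh]] := ab' d d0.
  have [Sl jl tl] := mulP f h Sf Sh.
  have key (V : cstarAlgType R[i]) (x x' y y' : V) : rnorm (x - y) < d ->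
      rnorm (x' - y') < d -> rnorm x = rnorm a -> rnorm x' = rnorm a' ->
      rnorm (cmul x x' - cmul y y') < e.
    move=> h1 h2 xa xa'; rewrite cmulBB (le_lt_trans (rnormD _ _))//.
    apply: (@le_lt_trans _ _ (d * rnorm a' + (rnorm a + 1) * d)); last first.
      by apply: lt_le_trans dK; rewrite /K; nra.
    apply: lerD; apply: (le_trans (rnorm_cmul _ _)).
      by rewrite xa' ler_wpM2r// ltW.
    apply: ler_pM => //; rewrite ?rnorm_ge0 ?(ltW h2)//.
    rewrite -xa -(subrK x y) (le_trans (rnormD _ _))// addrC lerD2l rdistC.
    by rewrite (le_trans (ltW h1)).
  exists (mul f h); split; rewrite ?jl ?tl//; apply: key => //; exact: apx_norm.
have apx_star a b : apx a b -> apx (cstar a) (cstar b).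
  move=> ab e e0; have [f [Sf af bf]] := ab e e0; have [Sl jl tl] := invP f Sf.
  have key (V : cstarAlgType R[i]) (x y : V) :
      rnorm (cstar x - cstar y) = rnorm (x - y).
    rewrite -[RHS]rnorm_cstar addrC -scaleN1r [in RHS]addrC -[X in X + x]scaleN1r.
    by rewrite cstar_antilinear rmorphN rmorph1.
  by exists (inv f); split; rewrite ?jl ?tl// key.
have apx_uniq a b b' : apx a b -> apx a b' -> b = b'.
  move=> h h'; have := apx_lin (-1) _ _ _ _ h' h.
  move=> /apx_norm; rewrite !scaleN1r addNr rnorm0 addrC => /rnorm0_eq0/eqP.
  by rewrite subr_eq0 => /eqP.
have /choice[rho rhoP] := ex.
exists rho; split.
- split=> [c x y|x y|x]; apply: apx_uniq (rhoP _) _.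
  + exact: apx_lin.
  + exact: apx_mul.
  + exact: apx_star.
- move=> x y xy; apply/eqP; rewrite -subr_eq0; apply/eqP/rnorm0_eq0.
  have := apx_norm _ _ (apx_lin (-1) _ _ _ _ (rhoP y) (rhoP x)).
  by rewrite xy !scaleN1r addNr rnorm0 addrC => <-.
- move=> _ [x _ <-] U; rewrite -filter_from_ballE => -[e e0 eU].
  have eR : 0 < complex.Re e by rewrite -ltcR -Re_real_complex// ltW.
  have [f [Sf _ tf]] := rhoP x _ eR.
  exists (t f); split; first by exists f.
  apply: eU; rewrite -ball_normE /= rnormE (Re_real_complex (ltW e0)).
  by rewrite ltcR.
Qed.

Section Restriction.
Variables (R : realType) (I : choiceType).
Local Notation L2 := (ell2 R I).

Lemma abs_summable_if (D : set I) (x : L2) :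
  abs_summable (fun i => rnorm (if i \in D then x i else 0) ^+ 2).
Proof.
apply: abs_summable_le (ell2_summable x) => i.
by case: ifP => _; rewrite ger0_norm ?sqr_ge0// rnorm0 expr0n sqr_ge0.
Qed.

Definition restr_vec (D : set I) (x : L2) : L2 := Ell2 (abs_summable_if D x).

Lemma restr_vecE D x i : restr_vec D x i = if i \in D then x i else 0.
Proof. by []. Qed.

Lemma restr_vec_le D x : rnorm (restr_vec D x) <= rnorm x.
Proof.
rewrite -(@ler_pXn2r _ 2)// ?nnegrE ?rnorm_ge0//; apply: ell2_rnorm2_mono => i.
by rewrite restr_vecE; case: ifP; rewrite ?rnorm0 ?rnorm_ge0.
Qed.

Lemma restriction_exists (D : set I) : exists T : bop L2, forall x, T x = restr_vec D x.
Proof.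
have l (a : R[i]) (x y : L2) :
    restr_vec D (a *: x + y) = a *: restr_vec D x + restr_vec D y.
  apply: ell2_eq => i; rewrite ell2_addE ell2_scaleE !restr_vecE.
  by case: ifP => // _; rewrite mulr0 addr0.
have b : exists M : R, forall x, rnorm (restr_vec D x) <= M * rnorm x.
  by exists 1 => x; rewrite mul1r restr_vec_le.
by exists (Bop l b).
Qed.

Definition restriction (D : set I) : bop L2 := projT1 (cid (restriction_exists D)).

Lemma restrictionE D x i : restriction D x i = if i \in D then x i else 0.
Proof. by rewrite /restriction; case: cid => T /= ->. Qed.

Lemma mx_entry_inj (S T : bop L2) : (forall i j, mx_entry S i j = mx_entry T i j) -> S = T.
Proof.
move=> h; apply/eqP; rewrite -subr_eq0; apply/eqP/bop_eq0_basis => j.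
by apply: ell2_eq => i; rewrite bop_subE ell2_subE -!mx_entryE h subrr.
Qed.

Lemma ell2_basisE (i j : I) : ell2_basis R i j = (i == j)%:R.
Proof. by []. Qed.

(** For the source map these are the projections to the fibres G_u; Bessel then adds up estimates
    made fibre by fibre. *)
Lemma restriction_orth (K : choiceType) (s : I -> K) :
  orth_projections (fun u => restriction [set i | s i = u]).
Proof.
split=> [u|u v uv]; first split.
- apply: mx_entry_inj => i j; rewrite mx_entry_adjoint !mx_entryE !restrictionE !ell2_basisE.
  have [->|ij] := eqVneq i j; first by case: ifP; rewrite ?rmorph1 ?rmorph0.
  by rewrite !if_same rmorph0.
- by apply: bop_eq => x; apply: ell2_eq => i; rewrite /= !restrictionE; case: (_ \in _).
- apply: bop_eq => x; apply: ell2_eq => i; rewrite /= !restrictionE.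
  case: ifP => // /set_mem/= su; case: ifP => // /set_mem/= sv.
  by rewrite -su -sv eqxx in uv.
Qed.

End Restriction.

Section FellFibres.
Variables (R : realType) (X : topologicalType) (G : topGroupoid X).
Variable E : twist R G.
Local Notation L := (fell E).
Local Notation act := (circle_act (@tw_incl _ _ _ E)).
Implicit Types (s t : E) (l m : L) (g k : G).

Lemma tw_fibre s t : tw_proj s = tw_proj t -> exists z, circle z /\ t = act z s.
Proof.
move=> st; have [U [phi [psi [_ Us [_ _ h1 h2 h3]]]]] := tw_bundle E (tw_proj s).
have [cs sE] := h2 s Us; have [ct tE] : circle (psi t) /\ phi (tw_proj t) (psi t) = t.
  by apply: h2; rewrite -st.
have cz : circle (psi t * Num.conj (psi s)) by apply: circleM => //; exact: circleJ.
exists (psi t * Num.conj (psi s)); split=> //.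
by rewrite -{2}sE -h3// -mulrA circleVJ// mulr1 st tE.
Qed.

Lemma fell_in_fibre s l : fell_proj l = tw_proj s -> exists a, l = fell_class s a.
Proof.
move=> ls; have [z [cz sE]] := tw_fibre ls.
have lE : l = fell_class (repr l).1 (repr l).2.
  by rewrite /fell_class -surjective_pairing reprK.
by exists (Num.conj z * (repr l).2); rewrite {1}lE; apply/fell_classP; exists z.
Qed.

Lemma fell_coordK s l : fell_proj l = tw_proj s -> fell_class s (fell_coord s l) = l.
Proof. by move=> /fell_in_fibre[a ->]; rewrite fell_coord_class. Qed.

Lemma fell_norm_coord s l : fell_proj l = tw_proj s -> rnorm (fell_coord s l) = fell_norm l.
Proof. by move=> /fell_in_fibre[a ->]; rewrite fell_coord_class fell_norm_class. Qed.

Lemma fell_zeroE s g : tw_proj s = g -> fell_zero E g = fell_class s 0.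
Proof.
move=> sg; have [z [cz ->]] : exists z, circle z /\ s = act z (tw_lift E g).
  by apply: tw_fibre; rewrite tw_liftK.
by apply/fell_classP; exists z; rewrite mulr0.
Qed.

Lemma fell_proj_zero g : fell_proj (fell_zero E g) = g.
Proof. by rewrite fell_proj_class tw_liftK. Qed.

Lemma fell_norm0 l : fell_norm l = 0 <-> l = fell_zero E (fell_proj l).
Proof.
split=> [l0|->]; last by rewrite fell_norm_class rnorm0.
have [a lE] := fell_in_fibre (esym (tw_liftK E (fell_proj l))).
move: l0; rewrite lE fell_norm_class fell_proj_class tw_liftK => /rnorm0_eq0 ->.
by [].
Qed.

Lemma fell_zero_norm g : fell_norm (fell_zero E g) = 0.
Proof. by rewrite fell_norm_class rnorm0. Qed.

Lemma fell_lift g l : fell_proj l = g -> exists a, l = fell_class (tw_lift E g) a.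
Proof. by move=> lg; apply: fell_in_fibre; rewrite tw_liftK. Qed.

Lemma fell_proj_mul l m : gsrc (fell_proj l) = grng (fell_proj m) ->
  fell_proj (fell_mul l m) = gmul (fell_proj l) (fell_proj m).
Proof.
move=> lm; rewrite fell_proj_class tw_projM//.
by rewrite -tw_proj_src -tw_proj_rng.
Qed.

Lemma fell_norm_mul l m : fell_norm (fell_mul l m) = fell_norm l * fell_norm m.
Proof. by rewrite fell_norm_class rnormM. Qed.

(** Another lift differs by one circle element, which scales all coordinates alike and cancels in
    the class. *)
Lemma fell_sum_base (T : choiceType) (D : set T) (F : T -> L) s g :
  tw_proj s = g -> (forall i, D i -> fell_proj (F i) = g) ->
  fell_sum g D F = fell_class s (\sum_(i \in D) fell_coord s (F i)).
Proof.
move=> sg Fg; have [z [cz ->]] : exists z, circle z /\ s = act z (tw_lift E g).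
  by apply: tw_fibre; rewrite tw_liftK.
apply/fell_classP; exists z; split=> //; rewrite mulr_fsumr.
apply: eq_fsbigr => i /set_mem/Fg Fi.
have [a ->] := fell_lift Fi; rewrite fell_coord_class.
suff -> : fell_class (tw_lift E g) a = fell_class (act z (tw_lift E g)) (Num.conj z * a).
  by rewrite fell_coord_class.
by apply/fell_classP; exists z.
Qed.

End FellFibres.

Section GroupoidLaws.
Variables (X : topologicalType) (G : topGroupoid X).
Implicit Types a b c : G.

Lemma gmulrK a b : gsrc a = gsrc b -> gmul (gmul a (ginv b)) b = a.
Proof.
by move=> ab; rewrite -gmulA ?grng_inv ?gsrc_inv// gmulVl -ab gmul1r.
Qed.

Lemma gmulKr a b : gsrc a = grng b -> gmul (gmul a b) (ginv b) = a.
Proof. by move=> ab; rewrite -gmulA ?grng_inv// gmulVr -ab gmul1r. Qed.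

Lemma gmulKl a b : gsrc a = grng b -> gmul (ginv a) (gmul a b) = b.
Proof. by move=> ab; rewrite gmulA ?gsrc_inv// gmulVl ab gmul1l. Qed.

Lemma gmullK a b : grng a = grng b -> gmul a (gmul (ginv a) b) = b.
Proof. by move=> ab; rewrite gmulA ?grng_inv ?gsrc_inv// gmulVr ab gmul1l. Qed.

Lemma ginvK a : ginv (ginv a) = a.
Proof.
have := @gmulKl (ginv a) a (gsrc_inv a).
rewrite gmulVl (_ : gsrc a = gsrc (ginv (ginv a))) ?gmul1r//.
by rewrite gsrc_inv grng_inv.
Qed.

Lemma ginvM a b : gsrc a = grng b -> ginv (gmul a b) = gmul (ginv b) (ginv a).
Proof.
move=> ab; have h : gsrc (gmul (ginv b) (ginv a)) = grng (gmul a b).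
  by rewrite gsrc_mul ?gsrc_inv ?grng_inv// grng_mul.
have e : gmul (gmul (ginv b) (ginv a)) (gmul a b) = gid G (gsrc b).
  by rewrite -gmulA ?gmulKl ?gmulVl ?gsrc_inv ?grng_inv ?grng_mul.
rewrite -[RHS](gmulKr h) e -(gsrc_mul ab) -grng_inv gmul1l//.
Qed.

Lemma ginvMV a b : gsrc a = gsrc b -> ginv (gmul a (ginv b)) = gmul b (ginv a).
Proof. by move=> ab; rewrite ginvM ?grng_inv// ginvK. Qed.

End GroupoidLaws.

(** * Matrices of the regular representation *)

Section RegularOperator.
Variables (R : realType) (X : topologicalType) (G : topGroupoid X).
Variable E : twist R G.
Local Notation L := (fell E).
Local Notation L2 := (ell2 R G).
Local Notation lift := (tw_lift E).
Implicit Types (f h : G -> L) (g k : G) (u : X).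

(* The matrix entries of the regular representation, in the basis of the
   classes [lift g, 1]. *)
Definition kern f g k : R[i] :=
  if `[< gsrc g = gsrc k >]
  then fell_coord (gmul (lift g) (ginv (lift k))) (f (gmul g (ginv k))) else 0.

Lemma gsrc_lift g : gsrc (lift g) = gsrc g.
Proof. by rewrite -tw_proj_src tw_liftK. Qed.

Lemma tw_projV (s : E) : tw_proj (ginv s) = ginv (tw_proj s).
Proof.
have h : gsrc (tw_proj (ginv s)) = grng (tw_proj s).
  by rewrite tw_proj_src tw_proj_rng gsrc_inv.
rewrite -[LHS](gmulKr h) -tw_projM ?gsrc_inv// gmulVl tw_proj_id.
by rewrite -tw_proj_src -grng_inv gmul1l.
Qed.

Lemma proj_lift_div g k : gsrc g = gsrc k ->
  tw_proj (gmul (lift g) (ginv (lift k))) = gmul g (ginv k).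
Proof. by move=> gk; rewrite tw_projM ?grng_inv ?gsrc_lift// tw_projV !tw_liftK. Qed.

Lemma kernE f g k : is_section f -> gsrc g = gsrc k ->
  f (gmul g (ginv k)) = fell_class (gmul (lift g) (ginv (lift k))) (kern f g k).
Proof.
move=> fs gk; rewrite /kern asboolT// fell_coordK//.
by rewrite fs proj_lift_div.
Qed.

Lemma kern_coord f g k a : gsrc g = gsrc k ->
  f (gmul g (ginv k)) = fell_class (gmul (lift g) (ginv (lift k))) a -> kern f g k = a.
Proof. by move=> gk fE; rewrite /kern asboolT// fE fell_coord_class. Qed.

Lemma kern_out f g k : gsrc g <> gsrc k -> kern f g k = 0.
Proof. by move=> gk; rewrite /kern asboolF. Qed.

Lemma kern_norm f g k : is_section f -> gsrc g = gsrc k ->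
  rnorm (kern f g k) = fell_norm (f (gmul g (ginv k))).
Proof. by move=> fs gk; rewrite (kernE fs gk) fell_norm_class. Qed.

Lemma kern_lin a f h g k : is_section f -> is_section h ->
  kern (section_lin a f h) g k = a * kern f g k + kern h g k.
Proof.
move=> fs hs; have [gk|gk] := pselect (gsrc g = gsrc k); last first.
  by rewrite !kern_out// mulr0 addr0.
apply: kern_coord => //.
by rewrite /section_lin (kernE fs gk) (kernE hs gk) fell_scale_class fell_add_class.
Qed.

Lemma kern_star f g k : is_section f -> kern (involution f) g k = Num.conj (kern f k g).
Proof.
move=> fs; have [gk|gk] := pselect (gsrc g = gsrc k); last first.
  by rewrite !kern_out ?rmorph0// => e; apply: gk.
apply: kern_coord => //; rewrite /involution ginvMV// (kernE fs (esym gk)).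
by rewrite fell_star_class ginvMV// !gsrc_lift.
Qed.

(** The factorizations of [g k^-1] are the pairs [g l^-1], [l k^-1] with [l] in the same source
    fibre, and the lifts telescope in the same way; convolution thus becomes a matrix product. *)
Lemma kern_conv f h g k : is_section f -> is_section h -> gsrc g = gsrc k ->
  kern (convolution f h) g k =
  \sum_(l \in [set l | gsrc l = gsrc g]) kern f g l * kern h l k.
Proof.
move=> fs hs gk; apply: kern_coord => //.
have pt := proj_lift_div gk; set t := gmul (lift g) _ in pt *.
rewrite /convolution (fell_sum_base pt); last first.
  move=> [a b] /= [ab abE]; rewrite fell_proj_mul ?fs ?hs//.
congr fell_class.
have glk l : gsrc l = gsrc g -> gmul (gmul g (ginv l)) (gmul l (ginv k)) = gmul g (ginv k).
  move=> lg; rewrite -gmulA; first last.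
  - by rewrite gsrc_inv grng_mul// grng_inv lg.
  - by rewrite grng_inv.
  by rewrite gmulKl// grng_inv lg.
rewrite (@reindex_fsbig _ _ _ _ _ (fun l => (gmul g (ginv l), gmul l (ginv k)))
  [set l | gsrc l = gsrc g]).
  apply: eq_fsbigr => l /set_mem/= lg.
  rewrite (kernE fs (esym lg)) (kernE hs (etrans lg gk)) fell_mul_class; last first.
    rewrite gsrc_mul ?gsrc_inv ?grng_inv ?gsrc_lift// grng_mul// grng_inv.
    by rewrite !gsrc_lift lg.
  rewrite [X in fell_class X _](_ : _ = t) ?fell_coord_class//.
  rewrite -gmulA; first last.
  - by rewrite gsrc_inv grng_mul// grng_inv !gsrc_lift lg.
  - by rewrite grng_inv !gsrc_lift.
  by rewrite gmulKl// grng_inv !gsrc_lift lg.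
split=> [l /= lg|l m|[a b] /= [ab abE]].
- split; last exact: glk.
  by rewrite gsrc_mul ?grng_inv// gsrc_inv grng_mul// grng_inv lg.
- move=> /set_mem/= lg /set_mem/= mg [e _].
  have := congr1 (fun x => gmul (ginv x) g) e.
  by rewrite !ginvMV// !gmulrK.
- have sa : grng a = grng g.
    by rewrite -(@grng_mul _ _ a b)// abE grng_mul// grng_inv.
  have sb : gsrc b = grng k.
    by rewrite -(@gsrc_mul _ _ a b)// abE gsrc_mul ?gsrc_inv// grng_inv.
  exists (gmul (ginv a) g); first by rewrite gsrc_mul// gsrc_inv.
  have bE : b = gmul (gmul (ginv a) g) (ginv k).
    rewrite -gmulA ?grng_inv ?gsrc_inv//.
    by rewrite -abE gmulKl.
  rewrite -bE; congr (_, _).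
  rewrite ginvM ?gsrc_inv// ginvK gmulA ?gsrc_inv ?grng_inv//.
  by rewrite gmulVr -sa gmul1l.
Qed.

(** Bounds the nonzero entries of [kern f] in each row and column, phrased by norms so as not to
    depend on the chosen lifts. *)
Definition finite_propagation m f :=
  [/\ is_section f,
      forall g, exists s : seq G, (size s <= m)%N /\ forall k, gsrc g = gsrc k ->
        k \notin s -> fell_norm (f (gmul g (ginv k))) = 0
    & forall k, exists s : seq G, (size s <= m)%N /\ forall g, gsrc g = gsrc k ->
        g \notin s -> fell_norm (f (gmul g (ginv k))) = 0].

Definition regular_fun f (x : G -> R[i]) g :=
  \sum_(k \in [set k | gsrc k = gsrc g]) kern f g k * x k.

(** The list does not depend on [x], so linearity of [regular_fun f] in [x] reduces to that of
    ordinary finite sums. *)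
Lemma regular_fun_row m f g : finite_propagation m f ->
  exists s : seq G, [/\ uniq s, {in s, forall k, gsrc k = gsrc g},
    forall k, k \notin s -> kern f g k = 0
    & forall x, regular_fun f x g = \sum_(k <- s) kern f g k * x k].
Proof.
move=> [fs row _]; have [s0 [_ s0P]] := row g.
pose s := undup [seq k <- s0 | `[< gsrc k = gsrc g >]].
have sg : {in s, forall k, gsrc k = gsrc g}.
  by move=> k; rewrite mem_undup mem_filter => /andP[/asboolP].
have sn k : k \notin s -> kern f g k = 0.
  move=> ks; have [gk|gk] := pselect (gsrc g = gsrc k); last exact: kern_out.
  apply: rnorm0_eq0; rewrite kern_norm// s0P//; apply: contra ks => ks.
  by rewrite mem_undup mem_filter ks andbT; apply/asboolP.
exists s; split; rewrite ?undup_uniq// => x; rewrite /regular_fun.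
rewrite (@fsbigE _ _ _ _ _ s) ?undup_uniq//; last first.
  by move=> k _ /sn ->; rewrite mul0r.
rewrite big_seq_cond [RHS]big_seq; apply: eq_bigl => k.
by rewrite andb_idr// => /sg kg; exact: mem_set.
Qed.

Lemma regular_repE u f (x : G -> R[i]) (xi : G -> L) g :
  is_section f -> (forall k, gsrc k = u -> xi k = fell_class (lift k) (x k)) ->
  gsrc g = u -> regular_rep u f xi g = fell_class (lift g) (regular_fun f x g).
Proof.
move=> fs xiE gu; have E1 k : gsrc k = u ->
    fell_mul (f (gmul g (ginv k))) (xi k) = fell_class (lift g) (kern f g k * x k).
  move=> ku; rewrite xiE// kernE ?gu ?ku// fell_mul_class.
    by rewrite gmulrK// !gsrc_lift gu ku.
  by rewrite gsrc_mul ?gsrc_inv// grng_inv !gsrc_lift gu ku.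
rewrite /regular_rep (fell_sum_base (tw_liftK E g)).
  rewrite /regular_fun gu; congr fell_class; apply: eq_fsbigr => k /set_mem/= ku.
  by rewrite E1// fell_coord_class.
by move=> k /= ku; rewrite E1// fell_proj_class tw_liftK.
Qed.

Lemma l2norm_ell2 u (xi : G -> L) (y : L2) :
  (forall g, gsrc g = u -> fell_norm (xi g) = rnorm (y g)) ->
  (forall g, gsrc g <> u -> y g = 0) -> l2norm u xi = (rnorm y)%:E.
Proof.
move=> xy y0; rewrite /l2norm esum_mkcond.
rewrite (_ : (\esum_(g in _) _ = (ell2_norm2 y)%:E)%E).
  by rewrite poweR_EFin powR12_sqrt ?ell2_norm2_ge0// ell2_rnormE.
rewrite /ell2_norm2 -ge0_sumE; last exact: ell2_summable.
  apply: eq_esum => g _; case: ifP => [/set_mem/= gu|/negP gu]; first by rewrite xy.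
  by rewrite y0 ?rnorm0 ?expr0n// => e; apply: gu; exact: mem_set.
by move=> g; exact: sqr_ge0.
Qed.

Lemma l2norm_bounded u (xi : G -> L) (x : G -> R[i]) N : 0 <= N ->
  (forall g, gsrc g = u -> fell_norm (xi g) = rnorm (x g)) ->
  (l2norm u xi <= N%:E)%E ->
  exists y : L2, [/\ forall g, gsrc g = u -> y g = x g,
    forall g, gsrc g <> u -> y g = 0 & rnorm y <= N].
Proof.
move=> N0 xx le; pose y g := if `[< gsrc g = u >] then x g else 0.
have yE g : gsrc g = u -> y g = x g by move=> gu; rewrite /y asboolT.
have y0 g : gsrc g <> u -> y g = 0 by move=> gu; rewrite /y asboolF.
have sy : abs_summable (fun g => rnorm (y g) ^+ 2).
  apply: (@le_lt_trans _ _ (\esum_(g in [set g | gsrc g = u]) (fell_norm (xi g) ^+ 2)%:E)%E).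
    rewrite [leRHS]esum_mkcond; apply: le_esum => g _ /=.
    case: ifP => [/set_mem/= gu|/negP gu].
      by rewrite xx// yE// lee_fin ger0_norm// sqr_ge0.
    by rewrite y0 ?rnorm0 ?expr0n ?normr0// => e; apply: gu; exact: mem_set.
  rewrite ltey; apply/eqP => e; move: le; rewrite /l2norm e poweRyr ?invr_eq0//.
have yn : l2norm u xi = (rnorm (Ell2 sy))%:E.
  by apply: l2norm_ell2 => g gu /=; [rewrite xx// yE|exact: y0].
by exists (Ell2 sy); split=> //=; rewrite -lee_fin -yn.
Qed.

Lemma regular_fun_scale m f (a : R[i]) (x : G -> R[i]) g : finite_propagation m f ->
  regular_fun f (fun k => a * x k) g = a * regular_fun f x g.
Proof.
move=> fp; have [s [_ _ _ sE]] := regular_fun_row g fp; rewrite !sE mulr_sumr.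
by apply: eq_bigr => k _; rewrite mulrCA.
Qed.

Lemma regular_fun_fibre f (x y : G -> R[i]) g :
  (forall k, gsrc k = gsrc g -> x k = y k) -> regular_fun f x g = regular_fun f y g.
Proof. by move=> xy; apply: eq_fsbigr => k /set_mem/= /xy ->. Qed.

(** Scale [x] into the unit ball of H_u, use the supremum, and scale back. Finite sums are bounded
    because the image is not yet known to be square summable. *)
Lemma regular_fun_fibre_bound m f (N : R) u (x : L2) (A : seq G) :
  finite_propagation m f -> uniq A -> (regular_norm u f <= N%:E)%E -> 0 <= N ->
  (forall g, gsrc g <> u -> x g = 0) -> {in A, forall g, gsrc g = u} ->
  \sum_(g <- A) rnorm (regular_fun f x g) ^+ 2 <= N ^+ 2 * rnorm x ^+ 2.
Proof.
move=> fp uA fN N0 xu Au; have [fs _ _] := fp.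
have [x0|x0] := eqVneq (rnorm x) 0.
  rewrite x0 expr0n mulr0 big1// => g _.
  have {}x0 : x = 0 by apply: rnorm0_eq0.
  rewrite /regular_fun fsbig1 ?rnorm0 ?expr0n// => k _.
  by rewrite x0 mulr0.
have xp : 0 < rnorm x by rewrite lt_def x0 rnorm_ge0.
pose c : R[i] := (rnorm x)^-1%:C; pose y : L2 := c *: x.
have y1 : rnorm y = 1.
  by rewrite rnormZ rnorm_real gtr0_norm ?invr_gt0// mulVf.
pose xi k := fell_class (lift k) (y k).
have yu g : gsrc g <> u -> y g = 0 by move=> /xu xg; rewrite ell2_scaleE xg mulr0.
have xib : unit_ball u xi.
  split=> [g _|]; first by rewrite fell_proj_class tw_liftK.
  by rewrite (l2norm_ell2 _ yu) ?y1// => g gu; rewrite fell_norm_class.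
have le : (l2norm u (regular_rep u f xi) <= N%:E)%E.
  by apply: le_trans fN; apply: ereal_sup_ubound; exists xi.
have [|z [zE _ zN]] := l2norm_bounded (x := regular_fun f y) N0 _ le.
  by move=> g gu; rewrite (regular_repE (x := y))// fell_norm_class.
have -> : \sum_(g <- A) rnorm (regular_fun f x g) ^+ 2 =
    rnorm x ^+ 2 * \sum_(g <- A) rnorm (z g) ^+ 2.
  rewrite mulr_sumr; apply: eq_big_seq => g gA.
  rewrite zE ?Au// -exprMn (regular_fun_scale c x g fp) rnormM rnorm_real.
  by rewrite gtr0_norm ?invr_gt0// mulrA mulfV// mul1r.
rewrite mulrC ler_wpM2r ?sqr_ge0//.
apply: (@le_trans _ _ (rnorm z ^+ 2)); last by rewrite lerXn2r ?nnegrE ?rnorm_ge0.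
have := ge0_sum_finite [fset g in A]%fset (sqr_rnorm_ge0 z) (ell2_summable z).
rewrite ell2_rnorm2; apply: le_trans; rewrite le_eqVlt; apply/orP; left; apply/eqP.
apply: perm_big; apply: uniq_perm; rewrite ?fset_uniq// => g.
by rewrite in_fset.
Qed.

(** Group [A] by source: the values over u see only the part of [x] on G_u, and these parts obey
    Bessel's inequality. *)
Lemma regular_fun_bound m f (N : R) (x : L2) (A : seq G) :
  finite_propagation m f -> uniq A -> (reduced_norm f <= N%:E)%E -> 0 <= N ->
  \sum_(g <- A) rnorm (regular_fun f x g) ^+ 2 <= N ^+ 2 * rnorm x ^+ 2.
Proof.
move=> fp uA fN N0.
pose U := undup [seq gsrc g | g <- A].
pose p u := restriction R [set g : G | gsrc g = u].
have pP : orth_projections p := restriction_orth R (@gsrc X G).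
have -> : \sum_(g <- A) rnorm (regular_fun f x g) ^+ 2 =
    \sum_(u <- U) \sum_(g <- A | gsrc g == u) rnorm (regular_fun f x g) ^+ 2.
  rewrite (exchange_big_dep predT)//=; apply: eq_big_seq => g gA.
  rewrite -big_filter (_ : [seq u <- U | gsrc g == u] = [:: gsrc g]) ?big_seq1//.
  apply/perm_small_eq => //; apply: uniq_perm; rewrite ?filter_uniq ?undup_uniq//.
  move=> u; rewrite mem_filter inE mem_undup eq_sym; case: eqP => //= ->.
  by apply/mapP; exists g.
apply: (@le_trans _ _ (N ^+ 2 * \sum_(u <- U) rnorm (p u x) ^+ 2)); last first.
  by rewrite ler_wpM2l ?sqr_ge0// orth_projections_bessel// undup_uniq.
rewrite mulr_sumr; apply: ler_sum => u _; rewrite -big_filter.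
have -> : \sum_(g <- [seq g <- A | gsrc g == u]) rnorm (regular_fun f x g) ^+ 2 =
    \sum_(g <- [seq g <- A | gsrc g == u]) rnorm (regular_fun f (p u x) g) ^+ 2.
  apply: eq_big_seq => g; rewrite mem_filter => /andP[/eqP gu _].
  congr (rnorm _ ^+ 2); apply: regular_fun_fibre => k kg.
  by rewrite restrictionE mem_set//= kg.
apply: (regular_fun_fibre_bound (u := u) fp) => //.
- by rewrite filter_uniq.
- apply: le_trans fN; apply: ereal_sup_ubound; right; by exists u.
- by move=> g gu; rewrite restrictionE; case: ifP => // /set_mem.
- by move=> g; rewrite mem_filter => /andP[/eqP].
Qed.

Lemma regular_op_exists m f (N : R) : finite_propagation m f ->
  reduced_norm f = N%:E -> exists T : bop L2,
  [/\ forall x g, T x g = regular_fun f x g, forall g k, mx_entry T g k = kern f g k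
    & opnorm T = N].
Proof.
move=> fp fN; have [fs _ _] := fp.
have N0 : 0 <= N.
  by rewrite -lee_fin -fN; apply: ereal_sup_ubound; left.
have bd (x : L2) : abs_summable (fun g => rnorm (regular_fun f x g) ^+ 2) /\
    ge0_sum (fun g => rnorm (regular_fun f x g) ^+ 2) <= N ^+ 2 * rnorm x ^+ 2.
  apply: bounded_summable => [g|A]; first exact: sqr_ge0.
  by apply: (regular_fun_bound x fp (fset_uniq A) _ N0); rewrite fN.
pose T (x : L2) : L2 := Ell2 (bd x).1.
have Tl (a : R[i]) (x y : L2) : T (a *: x + y) = a *: T x + T y.
  apply: ell2_eq => g; rewrite ell2_addE ell2_scaleE /=.
  have [s [_ _ _ sE]] := regular_fun_row g fp; rewrite !sE mulr_sumr -big_split.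
  by apply: eq_bigr => k _ /=; rewrite mulrDr mulrCA.
have Tn (x : L2) : rnorm (T x) <= N * rnorm x.
  rewrite -(@ler_pXn2r _ 2)// ?nnegrE ?mulr_ge0 ?rnorm_ge0// exprMn ell2_rnorm2.
  exact: (bd x).2.
have Tb : exists M : R, forall x, rnorm (T x) <= M * rnorm x by exists N.
pose B := Bop Tl Tb; exists B; split=> // [g k|].
  rewrite mx_entryE /= /regular_fun.
  have [gk|gk] := pselect (gsrc k = gsrc g); last first.
    rewrite kern_out; last by move=> e; apply: gk.
    apply: fsbig1 => l /= lg; case: eqP => [e|_]; rewrite ?mulr0//.
    by rewrite -e in lg.
  rewrite (@fsbigE _ _ _ _ _ [:: k])//.
  - by rewrite big_cons big_nil mem_set//= eqxx mulr1 addr0.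
  - by move=> l /=; rewrite inE => /eqP ->.
  - by move=> l _; rewrite inE eq_sym => /negPf ->; rewrite mulr0.
(* For the reverse inequality, a unit vector of H_u is extended by zero to all of [G], and its image
   is restricted to G_u. *)
apply/eqP; rewrite eq_le opnorm_le//= -lee_fin -fN.
apply: ge_ereal_sup => _ [->|[u _ <-]]; first by rewrite lee_fin opnorm_ge0.
apply: ge_ereal_sup => _ [xi [xis xi1] <-].
pose x g := fell_coord (lift g) (xi g).
have xiE k : gsrc k = u -> xi k = fell_class (lift k) (x k).
  by move=> ku; rewrite fell_coordK// xis// tw_liftK.
have [|y [yE y0 y1]] := l2norm_bounded (x := x) ler01 _ xi1.
  by move=> g gu; rewrite xiE// fell_norm_class.
have xiE' k : gsrc k = u -> xi k = fell_class (lift k) (y k).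
  by move=> ku; rewrite xiE// yE.
rewrite (@l2norm_ell2 u _ (restr_vec [set g | gsrc g = u] (B y))) => [|g gu|g gu].
- rewrite lee_fin (le_trans (restr_vec_le _ _))// (le_trans (opnormP _ _))//.
  by rewrite ler_piMr ?opnorm_ge0.
- by rewrite (regular_repE fs xiE' gu) fell_norm_class restr_vecE mem_set.
- by rewrite restr_vecE; case: ifP => // /set_mem.
Qed.

Lemma card_le_seq (I : choiceType) (D : set I) (s : seq I) m : (size s <= m)%N ->
  (forall i, D i -> i \in s) -> (D #<= `I_m)%card.
Proof.
move=> sm Ds; have [[i0 Di0]|D0] := pselect (D !=set0); last first.
  by have -> : D = set0 by [apply/seteqP; split=> // i Di; case: D0; exists i].
apply: (card_le_trans _ (card_image_le (nth i0 s) `I_m)); apply: subset_card_le => i Di.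
exists (index i s); last by rewrite nth_index ?Ds.
by apply: leq_trans sm; rewrite index_mem Ds.
Qed.

Lemma regular_op_propagation m f (T : bop L2) : finite_propagation m f ->
  (forall g k, mx_entry T g k = kern f g k) -> propagation_le m T.
Proof.
move=> [fs row col] TE; split=> [g|k].
  have [s [sm sP]] := row g; apply: (card_le_seq sm) => k /=; rewrite TE.
  apply: contraNT => ks; have [gk|gk] := pselect (gsrc g = gsrc k); last first.
    by rewrite kern_out.
  by apply/eqP/rnorm0_eq0; rewrite kern_norm// sP.
have [s [sm sP]] := col k; apply: (card_le_seq sm) => g /=; rewrite TE.
apply: contraNT => ks; have [gk|gk] := pselect (gsrc g = gsrc k); last first.
  by rewrite kern_out.
by apply/eqP/rnorm0_eq0; rewrite kern_norm// sP.
Qed.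

(** Sections go to their operators on the l^2 space of all arrows, isometrically for the reduced
    norm. Matrix entries determine an operator, so multiplicativity and compatibility with adjoints
    are identities for [kern]. *)
Lemma reduced_completion_controlled (S : set (G -> L)) (A : cstarAlgType R[i])
    (j : (G -> L) -> A) : reduced_completion S j ->
  (forall f, S f -> exists m, finite_propagation m f) ->
  (forall a f h, S f -> S h -> S (section_lin a f h)) ->
  (forall f h, S f -> S h -> S (convolution f h)) ->
  (forall f, S f -> S (involution f)) -> controlled_propagation A.
Proof.
move=> [jl jM jS jn jd] Sp Sl SM SS.
have /choice[t tP] f : exists T : bop L2, S f ->
    [/\ forall x g, T x g = regular_fun f x g, forall g k, mx_entry T g k = kern f g k
      & opnorm T = rnorm (j f)].
  have [Sf|Sf] := pselect (S f); last by exists 0.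
  have [m fp] := Sp f Sf; have [T TP] := regular_op_exists fp (esym (jn f Sf)).
  by exists T.
have sec f : S f -> is_section f by move=> /Sp[m []].
have ent f : S f -> forall g k, mx_entry (t f) g k = kern f g k by move=> /tP[].
have [a f h Sf Sh|f h Sf Sh|f Sf|f Sf|rho [rhoH rhoI rhoC]] :=
  @isometric_extension R A (bop L2) _ S (@section_lin _ _ _ E) (@convolution _ _ _ E)
    (@involution _ _ _ E) j t _ _ _ _ jd.
- split; [exact: Sl|exact: jl|]; apply: mx_entry_inj => g k; rewrite ent; last exact: Sl.
  rewrite kern_lin; [|exact: sec..].
  rewrite [RHS]mx_entryE bop_addE bop_scaleE ell2_addE ell2_scaleE -!mx_entryE.
  by rewrite !ent.
- split; [exact: SM|exact: jM|]; apply: mx_entry_inj => g k; rewrite ent; last exact: SM.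
  rewrite -[cmul _ _]/(bop_comp (t f) (t h)) [RHS]mx_entryE /=.
  have [-> _ _] := tP f Sf; rewrite /regular_fun.
  have [gk|gk] := pselect (gsrc g = gsrc k); last first.
    rewrite kern_out// fsbig1// => l /= lg.
    by rewrite -mx_entryE ent// [kern h l k]kern_out ?mulr0// lg.
  rewrite kern_conv; [|exact: sec|exact: sec|exact: gk].
  by apply: eq_fsbigr => l _; rewrite -mx_entryE ent.
- split; [exact: SS|exact: jS|]; apply: mx_entry_inj => g k; rewrite ent; last exact: SS.
  by rewrite kern_star ?mx_entry_adjoint ?ent//; exact: sec.
- by have [_ _] := tP f Sf.
exists G, rho; split=> //; apply: subset_trans rhoC _; apply: closure_subset => _ [f Sf <-].
have [m fp] := Sp f Sf; have [_ tE _] := tP f Sf.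
(* [m] may be 0, whereas the union defining [controlled_operators] starts at 1. *)
exists (maxn 1 m); first by rewrite /= leq_maxl.
have [h1 h2] := regular_op_propagation fp tE.
by split=> i; [apply: card_le_trans (h1 i) _|apply: card_le_trans (h2 i) _];
  rewrite card_le_II leq_maxr.
Qed.

End RegularOperator.

(** * Topology of the Fell bundle and of the groupoid *)

Section TopologyLemmas.

Lemma within_nbhs (T U : topologicalType) (A : set T) (f : T -> U) x W :
  {within A, continuous f} -> A x -> nbhs (f x) W -> nbhs x [set y | A y -> W (f y)].
Proof. by move=> /subspace_continuousP fc Ax Wfx; exact: (fc x Ax W Wfx). Qed.

Lemma nbhs_within (T U : topologicalType) (A : set T) (f : T -> U) :
  (forall x W, A x -> nbhs (f x) W -> nbhs x [set y | A y -> W (f y)]) ->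
  {within A, continuous f}.
Proof. by move=> h; apply/subspace_continuousP => x Ax W; exact: h. Qed.

(* Stands in for finite subcovers, whose library version asks for a pointed
   space. *)
Lemma compact_induction (T : topologicalType) (P : set T -> Prop) (K : set T) :
  P set0 -> (forall A B, A `<=` B -> P B -> P A) ->
  (forall A B, P A -> P B -> P (A `|` B)) ->
  compact K -> (forall x, K x -> exists2 N, nbhs x N & P N) -> P K.
Proof.
move=> P0 Pmono PU Kc Kloc; apply: contrapT => nPK.
pose F : set_system T := filter_from P (fun A => K `\` A).
have FF : ProperFilter F.
  apply: filter_from_proper.
    apply: filter_from_filter; first by exists set0.
    move=> A B PA PB; exists (A `|` B); first exact: PU.
    by move=> x [Kx /not_orP[Ax Bx]].
  move=> A PA; apply: contrapT => KA; apply: nPK; apply: Pmono PA => x Kx.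
  by apply: contrapT => Ax; apply: KA; exists x.
have [|x [Kx xF]] := Kc F; first by exists set0 => // x [].
have [N Nx PN] := Kloc x Kx.
have [|y [[_ nNy] Ny]] := xF (K `\` N) N _ Nx; first by exists N.
exact: nNy.
Qed.

(** Separation of the points of [U] by neighbourhoods in the ambient space: the cluster condition
    says that no neighbourhoods of the two points are disjoint. *)
Definition relatively_hausdorff (T : topologicalType) (U : set T) :=
  forall x y, U x -> U y -> cluster (nbhs x) y -> x = y.

Lemma nbhs_subspace_open (T : topologicalType) (U : set T) x (A : set T) :
  open U -> U x -> nbhs (x : subspace U) (A : set (subspace U)) <-> nbhs x A.
Proof.
move=> Uo Ux; have Un : nbhs x U by apply: open_nbhs_nbhs.
rewrite -[nbhs (x : subspace U) A]/(nbhs_subspace (x : subspace U) A).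
rewrite -nbhs_subspace_in//; split=> [h|]; last by apply: filterS.
have h' : nbhs x [set y | U y -> A y] := h.
by apply: filterS (filterI h' Un) => y [] /[apply].
Qed.

Lemma nbhs_subspace_isolated (T : topologicalType) (U : set T) x : ~ U x ->
  nbhs (x : subspace U) [set x].
Proof.
move=> Ux; rewrite -[nbhs _ _]/(nbhs_subspace (x : subspace U) [set x]).
by rewrite -nbhs_subspace_out.
Qed.

(** In [subspace U] the points outside [U] are isolated, so separation is only at stake inside [U],
    where the neighbourhoods are the ambient ones. *)
Lemma hausdorff_subspaceP (T : topologicalType) (U : set T) : open U ->
  hausdorff_space (subspace U) <-> relatively_hausdorff U.
Proof.
move=> Uo; have self (z : T) : U z -> nbhs (z : subspace U) U.
  by move=> Uz; apply/nbhs_subspace_open => //; exact: open_nbhs_nbhs.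
split=> [h x y Ux Uy xy|h x y xy].
  by apply: (h x y) => A B /(nbhs_subspace_open _ Uo Ux) Ax /(nbhs_subspace_open _ Uo Uy);
     exact: xy.
have [Ux|Ux] := pselect (U x); last first.
  have [Uy|Uy] := pselect (U y).
    by have [z [zx Uz]] := xy _ _ (nbhs_subspace_isolated Ux) (self y Uy); rewrite zx in Uz.
  by have [z [-> ->]] := xy _ _ (nbhs_subspace_isolated Ux) (nbhs_subspace_isolated Uy).
have [Uy|Uy] := pselect (U y); last first.
  by have [z [Uz zy]] := xy _ _ (self x Ux) (nbhs_subspace_isolated Uy); rewrite zy in Uz.
apply: h => // A B Ax By; apply: xy; exact/nbhs_subspace_open.
Qed.

(** Replaces closedness of compact sets, which fails in a non-Hausdorff space; within a set of
    separated points it still holds. *)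
Lemma compact_relatively_closed (T : topologicalType) (U C : set T) x :
  relatively_hausdorff U -> compact C -> C `<=` U -> U x -> closure C x -> C x.
Proof.
move=> Uh Cc CU Ux Cx.
have FF : ProperFilter (within C (nbhs x)) by apply: within_nbhs_proper.
have [|y [Cy xy]] := Cc (within C (nbhs x)); first exact: withinT.
rewrite (Uh x y Ux (CU y Cy))// => A B Ax By; apply: xy => //.
by apply: filterS Ax => z Az _.
Qed.

End TopologyLemmas.

Section FellTopology.
Variables (R : realType) (X : topologicalType) (G : topGroupoid X).
Variable E : twist R G.
Local Notation L := (fell E).
Local Notation act := (circle_act (@tw_incl _ _ _ E)).
Implicit Types (s t : E) (l m : L) (g k : G) (a b z : R[i]).

Lemma gmul_nbhs (S : topGroupoid X) (x y : S) W : gsrc x = grng y ->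
  nbhs (gmul x y) W -> exists A B, [/\ nbhs x A, nbhs y B &
    forall x' y', A x' -> B y' -> gsrc x' = grng y' -> W (gmul x' y')].
Proof.
move=> xy Wxy.
have [[A B] /= [Ax By] AB] := within_nbhs (x := (x, y)) (@gmul_continuous _ S) xy Wxy.
by exists A, B; split=> // x' y' Ax' By' xy'; exact: (AB (x', y')).
Qed.

Lemma act_continuous z : circle z -> continuous (act z).
Proof.
move=> cz s W; rewrite /circle_act => Ws.
have [|A [B [Ai Bs AB]]] := gmul_nbhs _ Ws; first by rewrite tw_incl_src.
have [[A1 A2] /= [A1s A2z] A12] :=
  within_nbhs (x := (grng s, z)) (@tw_incl_continuous _ _ _ E) cz Ai.
have := @grng_continuous _ E s A1 A1s; move=> A1s'.
apply: filterS (filterI Bs A1s') => t [Bt /= A1t].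
apply: AB => //; last by rewrite tw_incl_src.
by apply: (A12 (grng t, z)) => //; split => //=; exact: nbhs_singleton.
Qed.

Lemma fell_class_continuous : continuous (fun p : E * R[i] => fell_class p.1 p.2).
Proof.
have -> : (fun p : E * R[i] => fell_class p.1 p.2) =
    (\pi_(quotient_topology {eq_quot fell_equiv E}) : E * R[i] -> L).
  by apply/funext => -[s a].
exact: pi_continuous.
Qed.

Lemma rnbhsP (V : normedModType R[i]) (x : V) W :
  nbhs x W <-> exists2 e : R, 0 < e & forall y, rnorm (x - y) < e -> W y.
Proof.
split=> [|[e e0 eW]]; last first.
  suff : nbhs x [set y | rnorm (x - y) < e] by apply: filterS => y; exact: eW.
  by have /rcvgP := @cvg_id _ (nbhs x); apply.
rewrite -filter_from_ballE => -[e e0 eW]; exists (complex.Re e).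
  by rewrite -ltcR -Re_real_complex// ltW.
move=> y xy; apply: eW; rewrite -ball_normE /= rnormE (Re_real_complex (ltW e0)).
by rewrite ltcR.
Qed.

Lemma complex_mul_nbhs (a b : R[i]) W : nbhs (a * b) W ->
  exists A B, [/\ nbhs a A, nbhs b B & forall a' b', A a' -> B b' -> W (a' * b')].
Proof.
move=> /rnbhsP[e e0 eW]; pose K := 1 + rnorm a + rnorm b.
have a0 := rnorm_ge0 a; have b0 := rnorm_ge0 b.
have K0 : 0 < K by rewrite /K -addrA ltr_wpDr ?addr_ge0.
pose d := Num.min 1 (e / (2 * K)).
have d0 : 0 < d by rewrite lt_min ltr01 divr_gt0// mulr_gt0.
have d1 : d <= 1 by rewrite ge_min lexx.
have dK : d * (2 * K) <= e by rewrite -ler_pdivlMr ?mulr_gt0// ge_min lexx orbT.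
exists [set a' | rnorm (a - a') < d], [set b' | rnorm (b - b') < d].
split; [by apply/rnbhsP; exists d..|move=> a' b' /= ad bd; apply: eW].
have -> : a * b - a' * b' = (a - a') * b + a' * (b - b') by ring.
rewrite (le_lt_trans (rnormD _ _))// !rnormM.
have a'1 : rnorm a' <= rnorm a + 1.
  rewrite -(subrK a a') addrC (le_trans (rnormD _ _))// lerD2l rdistC.
  by rewrite (le_trans (ltW ad)).
apply: (@le_lt_trans _ _ (d * rnorm b + (rnorm a + 1) * d)); last first.
  by apply: lt_le_trans dK; rewrite /K; nra.
by apply: lerD; [rewrite ler_wpM2r// ltW|apply: ler_pM; rewrite ?rnorm_ge0// ltW].
Qed.

Lemma complex_mul_continuous (z : R[i]) : continuous (fun a : R[i] => z * a).
Proof.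
move=> a W /complex_mul_nbhs[A [B [Az Ba AB]]].
by apply: filterS Ba => b Bb; apply: AB => //; exact: nbhs_singleton.
Qed.

(* The projection onto the Fell bundle is open, the circle acting by
   homeomorphisms. *)
Lemma fell_nbhsP s a (W : set L) :
  nbhs (fell_class s a) W <-> nbhs (s, a) [set p : E * R[i] | W (fell_class p.1 p.2)].
Proof.
split=> [|]; first exact: (@fell_class_continuous (s, a)).
move=> Wsa; pose Q := interior [set p : E * R[i] | W (fell_class p.1 p.2)].
have Qo : open Q by exact: open_interior.
have Qsa : Q (s, a) by exact: Wsa.
have QW : forall p, Q p -> W (fell_class p.1 p.2) by exact: interior_subset.
pose V : set L := [set l | exists p, Q p /\ l = fell_class p.1 p.2].
apply: (@filterS _ _ _ V); first by move=> _ [p [/QW Wp ->]].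
apply: open_nbhs_nbhs; split; last by exists (s, a).
rewrite /open /= /quotient_open openE => -[t b] [[s' a'] [Qp /fell_classP[z [cz /= e1 e2]]]].
have cz' := circleJ cz.
have zz : z * Num.conj z = 1 by rewrite mulrC circleVJ.
have Qtb : nbhs (act z t, Num.conj z * b) Q.
  rewrite -e1 -e2; exact: open_nbhs_nbhs.
have [[A B] /= [At Bb] AB] := Qtb.
have At' := act_continuous cz At.
have Bb' := complex_mul_continuous (z := Num.conj z) (x := b) Bb.
exists (act z @^-1` A, (fun a : R[i] => Num.conj z * a) @^-1` B); first by split.
move=> [t' b'] /= [At1 Bb1]; exists (act z t', Num.conj z * b'); split.
  exact: (AB (_, _)).
by apply/fell_classP; exists z.
Qed.

(** With the converse that follows, every continuity claim on the Fell bundle becomes one about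
    representatives in the twist and the scalars. *)
Lemma fell_prod_nbhs s a (W : set L) : nbhs (fell_class s a) W ->
  exists A B, [/\ nbhs s A, nbhs a B & forall t b, A t -> B b -> W (fell_class t b)].
Proof.
move=> /fell_nbhsP[[A B] /= [As Ba] AB]; exists A, B; split=> // t b At Bb.
exact: (AB (t, b)).
Qed.

Lemma fell_nbhs_prod s a A B : nbhs s A -> nbhs a B ->
  nbhs (fell_class s a) [set l | exists t b, [/\ A t, B b & l = fell_class t b]].
Proof.
move=> As Ba; apply/fell_nbhsP; exists (A, B) => // -[t b] [/= At Bb].
by exists t, b.
Qed.

Lemma fell_lift_class l : exists s a, l = fell_class s a.
Proof. by have [a ->] := fell_lift (erefl (fell_proj l)); exists (tw_lift E (fell_proj l)), a. Qed.

Lemma conj_continuous : continuous (fun a : R[i] => Num.conj a).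
Proof.
move=> a W /rnbhsP[e e0 eW]; apply/rnbhsP; exists e => // b ab; apply: eW.
by rewrite -rmorphB rnormJ.
Qed.

Lemma fell_star_continuous : continuous (@fell_star R X G E).
Proof.
move=> l W; have [s [a ->]] := fell_lift_class l; rewrite fell_star_class.
move=> /fell_prod_nbhs[A [B [As Ba AB]]].
have := fell_nbhs_prod (@ginv_continuous _ E s _ As) (@conj_continuous a _ Ba).
apply: filterS => _ [t [b [At Bb ->]]] /=.
by rewrite fell_star_class; exact: AB.
Qed.

Lemma fell_proj_continuous : continuous (@fell_proj R X G E).
Proof.
move=> l W; have [s [a ->]] := fell_lift_class l; rewrite fell_proj_class => Ws.
have aT : nbhs a [set: R[i]] by exact: filterT.
have := fell_nbhs_prod (@tw_proj_continuous _ _ _ E s _ Ws) aT.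
by apply: filterS => _ [t [b [At _ ->]]] /=; rewrite fell_proj_class.
Qed.

Lemma fell_mul_nbhs l m W : gsrc (fell_proj l) = grng (fell_proj m) ->
  nbhs (fell_mul l m) W -> exists A B, [/\ nbhs l A, nbhs m B &
    forall l' m', A l' -> B m' -> gsrc (fell_proj l') = grng (fell_proj m') ->
      W (fell_mul l' m')].
Proof.
have [s [a ->]] := fell_lift_class l; have [t [b ->]] := fell_lift_class m.
rewrite !fell_proj_class tw_proj_src tw_proj_rng => st; rewrite fell_mul_class//.
move=> /fell_prod_nbhs[A [B [Ast Bab AB]]].
have [A1 [A2 [A1s A2t A12]]] := gmul_nbhs st Ast.
have [B1 [B2 [B1a B2b B12]]] := complex_mul_nbhs Bab.
exists [set l | exists s a, [/\ A1 s, B1 a & l = fell_class s a]].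
exists [set l | exists s a, [/\ A2 s, B2 a & l = fell_class s a]].
split; [exact: fell_nbhs_prod..|].
move=> _ _ [s' [a' [As Ba ->]]] [t' [b' [At Bb ->]]].
rewrite !fell_proj_class tw_proj_src tw_proj_rng => st'; rewrite fell_mul_class//.
by apply: AB; [exact: A12|exact: B12].
Qed.

Lemma fell_scale_nbhs c l W : nbhs (fell_scale c l) W ->
  exists C A, [/\ nbhs c C, nbhs l A & forall c' l', C c' -> A l' -> W (fell_scale c' l')].
Proof.
have [s [a ->]] := fell_lift_class l; rewrite fell_scale_class.
move=> /fell_prod_nbhs[A [B [As Bca AB]]].
have [B1 [B2 [B1c B2a B12]]] := complex_mul_nbhs Bca.
exists B1, [set l | exists s a, [/\ A s, B2 a & l = fell_class s a]].
split=> //; first exact: fell_nbhs_prod.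
by move=> c' _ Cc [t [b [At Bb ->]]]; rewrite fell_scale_class; apply: AB => //; exact: B12.
Qed.

(** The pointwise choice [tw_lift] need not be continuous; a trivialization supplies a continuous
    local lift and a continuous scalar coordinate relative to it. *)
Lemma local_section g0 : exists (U : set G) (sg : G -> E),
  [/\ open U, U g0, forall g, U g -> tw_proj (sg g) = g,
      forall g, U g -> {for g, continuous sg}
    & forall l, U (fell_proj l) ->
        {for l, continuous (fun l => fell_coord (sg (fell_proj l)) l)}].
Proof.
have [U [phi [psi [Uo Ug [phic psic h1 h2 h3]]]]] := tw_bundle E g0.
pose sg g := phi g 1.
have sgP g : U g -> tw_proj (sg g) = g.
  by move=> Ug'; have [] := h1 g 1 Ug' (circle1 R).
have sgE s : U (tw_proj s) -> circle (psi s) /\ s = act (psi s) (sg (tw_proj s)).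
  move=> Us; have [cs sE] := h2 s Us; split=> //.
  by rewrite -h3// ?mulr1//; exact: circle1.
have coordE s a : U (tw_proj s) -> fell_coord (sg (tw_proj s)) (fell_class s a) = psi s * a.
  move=> Us; have [cs sE] := sgE s Us.
  suff -> : fell_class s a = fell_class (sg (tw_proj s)) (psi s * a).
    by rewrite fell_coord_class.
  apply/esym/fell_classP; exists (psi s); split=> //.
  by rewrite mulrA circleVJ// mul1r.
exists U, sg; split=> // [g Ug' W Wg|l].
  have [[A B] /= [Ag B1] AB] :=
    within_nbhs (T := (G * R[i])%type) (x := (g, 1)) phic (conj Ug' (circle1 R)) Wg.
  have Un : nbhs g U by exact: open_nbhs_nbhs.
  apply: filterS (filterI Ag Un) => k [Ak Uk]; apply: (AB (k, 1)); last by split => //; exact: circle1.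
  by split=> //=; exact: nbhs_singleton.
have [s [a ->]] := fell_lift_class l; rewrite fell_proj_class => Us W.
rewrite fell_proj_class coordE// => /complex_mul_nbhs[A [B [As Ba AB]]].
have As' := within_nbhs psic Us As.
have Us' : nbhs s [set t : E | U (tw_proj t)].
  by apply: (@tw_proj_continuous _ _ _ E s); exact: open_nbhs_nbhs.
have AU : nbhs s ([set t : E | U (tw_proj t) -> A (psi t)] `&` [set t : E | U (tw_proj t)]).
  exact: filterI.
have := fell_nbhs_prod AU Ba.
apply: filterS => _ [t [b [[/= At Ut] Bb ->]]] /=.
by rewrite fell_proj_class coordE//; apply: AB => //; exact: At.
Qed.

Lemma fell_zero_continuous : continuous (fell_zero E).
Proof.
move=> g W; have [U [sg [Uo Ug sgP sgc _]]] := local_section g.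
rewrite (fell_zeroE (sgP g Ug)) => /fell_prod_nbhs[A [B [As B0 AB]]].
have As' : nbhs g (sg @^-1` A) := sgc g Ug A As.
have Un : nbhs g U by exact: open_nbhs_nbhs.
apply: filterS (filterI As' Un) => k [/= Ak Uk]; rewrite (fell_zeroE (sgP k Uk)); apply: AB => //.
exact: nbhs_singleton.
Qed.

End FellTopology.

(** * Bisections, compact sets and bump functions *)

Section EtaleGroupoids.
Variables (X : topologicalType) (G : topGroupoid X).
Hypothesis etG : etale G.
Implicit Types (g k a b : G) (U V W : set G) (u : X).

Lemma gsrc_open V : open V -> open (@gsrc X G @` V).
Proof.
move=> Vo; rewrite openE => _ [g Vg <-].
have [U [Uo Ug _ _ Uop]] := etG g.
have : open (@gsrc X G @` (U `&` V)).
  by apply: Uop; [exact: subIsetl|exact: openI].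
move=> o; apply: (@filterS _ _ _ (@gsrc X G @` (U `&` V))).
  by move=> _ [k [_ Vk] <-]; exists k.
by apply: open_nbhs_nbhs; split=> //; exists g.
Qed.

Lemma grng_open V : open V -> open (@grng X G @` V).
Proof.
move=> Vo; have -> : @grng X G @` V = @gsrc X G @` (@ginv X G @^-1` V).
  apply/seteqP; split=> _ [g Vg <-].
    by exists (ginv g); rewrite /= ?ginvK ?gsrc_inv.
  by exists (ginv g); rewrite /= ?grng_inv.
by apply: gsrc_open; apply: open_comp => // g _; exact: ginv_continuous.
Qed.

Definition bisection V :=
  [/\ open V, set_inj V (@gsrc X G) & set_inj V (@grng X G)].

Lemma bisection_exists g U : nbhs g U -> exists V, [/\ bisection V, V g & V `<=` U].
Proof.
rewrite nbhsE => -[U' [U'o U'g] U'U].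
have [A [Ao Ag Ai _ _]] := etG g; have [B [Bo Bg Bi _ _]] := etG (ginv g).
exists (U' `&` (A `&` (@ginv X G @^-1` B))); split=> //.
- split.
  + apply: openI => //; apply: openI => //.
    by apply: open_comp => // k _; exact: ginv_continuous.
  + move=> a b /set_mem[_ [Aa _]] /set_mem[_ [Ab _]] ab.
    by apply: Ai => //; exact: mem_set.
  + move=> a b /set_mem[_ [_ Ba]] /set_mem[_ [_ Bb]] ab.
    rewrite -(ginvK a) -(ginvK b); congr ginv; apply: Bi; [exact: mem_set..|].
    by rewrite !gsrc_inv.
- by move=> k [/U'U].
Qed.

Definition fibrewise_finite n (N : set G) :=
  (forall u, exists s : seq G, (size s <= n)%N /\
     forall g, N g -> gsrc g = u -> g \in s) /\
  (forall u, exists s : seq G, (size s <= n)%N /\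
     forall g, N g -> grng g = u -> g \in s).

(** A bisection meets each source fibre and each range fibre at most once, and such bounds add up
    over a finite cover. *)
Lemma compact_fibrewise_finite (K : set G) : compact K ->
  exists n, fibrewise_finite n K.
Proof.
move=> Kc; apply: (compact_induction (P := fun N => exists n, fibrewise_finite n N) _ _ _ Kc).
- by exists 0%N; split=> u; exists [::].
- move=> A B AB [n [h1 h2]]; exists n; split=> u.
    by have [s [sn sP]] := h1 u; exists s; split=> // g /AB; exact: sP.
  by have [s [sn sP]] := h2 u; exists s; split=> // g /AB; exact: sP.
- move=> A B [n [h1 h2]] [m [k1 k2]]; exists (n + m)%N; split=> u.
    have [s [sn sP]] := h1 u; have [t [tm tP]] := k1 u.
    exists (s ++ t); split=> [|g]; first by rewrite size_cat leq_add.
    by case=> [Ag|Bg] gu; rewrite mem_cat; [rewrite (sP _ Ag gu)|rewrite (tP _ Bg gu) orbT].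
  have [s [sn sP]] := h2 u; have [t [tm tP]] := k2 u.
  exists (s ++ t); split=> [|g]; first by rewrite size_cat leq_add.
  by case=> [Ag|Bg] gu; rewrite mem_cat; [rewrite (sP _ Ag gu)|rewrite (tP _ Bg gu) orbT].
move=> x _; have [V [[Vo Vs Vr] Vx _]] := bisection_exists (@filterT _ (nbhs x) _).
exists V; first exact: open_nbhs_nbhs.
have one (f : G -> X) u : set_inj V f -> exists s : seq G, (size s <= 1)%N /\
    forall g, V g -> f g = u -> g \in s.
  move=> Vi; have [[g [Vg gu]]|no] := pselect (exists g, V g /\ f g = u).
    exists [:: g]; split=> // k Vk ku; rewrite inE; apply/eqP.
    by apply: Vi; rewrite ?ku ?gu//; exact: mem_set.
  by exists [::]; split=> // k Vk ku; case: no; exists k.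
by exists 1%N; split=> u; exact: one.
Qed.

Variable R : realType.
Variable E : twist R G.
Local Notation L := (fell E).

(** The arrow [g k^-1] has the range of [g], and its source is the range of [k]. So range fibres of
    the compact set bound the rows, and source fibres the columns. *)
Lemma compact_support_propagation (f : G -> L) (K : set G) : is_section f ->
  compact K -> nonzero_set f `<=` K -> exists m, finite_propagation m f.
Proof.
move=> fs Kc fK; have [n [h1 h2]] := compact_fibrewise_finite Kc; exists n.
have f0 x : ~ K x -> fell_norm (f x) = 0.
  move=> Kx; apply/fell_norm0; rewrite fs; apply: contrapT => fx.
  by apply: Kx; apply: fK.
split=> // [g|k].
  have [s [sn sP]] := h2 (grng g); exists [seq gmul (ginv a) g | a <- s].
  split=> [|k gk ks]; first by rewrite size_map.
  apply: f0 => Kgk; move/negP: ks; apply; apply/mapP.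
  exists (gmul g (ginv k)); first by rewrite sP// grng_mul// grng_inv.
  by rewrite ginvMV// gmulrK.
have [s [sn sP]] := h1 (grng k); exists [seq gmul a k | a <- s].
split=> [|g gk gs]; first by rewrite size_map.
apply: f0 => Kgk; move/negP: gs; apply; apply/mapP.
exists (gmul g (ginv k)); last by rewrite gmulrK.
by rewrite sP// gsrc_mul ?gsrc_inv// grng_inv.
Qed.

Hypothesis hausX : hausdorff_space X.

(** Taken with the source map, this makes every bisection Hausdorff although the arrow space may not
    be. *)
Lemma injective_relatively_hausdorff (Y : set G) (f : G -> X) : continuous f ->
  set_inj Y f -> relatively_hausdorff Y.
Proof.
move=> fc fi x y Yx Yy xy; apply: fi; [exact: mem_set..|].
apply: hausX => A B Ax By; have [z [Az Bz]] := xy _ _ (fc x A Ax) (fc y B By).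
by exists (f z).
Qed.

(** The composable pairs are closed in the product because the unit space is Hausdorff; the arrow
    space plays no part in that. *)
Lemma compact_composable (K1 K2 : set G) : compact K1 -> compact K2 ->
  compact [set gmul p.1 p.2 | p in [set p : G * G |
    [/\ K1 p.1, K2 p.2 & gsrc p.1 = grng p.2]]].
Proof.
move=> K1c K2c; apply: continuous_compact.
  apply: nbhs_within => -[a b] W [/= K1a K2b ab] Wab.
  have [A [B [Aa Bb AB]]] := gmul_nbhs ab Wab.
  by exists (A, B) => // -[a' b'] /= [Aa' Bb'] [_ _ ab']; exact: AB.
have -> : [set p : G * G | [/\ K1 p.1, K2 p.2 & gsrc p.1 = grng p.2]] =
    (K1 `*` K2) `&` [set p | gsrc p.1 = grng p.2].
  by apply/seteqP; split=> -[a b] /=; [case|case=> -[]].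
apply: compact_closedI; first exact: compact_setX.
move=> [a b] /= h; apply: hausX => A B Aa Bb.
have Na : nbhs a (@gsrc X G @^-1` A) := gsrc_continuous Aa.
have Nb : nbhs b (@grng X G @^-1` B) := grng_continuous Bb.
have [|[a' b'] [/= ab' [Aa' Bb']]] := h ((@gsrc X G @^-1` A) `*` (@grng X G @^-1` B)).
  by exists (@gsrc X G @^-1` A, @grng X G @^-1` B).
by exists (gsrc a'); split=> //; rewrite ab'.
Qed.

Hypothesis lcX : locally_compact [set: X].

Lemma bump_base (u : X) (O : set X) : open O -> O u ->
  exists (chi : X -> R) (D : set X), [/\ continuous chi, compact D, D `<=` O,
    nbhs u [set x | chi x = 1] & forall x, ~ D x -> chi x = 0].
Proof.
move=> Oo Ou; have [Z Zu [Zc Zcl]] := lcX (I : [set: X] u).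
have {}Zu : nbhs u Z.
  have h : nbhs u [set x | [set: X] x -> Z x] := Zu.
  by apply: filterS h => x; apply.
(* Separating [u] from the complement of [Q] confines the set where [f] is small both to [O] and to
   the compact [Z]. *)
pose Q := O `&` interior Z.
have Qo : open Q by apply: openI => //; exact: open_interior.
have Qu : Q u by split.
have [|f [fc fr f0 f1]] := (@uniform_separatorP X R [set u] (~` Q)).1.
  by apply: (locally_compact_completely_regular (R := R) lcX hausX);
    [exact: open_closedC|apply].
have fu : f u = 0 by apply: f0; exists u.
have fQ x : f x <= 2^-1 -> Q x.
  move=> fx; apply: contrapT => Qx; have f1x : f x = 1 by apply: f1; exists x.
  by move: fx; rewrite f1x; lra.
(* The clamp equals 1 where f <= 1/4, a whole neighbourhood of [u], and 0 where f >= 1/2, so it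
   vanishes outside a closed subset of [Z]. *)
pose chi x := Num.max 0 (Num.min 1 (2 - 4 * f x)).
exists chi, (Z `&` [set x | f x <= 2^-1]); split.
- move=> x; apply: (@continuous_max R X (fun=> 0)); first exact: cvg_cst.
  apply: (@continuous_min R X (fun=> 1)); first exact: cvg_cst.
  by apply: cvgB; [exact: cvg_cst|apply: cvgM; [exact: cvg_cst|exact: fc]].
- apply: compact_closedI => //.
  rewrite (_ : [set x | _] = f @^-1` [set r | r <= 2^-1])//.
  by apply: closed_comp => //; exact: closed_le.
- by move=> x [_ /fQ[]].
- have : nbhs u [set x | f x < 4^-1].
    have /cvgrPdist_lt/(_ 4^-1) := fc u; rewrite invr_gt0 ltr0n => /(_ isT).
    by apply: filterS => x; rewrite fu sub0r normrN => /(le_lt_trans (ler_norm _)).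
  apply: filterS => x /= fx; rewrite /chi min_l ?max_r//; lra.
- move=> x Dx; have fx : 2^-1 < f x.
    rewrite ltNge; apply/negP => fx; apply: Dx; split=> //.
    by have [_ /interior_subset] := fQ x fx.
  rewrite /chi max_l// ge_min; apply/orP; right; lra.
Qed.

(** A bump on the base, pulled back along the source map of [V] and extended by zero. Continuity is
    claimed only on [V]: outside it a limit point of [C] may exist. *)
Lemma bump_exists g V : bisection V -> V g ->
  exists (theta : G -> R) (C W : set G), [/\ compact C, C `<=` V,
    nbhs g W /\ W `<=` C, forall x, W x -> theta x = 1
    & (forall x, ~ C x -> theta x = 0) /\ forall x, V x -> {for x, continuous theta}].
Proof.
move=> [Vo Vs _] Vg.
have sVo : open (@gsrc X G @` V) by exact: gsrc_open.
have [|chi [D [chic Dc DV chi1 chi0]]] := bump_base sVo (u := gsrc g).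
  by exists g.
pose theta x := if `[< V x >] then chi (gsrc x) else 0.
have Vn x : V x -> nbhs x V by move=> Vx; exact: open_nbhs_nbhs.
pose C := V `&` (@gsrc X G @^-1` D).
pose W := V `&` (@gsrc X G @^-1` [set x | chi x = 1]).
exists theta, C, W; split.
(* [C] is the homeomorphic copy of [D] under the source map on [V]: a cluster point of the pushed
   filter lifts to one of the filter itself. *)
- move=> F FF FC.
  have FD : F (@gsrc X G @^-1` D) by apply: filterS FC => x [].
  have [d [Dd dF]] := Dc (@gsrc X G @ F) _ FD.
  have [v Vv vd] := DV d Dd; exists v; split; first by split=> //=; rewrite vd.
  move=> A B FA Bv.
  have Bd : nbhs d (@gsrc X G @` (interior B `&` V)).
    apply: open_nbhs_nbhs; split; last by exists v.
    by apply: gsrc_open; apply: openI => //; exact: open_interior.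
  have FAC : F (@gsrc X G @^-1` (@gsrc X G @` (A `&` C))).
    by apply: filterS (filterI FA FC) => x Ax; exists x.
  have [_ [[a [Aa [Va _]] <-] [b [Bb Vb] ab]]] := dF (@gsrc X G @` (A `&` C)) _ FAC Bd.
  exists a; split=> //; rewrite -(Vs b a)//; [exact: interior_subset|exact: mem_set..].
- by move=> x [].
- split; first by apply: filterI; [exact: Vn|exact: gsrc_continuous].
  move=> x [Vx /= c1]; split=> //=; apply: contrapT => /chi0.
  by rewrite c1 => /eqP; rewrite oner_eq0.
- by move=> x [Vx /= c1]; rewrite /theta asboolT.
split=> [x Cx|x Vx].
  by rewrite /theta; case: asboolP => // Vx; apply: chi0 => Dx; apply: Cx.
move=> N; rewrite {1}/theta asboolT// => Nx.
have Nx' : nbhs x [set y | N (chi (gsrc y))].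
  by apply: (@gsrc_continuous _ G x (chi @^-1` N)); exact: chic.
by apply: filterS (filterI Nx' (Vn x Vx)) => y [Ny Vy] /=; rewrite /theta asboolT.
Qed.

(** At a point of [U] outside [V] the bump vanishes nearby, as the compact [C] is closed relative to
    the Hausdorff set [U]. *)
Lemma bump_continuous (theta : G -> R) (U V C : set G) : open U -> relatively_hausdorff U ->
  V `<=` U -> compact C -> C `<=` V -> (forall x, ~ C x -> theta x = 0) ->
  (forall x, V x -> {for x, continuous theta}) ->
  forall x, U x -> {for x, continuous theta}.
Proof.
move=> Uo Uh VU Cc CV th0 thc x Ux; have [Vx|Vx] := pselect (V x); first exact: thc.
have nC : ~ closure C x.
  by move=> /(compact_relatively_closed Uh Cc (subset_trans CV VU) Ux)/CV.
have Cn : nbhs x (~` C).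
  apply: filterS (_ : nbhs x (~` closure C)).
    by move=> y yC Cy; apply: yC; exact: subset_closure.
  by apply: open_nbhs_nbhs; split=> //; apply: closed_openC; exact: closed_closure.
move=> N; rewrite th0; last by move=> /CV.
by move=> N0; apply: filterS Cn => y /th0; rewrite /= => ->; exact: nbhs_singleton.
Qed.

End EtaleGroupoids.

(** * Continuous sections *)

Section Sections.
Variables (R : realType) (X : topologicalType) (G : topGroupoid X).
Variable E : twist R G.
Local Notation L := (fell E).
Local Notation lift := (tw_lift E).
Implicit Types (f h : G -> L) (g k : G) (U V W : set G).

(** Taken with respect to the pointwise lift: suited to fibrewise algebra, not to continuity. *)
Definition coord_fun f g : R[i] := fell_coord (lift g) (f g).

Definition section_mul (c : G -> R[i]) f : G -> L := fun g => fell_scale (c g) (f g).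

Lemma coord_funE f g : is_section f -> f g = fell_class (lift g) (coord_fun f g).
Proof. by move=> fs; rewrite fell_coordK// fs tw_liftK. Qed.

Lemma section_ext f h : is_section f -> is_section h ->
  coord_fun f =1 coord_fun h -> f = h.
Proof.
by move=> fs hs fh; apply/funext => g; rewrite (coord_funE g fs) (coord_funE g hs) fh.
Qed.

Lemma zero_section : is_section (fell_zero E).
Proof. by move=> g; rewrite fell_proj_zero. Qed.

Lemma lin_section a f h : is_section f -> is_section h -> is_section (section_lin a f h).
Proof.
move=> fs hs g; rewrite /section_lin (coord_funE g fs) (coord_funE g hs).
by rewrite fell_scale_class fell_add_class fell_proj_class tw_liftK.
Qed.

Lemma mul_section c f : is_section f -> is_section (section_mul c f).
Proof.
by move=> fs g; rewrite /section_mul (coord_funE g fs) fell_scale_class fell_proj_class tw_liftK.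
Qed.

Lemma involution_section f : is_section f -> is_section (involution f).
Proof.
move=> fs g; rewrite /involution (coord_funE (ginv g) fs) fell_star_class.
by rewrite fell_proj_class tw_projV tw_liftK ginvK.
Qed.

Lemma convolution_section f h : is_section (convolution f h).
Proof. by move=> g; rewrite fell_proj_class tw_liftK. Qed.

Lemma coord_zero g : coord_fun (fell_zero E) g = 0.
Proof. exact: fell_coord_class. Qed.

Lemma coord_lin a f h g : is_section f -> is_section h ->
  coord_fun (section_lin a f h) g = a * coord_fun f g + coord_fun h g.
Proof.
move=> fs hs; rewrite {1}/coord_fun /section_lin (coord_funE g fs) (coord_funE g hs).
by rewrite fell_scale_class fell_add_class fell_coord_class.
Qed.

Lemma coord_mul c f g : is_section f -> coord_fun (section_mul c f) g = c g * coord_fun f g.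
Proof.
move=> fs; rewrite {1}/coord_fun /section_mul (coord_funE g fs).
by rewrite fell_scale_class fell_coord_class.
Qed.

Lemma coord_eq0 f g : is_section f -> coord_fun f g = 0 <-> f g = fell_zero E g.
Proof.
move=> fs; split=> [f0|f0]; first by rewrite (coord_funE g fs) f0.
by rewrite /coord_fun f0 fell_coord_class.
Qed.

Lemma nonzero_coord f g : is_section f -> nonzero_set f g <-> coord_fun f g <> 0.
Proof. by move=> fs; rewrite coord_eq0. Qed.

Lemma nonzero_lin a f h : is_section f -> is_section h ->
  nonzero_set (section_lin a f h) `<=` nonzero_set f `|` nonzero_set h.
Proof.
move=> fs hs g /nonzero_coord; rewrite coord_lin// => /(_ (lin_section _ fs hs)) n.
have [f0|f0] := eqVneq (coord_fun f g) 0.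
  by right; apply/nonzero_coord => // h0; apply: (n _); rewrite f0 h0 mulr0 addr0.
by left; apply/nonzero_coord => //; exact/eqP.
Qed.

Lemma nonzero_mul c f : is_section f ->
  nonzero_set (section_mul c f) `<=` [set g | c g <> 0 /\ nonzero_set f g].
Proof.
move=> fs g /(nonzero_coord _ (mul_section c fs)); rewrite coord_mul// => n.
split=> [c0|]; first by apply: n; rewrite c0 mul0r.
by apply/nonzero_coord => // f0; apply: n; rewrite f0 mulr0.
Qed.

(** Every arrow is [g k^-1] with [k] the unit at its source, so identities between sections can be
    checked on matrices. *)
Lemma section_kern_ext f h : is_section f -> is_section h ->
  (forall g k, gsrc g = gsrc k -> kern f g k = kern h g k) -> f = h.
Proof.
move=> fs hs fh; apply/funext => g; have gs : gsrc g = gsrc (gid G (gsrc g)) by rewrite gsrc_id.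
have gg : gmul g (ginv (gid G (gsrc g))) = g.
  have gi : grng (gid G (gsrc g)) = gsrc g by rewrite grng_id.
  by rewrite -{1}[g]gmul1r gmulKr// gi.
by rewrite -gg (kernE fs gs) (kernE hs gs) fh.
Qed.

Lemma regular_fun_superset f (x : G -> R[i]) g (s : seq G) : uniq s ->
  {in s, forall k, gsrc k = gsrc g} -> (forall k, k \notin s -> kern f g k = 0) ->
  regular_fun f x g = \sum_(k <- s) kern f g k * x k.
Proof.
move=> us sg sn; rewrite /regular_fun (@fsbigE _ _ _ _ _ s)//; last first.
  by move=> k _ /sn ->; rewrite mul0r.
rewrite big_seq_cond [RHS]big_seq; apply: eq_bigl => k.
by rewrite andb_idr// => /sg kg; exact: mem_set.
Qed.

(** A finitely supported sum is additive only once the supports are known to be finite; finite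
    propagation provides a common list for both rows. *)
Lemma convolution_linl m n a f f' h : finite_propagation m f -> finite_propagation n f' ->
  is_section h ->
  convolution (section_lin a f f') h = section_lin a (convolution f h) (convolution f' h).
Proof.
move=> fp fp' hs; have [fs _ _] := fp; have [fs' _ _] := fp'.
apply: section_kern_ext; first exact: convolution_section.
  by apply: lin_section; exact: convolution_section.
move=> g k gk; rewrite kern_lin; [|exact: convolution_section..].
rewrite !kern_conv//; last exact: lin_section.
have [s [us sg sn _]] := regular_fun_row g fp; have [t [ut tg tn _]] := regular_fun_row g fp'.
pose r := undup (s ++ t).
have rg : {in r, forall l, gsrc l = gsrc g}.
  by move=> l; rewrite mem_undup mem_cat => /orP[/sg|/tg].
have rs l : l \notin r -> kern f g l = 0.
  by rewrite mem_undup mem_cat negb_or => /andP[/sn].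
have rt l : l \notin r -> kern f' g l = 0.
  by rewrite mem_undup mem_cat negb_or => /andP[_ /tn].
have key f0 : (forall l, l \notin r -> kern f0 g l = 0) ->
    \sum_(l \in [set l | gsrc l = gsrc g]) kern f0 g l * kern h l k =
    \sum_(l <- r) kern f0 g l * kern h l k.
  by apply: regular_fun_superset; rewrite ?undup_uniq.
rewrite !key// ?mulr_sumr -?big_split /=.
  by apply: eq_bigr => l _; rewrite kern_lin// mulrDl mulrA.
by move=> l lr; rewrite kern_lin// rs// rt// mulr0 addr0.
Qed.

Lemma convolution_linr m a f h h' : finite_propagation m f -> is_section h -> is_section h' ->
  convolution f (section_lin a h h') = section_lin a (convolution f h) (convolution f h').
Proof.
move=> fp hs hs'; have [fs _ _] := fp.
apply: section_kern_ext; first exact: convolution_section.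
  by apply: lin_section; exact: convolution_section.
move=> g k gk; rewrite kern_lin; [|exact: convolution_section..].
rewrite !kern_conv//; last exact: lin_section.
have [s [us sg sn key]] := regular_fun_row g fp.
have {}key h0 : \sum_(l \in [set l | gsrc l = gsrc g]) kern f g l * kern h0 l k =
    \sum_(l <- s) kern f g l * kern h0 l k by exact: key.
rewrite !key mulr_sumr -big_split; apply: eq_bigr => l _ /=.
by rewrite kern_lin// mulrDr mulrCA.
Qed.

Lemma involution_lin a f h : is_section f -> is_section h ->
  involution (section_lin a f h) = section_lin (Num.conj a) (involution f) (involution h).
Proof.
move=> fs hs; have fs' := involution_section fs; have hs' := involution_section hs.
apply: section_kern_ext; [exact/involution_section/lin_section|exact: lin_section|].
move=> g k gk; rewrite kern_star ?kern_lin ?kern_star//; last exact: lin_section.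
by rewrite rmorphD rmorphM.
Qed.

Lemma convolution_zerol h : is_section h -> convolution (fell_zero E) h = fell_zero E.
Proof.
move=> hs; have zs := zero_section.
have z0 g k : gsrc g = gsrc k -> kern (fell_zero E) g k = 0.
  by move=> gk; apply: rnorm0_eq0; rewrite kern_norm// fell_zero_norm.
apply: section_kern_ext => //; first exact: convolution_section.
move=> g k gk; rewrite kern_conv// z0//; apply: fsbig1 => l /= lg.
by rewrite z0 ?mul0r.
Qed.

Lemma convolution_zeror f : is_section f -> convolution f (fell_zero E) = fell_zero E.
Proof.
move=> hs; have zs := zero_section.
have z0 g k : gsrc g = gsrc k -> kern (fell_zero E) g k = 0.
  by move=> gk; apply: rnorm0_eq0; rewrite kern_norm// fell_zero_norm.
apply: section_kern_ext => //; first exact: convolution_section.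
move=> g k gk; rewrite kern_conv// z0//; apply: fsbig1 => l /= lg.
by rewrite [kern _ l k]z0 ?mulr0// lg.
Qed.

Lemma involution_zero : involution (fell_zero E) = fell_zero E.
Proof.
have zs := zero_section.
have z0 g k : gsrc g = gsrc k -> kern (fell_zero E) g k = 0.
  by move=> gk; apply: rnorm0_eq0; rewrite kern_norm// fell_zero_norm.
apply: section_kern_ext => //; first exact: involution_section.
by move=> g k gk; rewrite kern_star// !z0 ?rmorph0.
Qed.

(* When [f] is supported in a set on which the range map is injective, at most
   one factorization contributes to the convolution. *)
Lemma convolution_range_inj V f h g : is_section f -> is_section h ->
  set_inj V (@grng X G) -> nonzero_set f `<=` V ->
  (forall a, V a -> grng a = grng g ->
     convolution f h g = fell_mul (f a) (h (gmul (ginv a) g))) /\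
  ((forall a, V a -> grng a <> grng g) -> convolution f h g = fell_zero E g).
Proof.
move=> fs hs Vi fV.
have fn a : ~ V a -> coord_fun f a = 0.
  move=> Va; apply/coord_eq0 => //; apply: contrapT => fa; exact/Va/fV.
have coord0 a b t : coord_fun f a = 0 -> gsrc a = grng b -> tw_proj t = gmul a b ->
    fell_coord t (fell_mul (f a) (h b)) = 0.
  move=> fa ab tab; apply: rnorm0_eq0; rewrite fell_norm_coord.
    by rewrite fell_norm_mul (coord_funE a fs) fa fell_norm_class rnorm0 mul0r.
  by rewrite fell_proj_mul ?fs ?hs.
split=> [a Va ag|no].
  set b := gmul (ginv a) g.
  have ab : gsrc a = grng b by rewrite grng_mul ?grng_inv ?gsrc_inv.
  have abg : gmul a b = g by rewrite gmullK.
  rewrite /convolution /fell_sum (@fsbigE _ _ _ _ _ [:: (a, b)])//.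
  - rewrite big_cons big_nil mem_set//= addr0 fell_coordK// tw_liftK.
    by rewrite fell_proj_mul ?fs ?hs.
  - by move=> p /=; rewrite inE => /eqP ->.
  - move=> [a' b'] /= [ab' abg']; rewrite inE => ne.
    apply: coord0 => //; last by rewrite tw_liftK abg'.
    apply: fn => Va'; move/negP: ne; apply; apply/eqP.
    have aa' : a' = a.
      by apply: Vi; [exact: mem_set..|]; rewrite ag -abg' grng_mul.
    by rewrite /b -abg' -aa' gmulKl.
rewrite /convolution /fell_sum fsbig1// => -[a b] /= [ab abg].
apply: coord0 => //; last by rewrite tw_liftK abg.
by apply: fn => Va; apply: (no a Va); rewrite -abg grng_mul.
Qed.

End Sections.

Section ContinuousSections.
Variables (R : realType) (X : topologicalType) (G : topGroupoid X).
Variable E : twist R G.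
Local Notation L := (fell E).
Local Notation tlift := (tw_lift E).
Implicit Types (f h : G -> L) (g : G) (U V W : set G).

(** [elementary_section] with its open set named and the subspace topology unfolded into conditions
    at the points of [U]. *)
Definition elementary_on U f :=
  [/\ is_section f, open U /\ relatively_hausdorff U,
      forall x, U x -> {for x, continuous f}, nonzero_set f `<=` U
    & compact (closure (nonzero_set f) `&` U)].

Lemma elementary_sectionP f : elementary_section f <-> exists U, elementary_on U f.
Proof.
split=> [[fs [U [Uo Uh Uc fU fc]]]|[U [fs [Uo Uh] Uc fU fc]]].
  exists U; split=> //; first by split=> //; exact/hausdorff_subspaceP.
  move: Uc; rewrite continuous_open_subspace// => Uc x Ux.
  by apply: Uc; exact: mem_set.
split=> //; exists U; split=> //; first exact/hausdorff_subspaceP.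
by rewrite continuous_open_subspace// => x /set_mem; exact: Uc.
Qed.

Lemma section_mul_continuous (c : G -> R[i]) f g :
  {for g, continuous c} -> {for g, continuous f} -> {for g, continuous (section_mul c f)}.
Proof.
move=> cc fc W /fell_scale_nbhs[C [A [Cc Af CA]]].
have Cc' : nbhs g (c @^-1` C) := cc C Cc.
have Af' : nbhs g (f @^-1` A) := fc A Af.
by apply: filterS (filterI Cc' Af') => k [? ?]; exact: CA.
Qed.

Lemma elementary_mul U f (c : G -> R[i]) : elementary_on U f ->
  (forall x, U x -> {for x, continuous c}) -> elementary_on U (section_mul c f).
Proof.
move=> [fs Uo Uc fU fc] cc; have sub := nonzero_mul (c := c) fs; split=> //.
- exact: mul_section.
- by move=> x Ux; apply: section_mul_continuous; [exact: cc|exact: Uc].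
- by move=> x /sub[_ /fU].
have -> : closure (nonzero_set (section_mul c f)) `&` U =
    (closure (nonzero_set f) `&` U) `&` closure (nonzero_set (section_mul c f)).
  apply/seteqP; split=> [x [xc Ux]|x [[_ Ux] xc]]; last by [].
  by split=> //; split=> //; apply: closure_subset xc => y /sub[].
by apply: compact_closedI => //; exact: closed_closure.
Qed.

(** Unlike in [elementary_mul], the carrier shrinks to [V]; the closure in [V] of the nonzero set
    stays in [C], which is closed relative to [U]. *)
Lemma elementary_bump U V C f (c : G -> R[i]) : elementary_on U f -> open V -> V `<=` U ->
  compact C -> C `<=` V -> (forall x, ~ C x -> c x = 0) ->
  (forall x, U x -> {for x, continuous c}) -> elementary_on V (section_mul c f).
Proof.
move=> [fs [Uo Uh] Uc fU fc] Vo VU Cc CV c0 cc; have sub := nonzero_mul (c := c) fs.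
have subC : nonzero_set (section_mul c f) `<=` C.
  by move=> x /sub[cx _]; apply: contrapT => /c0.
split.
- exact: mul_section.
- by split=> // x y Vx Vy; apply: Uh; exact: VU.
- by move=> x /VU Ux; apply: section_mul_continuous; [exact: cc|exact: Uc].
- exact: subset_trans subC CV.
have -> : closure (nonzero_set (section_mul c f)) `&` V =
    C `&` closure (nonzero_set (section_mul c f)).
  apply/seteqP; split=> [x [xc Vx]|x [Cx xc]]; last by split=> //; exact: CV.
  split=> //; apply: (compact_relatively_closed Uh Cc (subset_trans CV VU)); first exact: VU.
  exact: closure_subset xc.
by apply: compact_closedI => //; exact: closed_closure.
Qed.

Lemma fell_sum_ord n g (F : 'I_n -> L) :
  fell_sum g [set: 'I_n] F = fell_class (tlift g) (\sum_(k < n) fell_coord (tlift g) (F k)).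
Proof.
congr fell_class; rewrite (@fsbigE _ _ _ _ _ (index_enum 'I_n)) ?index_enum_uniq//.
  by apply: eq_bigl => k; rewrite mem_set.
by move=> k _; rewrite mem_index_enum.
Qed.

Lemma CcP f : Cc f <-> exists n (c : 'I_n -> R[i]) (h : 'I_n -> G -> L),
  (forall k, elementary_section (h k)) /\
  forall g, f g = fell_class (tlift g) (\sum_(k < n) c k * coord_fun (h k) g).
Proof.
have key n (c : 'I_n -> R[i]) (h : 'I_n -> G -> L) g : (forall k, elementary_section (h k)) ->
    fell_sum g [set: 'I_n] (fun k => fell_scale (c k) (h k g)) =
    fell_class (tlift g) (\sum_(k < n) c k * coord_fun (h k) g).
  move=> hE; rewrite fell_sum_ord; congr fell_class; apply: eq_bigr => k _.
  have [hs _] := hE k; exact: (@coord_mul _ _ _ _ (fun=> c k) (h k) g hs).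
by split=> -[n [c [h [hE fE]]]]; exists n, c, h; split=> // g; rewrite fE key.
Qed.

Lemma Cc_section f : Cc f -> is_section f.
Proof. by move=> /CcP[n [c [h [_ fE]]]] g; rewrite fE fell_proj_class tw_liftK. Qed.

Lemma Cc_zero : Cc (fell_zero E).
Proof.
apply/CcP; exists 0%N, (fun=> 0), (fun=> fell_zero E); split=> [[]//|g].
by rewrite big_ord0.
Qed.

Lemma Cc_lin a f h : Cc f -> Cc h -> Cc (section_lin a f h).
Proof.
move=> Cf Ch; have fs := Cc_section Cf; have hs := Cc_section Ch.
move/CcP: Cf => [n [c [u [uE fE]]]]; move/CcP: Ch => [m [d [v [vE hE]]]].
apply/CcP; exists (n + m)%N.
exists (fun k : 'I_(n + m) => match fintype.split k with inl i => a * c i | inr j => d j end).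
exists (fun k : 'I_(n + m) => match fintype.split k with inl i => u i | inr j => v j end).
split=> [k|g]; first by case: fintype.split.
rewrite (coord_funE g (lin_section a fs hs)) coord_lin//.
rewrite /coord_fun fE hE !fell_coord_class big_split_ord /=; congr (fell_class _ (_ + _)).
  rewrite mulr_sumr; apply: eq_bigr => i _.
  by rewrite (unsplitK (inl i)) mulrA.
by apply: eq_bigr => j _; rewrite (unsplitK (inr j)).
Qed.

Lemma Cc_elementary f : elementary_section f -> Cc f.
Proof.
move=> fE; apply/CcP; exists 1%N, (fun=> 1), (fun=> f); split=> // g.
by rewrite big_ord1 mul1r -coord_funE//; case: fE.
Qed.

Lemma Cc_ind (P : (G -> L) -> Prop) : P (fell_zero E) ->
  (forall a f h, elementary_section f -> Cc h -> P h -> P (section_lin a f h)) ->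
  forall f, Cc f -> P f.
Proof.
move=> P0 Pl f /CcP[n]; elim: n f => [|n IH] f [c [h [hE fE]]].
  suff -> : f = fell_zero E by [].
  by apply/funext => g; rewrite fE big_ord0.
pose f' g := fell_class (tlift g)
  (\sum_(k < n) c (lift ord0 k) * coord_fun (h (lift ord0 k)) g).
have f'E : exists (c : 'I_n -> R[i]) (h : 'I_n -> G -> L),
    (forall k, elementary_section (h k)) /\
    forall g, f' g = fell_class (tlift g) (\sum_(k < n) c k * coord_fun (h k) g).
  by exists (fun k => c (lift ord0 k)), (fun k => h (lift ord0 k)).
have f'C : Cc f' by apply/CcP; exists n.
have [hs0 _] := hE ord0; have fs' := Cc_section f'C.
have -> : f = section_lin (c ord0) (h ord0) f'.
  apply: section_ext; last 1 first.
  - by move=> g; rewrite coord_lin// /coord_fun fE !fell_coord_class big_ord_recl.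
  - by move=> g; rewrite fE fell_proj_class tw_liftK.
  - exact: lin_section.
by apply: Pl => //; exact: IH.
Qed.

Lemma Cc_compact_support f : Cc f -> exists K, compact K /\ nonzero_set f `<=` K.
Proof.
move: f; apply: Cc_ind; first by exists set0; split; [exact: compact0|move=> g []].
move=> a f h [fs [U [Uo Uh Uc fU fc]]] Ch [K [Kc hK]].
exists ((closure (nonzero_set f) `&` U) `|` K); split; first exact: compactU.
move=> g /(nonzero_lin fs (Cc_section Ch))[fg|/hK]; last by right.
by left; split; [exact: subset_closure|exact: fU].
Qed.

Lemma nonzero_involution f :
  nonzero_set (involution f) `<=` @ginv X G @^-1` (nonzero_set f).
Proof.
move=> g /= ng f0; apply: ng; rewrite /involution f0 fell_star_class rmorph0.
by rewrite -(fell_zeroE (g := g))// tw_projV tw_liftK ginvK.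
Qed.

Lemma elementary_involution U f : elementary_on U f ->
  elementary_on (@ginv X G @^-1` U) (involution f).
Proof.
move=> [fs [Uo Uh] Uc fU fc]; have ic := @ginv_continuous X G.
have nz := @nonzero_involution f.
split.
- exact: involution_section.
- split; first by apply: open_comp => // k _; exact: ic.
  move=> x y Ux Uy xy; rewrite -(ginvK x) -(ginvK y); congr ginv; apply: Uh => // A B Ax By.
  have [z [Az Bz]] := xy _ _ (ic x A Ax) (ic y B By).
  by exists (ginv z).
- move=> x Ux W Wx; have := Uc _ Ux _ (fell_star_continuous Wx).
  exact: (ic x).
- by move=> g /nz/fU.
have -> : closure (nonzero_set (involution f)) `&` (@ginv X G @^-1` U) =
    (@ginv X G @` (closure (nonzero_set f) `&` U)) `&` closure (nonzero_set (involution f)).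
  apply/seteqP; split=> [g [gc Ug]|_ [[g [gc Ug] <-] igc]]; last first.
    by split=> //=; rewrite ginvK.
  split=> //; exists (ginv g); last by rewrite ginvK.
  split=> // B Bg; have [k [/nz nk Bk]] := gc _ (ic g B Bg).
  by exists (ginv k).
apply: compact_closedI; last exact: closed_closure.
by apply: continuous_compact => //; exact: continuous_subspaceT.
Qed.

Lemma Cc_involution f : Cc f -> Cc (involution f).
Proof.
move: f; apply: Cc_ind; first by rewrite involution_zero; exact: Cc_zero.
move=> a f h fE Ch Ch'; have [fs _] := fE.
rewrite involution_lin//; last exact: Cc_section.
apply: Cc_lin => //; apply: Cc_elementary; apply/elementary_sectionP.
move/elementary_sectionP: fE => [U fU]; exists (@ginv X G @^-1` U).
exact: elementary_involution.
Qed.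

Hypotheses (etG : etale G) (hausX : hausdorff_space X) (lcX : locally_compact [set: X]).

Lemma Cc_propagation f : Cc f -> exists m, finite_propagation m f.
Proof.
move=> Cf; have [K [Kc fK]] := Cc_compact_support Cf.
exact: (compact_support_propagation etG (Cc_section Cf) Kc fK).
Qed.

Definition bump_on U (theta : G -> R) := exists V C,
  [/\ bisection V, V `<=` U, compact C, C `<=` V &
    (forall x, ~ C x -> theta x = 0) /\ forall x, U x -> {for x, continuous theta}].

(** That some bump equals 1 at each point of [K] makes the product of the 1 - theta_k vanish there;
    no division by a sum of bumps occurs. *)
Lemma bump_cover U K : open U -> relatively_hausdorff U -> compact K -> K `<=` U ->
  exists n (theta : nat -> G -> R), (forall k, (k < n)%N -> bump_on U (theta k)) /\
    forall x, K x -> exists2 k, (k < n)%N & theta k x = 1.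
Proof.
move=> Uo Uh Kc KU; pose Q (N : set G) := exists n (theta : nat -> G -> R),
  (forall k, (k < n)%N -> bump_on U (theta k)) /\
  forall x, N x -> exists2 k, (k < n)%N & theta k x = 1.
apply: (compact_induction (P := Q) _ _ _ Kc).
- by exists 0%N, (fun=> fun=> 0); split.
- by move=> A B AB [n [theta [h1 h2]]]; exists n, theta; split=> // x /AB; exact: h2.
- move=> A B [n [theta [h1 h2]]] [m [eta [k1 k2]]].
  exists (n + m)%N, (fun k => if (k < n)%N then theta k else eta (k - n)%N); split=> [k knm|x].
    case: ltnP => kn; first exact: h1.
    by apply: k1; rewrite ltn_subLR.
  case=> [/h2[k kn kx]|/k2[k km kx]].
    by exists k; [exact: ltn_addr|rewrite kn].
  exists (n + k)%N; first by rewrite ltn_add2l.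
  by rewrite ltnNge leq_addr /= addKn.
move=> x Kx; have Ux := KU x Kx.
have [|V [Vb Vx VU]] := bisection_exists etG (g := x) (U := U).
  exact: open_nbhs_nbhs.
have [theta [C [W [Cc CV [Wx WC] W1 [th0 thc]]]]] := bump_exists etG R hausX lcX Vb Vx.
exists W => //; exists 1%N, (fun=> theta); split=> [k _|y Wy]; last by exists 0%N => //; exact: W1.
exists V, C; split=> //; split=> //.
exact: bump_continuous Uo Uh VU Cc CV th0 thc.
Qed.

Lemma realC_continuous (r : R) (W : set R[i]) : nbhs (r%:C) W -> nbhs r [set s : R | W s%:C].
Proof.
move=> /rnbhsP[e e0 eW]; apply/nbhs_ballP; exists e => //= s.
by rewrite /ball /= => rs; apply: eW; rewrite -rmorphB rnorm_real.
Qed.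

(* The partition of unity [theta_k * prod_(j > k) (1 - theta_j)], applied one
   factor at a time. *)
Lemma elementary_partition (P : (G -> L) -> Prop) : P (fell_zero E) ->
  (forall f h, is_section f -> is_section h -> elementary_section f -> elementary_section h ->
     P f -> P h -> P (section_lin 1 f h)) ->
  (forall V f, bisection V -> elementary_on V f -> P f) ->
  forall f, elementary_section f -> P f.
Proof.
move=> P0 Pl Pb f /elementary_sectionP[U fU]; have [fs [Uo Uh] _ fsub fc] := fU.
have [|n [theta [good cover]]] := bump_cover Uo Uh fc; first by move=> x [].
have {}cover x : nonzero_set f x -> exists2 k, (k < n)%N & theta k x = 1.
  by move=> fx; apply: cover; split; [exact: subset_closure|exact: fsub].
(* The section is generalized: multiplying it by 1 - theta_n removes the points where the last bump
   is 1, so the remaining bumps cover what is left. *)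
elim: n f fU {fs fsub fc} good cover => [|n IH] f fU good cover.
  suff -> : f = fell_zero E by [].
  apply/funext => g; apply: contrapT => fg.
  by have [] := cover g fg.
have [fs _ _ _ _] := fU.
have [V [C [Vb VU Cc CV [th0 thc]]]] := good n (ltnSn n).
pose c1 x := (theta n x)%:C; pose c2 x := (1 - theta n x)%:C.
have c1c x : U x -> {for x, continuous c1}.
  by move=> Ux W /realC_continuous; exact: thc.
have c2c x : U x -> {for x, continuous c2}.
  move=> Ux W /realC_continuous; have : {for x, continuous (fun y => 1 - theta n y)}.
    by apply: cvgB; [exact: cvg_cst|exact: thc].
  exact.
have f1 : elementary_on V (section_mul c1 f).
  apply: (elementary_bump fU _ VU Cc CV _ c1c); first by case: Vb.
  by move=> x /th0; rewrite /c1 => ->; rewrite rmorph0.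
have f2 : elementary_on U (section_mul c2 f) by apply: elementary_mul.
have -> : f = section_lin 1 (section_mul c1 f) (section_mul c2 f).
  apply: section_ext => //; first by apply: lin_section; exact: mul_section.
  move=> g; rewrite coord_lin ?coord_mul//; try exact: mul_section.
  by rewrite mul1r -mulrDl /c1 /c2 -rmorphD addrC subrK rmorph1 mul1r.
apply: Pl; [exact: mul_section|exact: mul_section|by apply/elementary_sectionP; exists V
  |by apply/elementary_sectionP; exists U|exact: Pb f1|].
apply: IH f2 _ _ => [k kn|x /(nonzero_mul fs)[cx fx]]; first exact/good/ltnW.
have [k kn kx] := cover x fx; exists k => //.
move: kn; rewrite ltnS leq_eqVlt => /predU1P[kn|//].
by case: cx; rewrite /c2 -kn kx subrr rmorph0.
Qed.

(** [alpha g] is the arrow of [V] with the range of [g]: the range map followed by its local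
    inverse, which is continuous because the range map is open. *)
Lemma bisection_section V : open V -> set_inj V (@grng X G) -> exists alpha : G -> G,
  [/\ forall a g, V a -> grng a = grng g -> alpha g = a,
      open (@grng X G @^-1` (@grng X G @` V))
    & forall g, (@grng X G @` V) (grng g) ->
        [/\ V (alpha g), grng (alpha g) = grng g & {for g, continuous alpha}]].
Proof.
move=> Vo Vi.
have /choice[alpha alphaP] g : exists a, forall b, V b -> grng b = grng g -> V a /\ grng a = grng g.
  have [[b [Vb bg]]|no] := pselect (exists b, V b /\ grng b = grng g).
    by exists b.
  by exists g => b Vb bg; case: no; exists b.
have alphaE a g : V a -> grng a = grng g -> alpha g = a.
  move=> Va ag; have [Vg gE] := alphaP g a Va ag.
  by apply: Vi; [exact: mem_set..|rewrite gE].
exists alpha; split=> //.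
  by apply: open_comp; [move=> g _; exact: grng_continuous|exact: grng_open].
move=> g [a Va ag]; have -> := alphaE a g Va ag; split=> // W.
rewrite (alphaE a g Va ag) => Wa.
have o : open (@grng X G @` (V `&` interior W)).
  by apply: grng_open => //; apply: openI => //; exact: open_interior.
have : nbhs g (@grng X G @^-1` (@grng X G @` (V `&` interior W))).
  by apply: grng_continuous; apply: open_nbhs_nbhs; split=> //; exists a.
apply: filterS => k [b [Vb Wb] bk] /=.
by rewrite (alphaE b k Vb bk); exact: interior_subset.
Qed.

Lemma quotient_continuous_at (alpha : G -> G) g : {for g, continuous alpha} ->
  grng (alpha g) = grng g -> (\forall k \near g, grng (alpha k) = grng k) ->
  {for g, continuous (fun k => gmul (ginv (alpha k)) k)}.
Proof.
move=> ac ag near_ag W Wg.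
have [|A [B [Aa Bg AB]]] := gmul_nbhs _ Wg; first by rewrite gsrc_inv.
have Aa' : nbhs g (alpha @^-1` (@ginv X G @^-1` A)) := ac _ (ginv_continuous Aa).
apply: filterS (filterI near_ag (filterI Aa' Bg)) => k [ak [Ak Bk]].
by apply: AB => //; rewrite gsrc_inv.
Qed.

Lemma bisection_factor V : open V -> set_inj V (@grng X G) -> exists alpha beta : G -> G,
  let D := @grng X G @^-1` (@grng X G @` V) in
  [/\ forall a g, V a -> grng a = grng g -> alpha g = a /\ beta g = gmul (ginv a) g,
      open D,
      forall g, D g -> [/\ V (alpha g), gsrc (alpha g) = grng (beta g),
        gmul (alpha g) (beta g) = g, {for g, continuous alpha} & {for g, continuous beta}]
    & forall f h, is_section f -> is_section h -> nonzero_set f `<=` V ->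
      (forall g, D g -> convolution f h g = fell_mul (f (alpha g)) (h (beta g))) /\
      (forall g, nonzero_set (convolution f h) g ->
         [/\ D g, nonzero_set f (alpha g) & nonzero_set h (beta g)])].
Proof.
move=> Vo Vr; have [alpha [alphaE Do alphaP]] := bisection_section Vo Vr.
pose beta g := gmul (ginv (alpha g)) g; exists alpha, beta; set D := _ @^-1` _ in Do *.
have ab g : D g -> gsrc (alpha g) = grng (beta g).
  by move=> /alphaP[_ rk _]; rewrite /beta grng_mul ?gsrc_inv// grng_inv.
have facE g : D g -> gmul (alpha g) (beta g) = g.
  by move=> /alphaP[_ rg _]; rewrite gmullK.
split=> //.
- by move=> a g Va ag; rewrite /beta (alphaE a).
- move=> g Dg; have [Vg rg ac] := alphaP g Dg; split=> //; [exact: ab|exact: facE|].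
  apply: quotient_continuous_at => //; have : nbhs g D by exact: open_nbhs_nbhs.
  by apply: filterS => k /alphaP[].
move=> f h fs hs fV.
have convE g : D g -> convolution f h g = fell_mul (f (alpha g)) (h (beta g)).
  move=> Dg; have [Vg rg _] := alphaP g Dg.
  by have [fg _] := convolution_range_inj g fs hs Vr fV; exact: fg.
split=> // g; have [Dg|nD] := pselect (D g); last first.
  have [_ zE] := convolution_range_inj g fs hs Vr fV.
  by move=> ng; case: ng; apply: zE => a Va ag; apply: nD; exists a.
rewrite /nonzero_set /= convE// => ng.
have n0 : fell_norm (fell_mul (f (alpha g)) (h (beta g))) <> 0.
  by move=> /fell_norm0; rewrite fell_proj_mul ?fs ?hs ?ab// facE.
split=> // z; apply: n0; rewrite fell_norm_mul z fell_zero_norm ?mul0r ?mulr0//.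
Qed.

Lemma elementary_convolution V W f h : bisection V -> bisection W ->
  elementary_on V f -> elementary_on W h -> elementary_section (convolution f h).
Proof.
move=> [Vo Vs Vr] [Wo Ws Wr] [fs _ fcont fV fc] [hs _ hcont hW hc].
have [alpha [beta /=]] := bisection_factor Vo Vr; set D := _ @^-1` _.
move=> [abE Do abP /(_ f h fs hs fV)[convE nzP]].
(* This is the product set of the two bisections; it is open and the source map is injective on it,
   hence it is Hausdorff and can carry the convolution. *)
pose VW := D `&` beta @^-1` W.
have VWo : open VW.
  rewrite openE => g [Dg Wg]; have [_ _ _ _ bc] := abP g Dg.
  by apply: filterI; [exact: open_nbhs_nbhs|apply: bc; exact: open_nbhs_nbhs].
have VWs : set_inj VW (@gsrc X G).
  move=> g g' /set_mem[Dg Wg] /set_mem[Dg' Wg'] gg'.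
  have [Vg ab gE _ _] := abP g Dg; have [Vg' ab' gE' _ _] := abP g' Dg'.
  have bb : beta g = beta g'.
    apply: Ws; [exact: mem_set..|].
    by move: gg'; rewrite -{1}gE -{1}gE' !gsrc_mul.
  have aa : alpha g = alpha g'.
    by apply: Vs; [exact: mem_set..|rewrite ab ab' bb].
  by rewrite -gE -gE' aa bb.
pose C := [set gmul p.1 p.2 | p in [set p : G * G |
  [/\ (closure (nonzero_set f) `&` V) p.1, (closure (nonzero_set h) `&` W) p.2
    & gsrc p.1 = grng p.2]]].
have Cc : compact C by exact: compact_composable.
have CVW : C `<=` VW.
  move=> _ [[a b] /= [[_ Va] [_ Wb] ab] <-].
  have rab : grng a = grng (gmul a b) by rewrite grng_mul.
  split; first by exists a.
  by have [_ /= ->] := abE a _ Va rab; rewrite gmulKl.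
have nzC : nonzero_set (convolution f h) `<=` C.
  move=> g /nzP[Dg fa hb]; have [Vg ab gE _ _] := abP g Dg.
  exists (alpha g, beta g) => //; split=> //=; split=> //; first exact: subset_closure.
    exact: subset_closure.
  exact: hW.
have VWh : relatively_hausdorff VW.
  by apply: (injective_relatively_hausdorff hausX _ VWs); exact: gsrc_continuous.
apply/elementary_sectionP; exists VW; split=> //.
- exact: convolution_section.
- move=> g [Dg Wg] N; have [Vg ab _ ac bc] := abP g Dg.
  rewrite convE// => /fell_mul_nbhs[|A [B [Af Bh AB]]]; first by rewrite fs hs ab.
  have Af' : nbhs g (alpha @^-1` (f @^-1` A)) := ac _ (fcont _ Vg _ Af).
  have Bh' : nbhs g (beta @^-1` (h @^-1` B)) := bc _ (hcont _ Wg _ Bh).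
  have Dn : nbhs g D by exact: open_nbhs_nbhs.
  apply: filterS (filterI Dn (filterI Af' Bh')) => k [Dk [Ak Bk]] /=.
  by have [_ abk _ _ _] := abP k Dk; rewrite convE//; apply: AB => //; rewrite fs hs.
- by move=> g /nzC/CVW.
have -> : closure (nonzero_set (convolution f h)) `&` VW =
    C `&` closure (nonzero_set (convolution f h)).
  apply/seteqP; split=> [g [gc VWg]|g [Cg gc]]; last by split=> //; exact: CVW.
  split=> //; apply: (compact_relatively_closed VWh) => //.
  exact: closure_subset gc.
by apply: compact_closedI => //; exact: closed_closure.
Qed.

(** Additivity in each factor reduces both to sections carried by bisections; propagation bounds
    travel along because additivity was obtained for finite propagation. *)
Lemma Cc_convolution f h : Cc f -> Cc h -> Cc (convolution f h).
Proof.
move=> Cf Ch; have hs := Cc_section Ch.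
move: f Cf; apply: Cc_ind; first by rewrite convolution_zerol//; exact: Cc_zero.
move=> a f f' fE Cf' IH; have Cf := Cc_elementary fE.
have [m fp] := Cc_propagation Cf; have [m' fp'] := Cc_propagation Cf'.
rewrite (convolution_linl a fp fp' hs); apply: Cc_lin => // {f' a m' Cf' fp' IH}.
move: h Ch {hs}; apply: Cc_ind; first by rewrite convolution_zeror; [exact: Cc_zero|case: fp].
move=> a h h' hE Ch' IH; have [hs _] := hE; have hs' := Cc_section Ch'.
rewrite (convolution_linr a fp hs hs'); apply: Cc_lin => // {h' a hs' Ch' IH m fp Cf}.
move: f fE; apply: elementary_partition; first by rewrite convolution_zerol//; exact: Cc_zero.
  move=> f f' fs fs' fE fE' C1 C2.
  have [m fp] := Cc_propagation (Cc_elementary fE).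
  have [m' fp'] := Cc_propagation (Cc_elementary fE').
  by rewrite (convolution_linl _ fp fp' hs); exact: Cc_lin.
move=> V f Vb fV; have fE : elementary_section f by apply/elementary_sectionP; exists V.
have fs : is_section f by case: fE.
have [m fp] := Cc_propagation (Cc_elementary fE).
move: h hE {hs}; apply: elementary_partition; first by rewrite convolution_zeror//; exact: Cc_zero.
  by move=> h h' hs hs' _ _ C1 C2; rewrite (convolution_linr _ fp hs hs'); exact: Cc_lin.
move=> W h Wb hW; apply: Cc_elementary; exact: elementary_convolution Vb Wb fV hW.
Qed.

End ContinuousSections.

(** * Borel sections *)

Section BorelSets.
Variable T : topologicalType.
Implicit Types (A B N : set T).

Definition borel : set (set T) := <<s [set U : set T | open U] >>.

Lemma borel_open A : open A -> borel A.
Proof. by move=> Ao; exact: sub_sigma_algebra. Qed.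

Lemma borelC A : borel A -> borel (~` A).
Proof.
have [_ h _] := smallest_sigma_algebra [set: T] [set U | open U].
by move=> /h; rewrite setTD.
Qed.

Lemma borel_bigcup (F : nat -> set T) : (forall n, borel (F n)) -> borel (\bigcup_n F n).
Proof. by have [_ _] := smallest_sigma_algebra [set: T] [set U | open U]; exact. Qed.

Lemma borel_countable (I : countType) (F : I -> set T) :
  (forall i, borel (F i)) -> borel (\bigcup_i F i).
Proof.
move=> Fb; pose F' n := oapp F set0 (choice.unpickle n).
have -> : \bigcup_i F i = \bigcup_n F' n.
  apply/seteqP; split=> x [i _ xi].
    by exists (choice.pickle i) => //; rewrite /F' choice.pickleK.
  by move: xi; rewrite /F'; case: (choice.unpickle i) => // j xj; exists j.
apply: borel_bigcup => n; rewrite /F'; case: (choice.unpickle n) => //=.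
by apply: borel_open; exact: open0.
Qed.

Lemma borelU A B : borel A -> borel B -> borel (A `|` B).
Proof.
move=> Ab Bb; have -> : A `|` B = \bigcup_(b : bool) (if b then A else B).
  apply/seteqP; split=> x; first by case; [exists true|exists false].
  by case=> -[] _ ?; [left|right].
by apply: borel_countable => -[].
Qed.

Lemma borelI A B : borel A -> borel B -> borel (A `&` B).
Proof.
move=> Ab Bb; rewrite -[A]setCK -[B]setCK -setCU.
by apply: borelC; apply: borelU; exact: borelC.
Qed.

End BorelSets.

Section BorelFunctions.
Implicit Types (S T Z : topologicalType).

Definition borel_on T Z (N : set T) (f : T -> Z) :=
  forall O, open O -> borel (N `&` f @^-1` O).

Lemma borel_onS T Z (M N : set T) (f : T -> Z) : open M -> M `<=` N ->
  borel_on N f -> borel_on M f.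
Proof.
move=> Mo MN fb O Oo; rewrite -(setIidl MN) -setIA.
by apply: borelI; [exact: borel_open|exact: fb].
Qed.

Lemma borel_on_eq T Z (N : set T) (f h : T -> Z) : (forall x, N x -> f x = h x) ->
  borel_on N f -> borel_on N h.
Proof.
move=> fh fb O /fb; congr (borel _).
by apply/seteqP; split=> x [Nx] /=; rewrite fh.
Qed.

Lemma open_preimage_on T Z (N : set T) (f : T -> Z) O : open N ->
  (forall x, N x -> {for x, continuous f}) -> open O -> open (N `&` f @^-1` O).
Proof.
move=> No fc Oo; rewrite openE => x [Nx Ox]; apply: filterI; first exact: open_nbhs_nbhs.
by apply: fc => //; exact: open_nbhs_nbhs.
Qed.

(** The sets with Borel pullback form a sigma-algebra that contains the open sets. *)
Lemma borel_preimage S T (N : set S) (phi : S -> T) A : open N ->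
  (forall x, N x -> {for x, continuous phi}) -> borel A -> borel (N `&` phi @^-1` A).
Proof.
move=> No phic; pose P := [set A : set T | borel (N `&` phi @^-1` A)].
apply: (@smallest_sub _ _ _ P); last first.
  by move=> O Oo; apply: borel_open; exact: open_preimage_on.
split=> [|B Pb|F FP]; rewrite /P /=.
- by rewrite preimage_set0 setI0; apply: borel_open; exact: open0.
- have -> : N `&` phi @^-1` ([set: T] `\` B) = N `&` ~` (N `&` phi @^-1` B).
    by apply/seteqP; split=> x [Nx] /= => [[_ nB]|nB]; split=> //; [case|split=> // Bx; exact: nB].
  by apply: borelI; [exact: borel_open|exact: borelC].
rewrite preimage_bigcup setI_bigcupr; exact: borel_bigcup.
Qed.

Lemma borel_on_precomp S T Z (N : set S) (M : set T) (phi : S -> T) (f : T -> Z) :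
  open N -> (forall x, N x -> {for x, continuous phi}) -> (forall x, N x -> M (phi x)) ->
  borel_on M f -> borel_on N (f \o phi).
Proof.
move=> No phic NM fb O Oo; have -> : N `&` (f \o phi) @^-1` O =
    N `&` phi @^-1` (M `&` f @^-1` O).
  by apply/seteqP; split=> x [Nx] /= => [?|[]//]; do !split=> //; exact: NM.
by apply: borel_preimage => //; exact: fb.
Qed.

Lemma borel_on_postcomp S T Z (N : set S) (M : set T) (f : S -> T) (k : T -> Z) :
  open M -> (forall y, M y -> {for y, continuous k}) -> (forall x, N x -> M (f x)) ->
  borel_on N f -> borel_on N (k \o f).
Proof.
move=> Mo kc NM fb O Oo; have -> : N `&` (k \o f) @^-1` O =
    N `&` f @^-1` (M `&` k @^-1` O).
  by apply/seteqP; split=> x [Nx] /= => [?|[]//]; do !split=> //; exact: NM.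
by apply: fb; exact: open_preimage_on.
Qed.

Variable R : realType.

Lemma complex_countable_base : exists B : rat * rat * rat -> set R[i],
  (forall i, open (B i)) /\ forall z W, nbhs z W -> exists2 i, B i z & B i `<=` W.
Proof.
exists (fun i => [set z | rnorm ((ratr i.1.1 +i* ratr i.1.2)%C - z) < ratr i.2]); split.
  move=> [[p q] r]; rewrite openE => z /= zr.
  apply/rnbhsP; exists (ratr r - rnorm ((ratr p +i* ratr q)%C - z)); first by rewrite subr_gt0.
  move=> y zy /=; rewrite -(subrK z (_ +i* _)%C) -addrA.
  by rewrite (le_lt_trans (rnormD _ _))// -ltrBrDl.
move=> [a b] W /rnbhsP[e e0 eW].
(* A rational radius below e/2 and a rational centre closer than that radius give a ball that
   contains the point and stays within distance e of it. *)
have [r /[!in_itv]/= /andP[r0 re]] : exists r, ratr r \in `]0, (e / 2)[.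
  by apply: rat_in_itvoo; rewrite divr_gt0.
have near (x : R) : exists p, `|ratr p - x| < ratr r / 2.
  have [|p /[!in_itv]/= /andP[p1 p2]] := @rat_in_itvoo R (x - ratr r / 2) (x + ratr r / 2).
    by lra.
  by exists p; rewrite ltr_norml; apply/andP; split; lra.
have [p pa] := near a; have [q qb] := near b.
have zr : rnorm ((ratr p +i* ratr q)%C - (a +i* b)%C) < ratr r.
  rewrite (_ : _ - _ = (ratr p - a) +i* (ratr q - b))%C; last first.
    by apply/eqP; rewrite eq_complex /= !eqxx.
  rewrite /rnorm normc_def /=; set x := ratr p - a in pa *; set y := ratr q - b in qb *.
  have h0 : 0 <= `|x| + `|y| by rewrite addr_ge0.
  apply: (@le_lt_trans _ _ (`|x| + `|y|)); last by lra.
  rewrite -[leRHS]ger0_norm// -sqrtr_sqr ler_wsqrtr//.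
  rewrite -[x ^+ 2](real_normK (num_real x)) -[y ^+ 2](real_normK (num_real y)).
  rewrite sqrrD -addrA lerD2l lerDr.
  by rewrite mulrn_wge0// mulr_ge0.
exists (p, q, r) => // y /= yr; apply: eW.
rewrite -(subrK (ratr p +i* ratr q)%C (_ +i* _)%C) -addrA.
by rewrite (le_lt_trans (rnormD _ _))// rdistC; lra.
Qed.

(* [R[i]] being second countable, [O] pulls back to a countable union of sets
   [P `&` F @^-1` A `&` H @^-1` B] with [P] open and [A], [B] basic open sets. *)
Lemma borel_on_joint T Z (N : set T) (F H : T -> R[i]) (Psi : T -> R[i] -> R[i] -> Z) :
  open N -> borel_on N F -> borel_on N H ->
  (forall x a b W, N x -> nbhs (Psi x a b) W -> exists M A B,
     [/\ nbhs x M, nbhs a A, nbhs b B &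
         forall x' a' b', M x' -> A a' -> B b' -> W (Psi x' a' b')]) ->
  borel_on N (fun x => Psi x (F x) (H x)).
Proof.
move=> No Fb Hb Psic O Oo; have [B [Bo Bn]] := complex_countable_base.
pose P i j := interior [set x | forall a b, B i a -> B j b -> O (Psi x a b)].
have -> : N `&` (fun x => Psi x (F x) (H x)) @^-1` O =
    \bigcup_(ij : (rat * rat * rat) * (rat * rat * rat))
      (P ij.1 ij.2 `&` ((N `&` F @^-1` B ij.1) `&` (N `&` H @^-1` B ij.2))).
  apply/seteqP; split=> [x [Nx /= Ox]|x [[i j] _ /= [Px [[Nx Fx] [_ Hx]]]]]; last first.
    by split=> //=; exact: (interior_subset Px).
  have [|M [A [A' [Mx AF AH MA]]]] := Psic x (F x) (H x) O Nx.
    exact: open_nbhs_nbhs.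
  have [i iF iA] := Bn _ _ AF; have [j jH jA] := Bn _ _ AH.
  exists (i, j) => //=; split=> //.
  rewrite /P; apply: filterS Mx => y My a b ia jb; apply: MA => //; [exact: iA|exact: jA].
apply: borel_countable => -[i j] /=; apply: borelI.
  by apply: borel_open; exact: open_interior.
by apply: borelI; [exact: Fb|exact: Hb].
Qed.

End BorelFunctions.

Section BorelSections.
Variables (R : realType) (X : topologicalType) (G : topGroupoid X).
Variable E : twist R G.
Local Notation L := (fell E).
Implicit Types (f h : G -> L) (g : G) (K U V : set G).

Lemma BcP f : Bc f <-> [/\ is_section f, exists M : R, forall g, fell_norm (f g) <= M,
  borel_on [set: G] f & exists K, compact K /\ nonzero_set f `<=` K].
Proof.
by split=> -[fs fM fb fK]; split=> // O Oo; have := fb O Oo; rewrite setTI.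
Qed.

(** Compactness leaves finitely many of the local pieces, whose union is an open set containing [K];
    off that set [f] is the zero section, which is continuous. *)
Lemma borel_patch f K : compact K -> nonzero_set f `<=` K ->
  (forall x, K x -> exists N, [/\ open N, N x & borel_on N f]) -> borel_on [set: G] f.
Proof.
move=> Kc fK loc.
have [M [Mo KM fM]] : exists M, [/\ open M, K `<=` M & borel_on M f].
  apply: (compact_induction (P := fun A => exists M, [/\ open M, A `<=` M & borel_on M f])
    _ _ _ Kc).
  - exists set0; split; [exact: open0|by []|move=> O _].
    by rewrite set0I; apply: borel_open; exact: open0.
  - by move=> A B AB [M [Mo BM fM]]; exists M; split=> //; exact: subset_trans AB BM.
  - move=> A B [M [Mo AM fM]] [N [No BN fN]]; exists (M `|` N); split; first exact: openU.
      by move=> x [/AM|/BN]; [left|right].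
    by move=> O Oo; rewrite setIUl; apply: borelU; [exact: fM|exact: fN].
  move=> x /loc[N [No Nx fN]]; exists N; first exact: open_nbhs_nbhs.
  by exists N; split.
move=> O Oo; rewrite setTI.
have -> : f @^-1` O = (M `&` f @^-1` O) `|` (~` M `&` fell_zero E @^-1` O).
  have f0 x : ~ M x -> f x = fell_zero E x.
    by move=> Mx; apply: contrapT => fx; apply: Mx; apply: KM; exact: fK.
  apply/seteqP; split=> x /= => [Ox|[[]//|[Mx]]]; last by rewrite f0.
  by have [Mx|Mx] := pselect (M x); [left|right; split=> //; rewrite -f0].
apply: borelU; first exact: fM.
apply: borelI; first by apply: borelC; exact: borel_open.
apply: borel_open; apply: open_comp => // x _; exact: fell_zero_continuous.
Qed.

Lemma borel_coordinate (T : topologicalType) (N : set T) (F : T -> L) (U : set G) (sg : G -> E) :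
  open U -> (forall l, U (fell_proj l) ->
    {for l, continuous (fun l => fell_coord (sg (fell_proj l)) l)}) ->
  (forall x, N x -> U (fell_proj (F x))) -> borel_on N F ->
  borel_on N (fun x => fell_coord (sg (fell_proj (F x))) (F x)).
Proof.
move=> Uo kc NU Fb.
apply: (borel_on_postcomp (M := [set l | U (fell_proj l)])
  (k := fun l => fell_coord (sg (fell_proj l)) l) _ kc NU Fb).
by apply: open_comp => // l _; exact: fell_proj_continuous.
Qed.

Lemma Bc_section f : Bc f -> is_section f. Proof. by case. Qed.

Lemma Bc_zero : Bc (fell_zero E).
Proof.
apply/BcP; split; first exact: zero_section.
- by exists 0 => g; rewrite fell_zero_norm.
- move=> O Oo; apply: borel_open; apply: open_preimage_on => // [|x _].
    exact: openT.
  exact: fell_zero_continuous.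
by exists set0; split; [exact: compact0|move=> g; case].
Qed.

Lemma coord_norm f g : is_section f -> rnorm (coord_fun f g) = fell_norm (f g).
Proof. by move=> fs; rewrite [in RHS](coord_funE g fs) fell_norm_class. Qed.

(** The bundle need not be second countable, so a pair of Borel sections need not be Borel as a map
    to the product. Local coordinates reduce the sum to scalar functions, for which [borel_on_joint]
    is available. *)
Lemma Bc_lin a f h : Bc f -> Bc h -> Bc (section_lin a f h).
Proof.
move=> /BcP[fs [M fM] fb [K [Kc fK]]] /BcP[hs [N hN] hb [K' [Kc' hK]]].
have ls := lin_section a fs hs.
have KU : nonzero_set (section_lin a f h) `<=` K `|` K'.
  by move=> g /(nonzero_lin fs hs)[/fK|/hK]; [left|right].
have KUc : compact (K `|` K') by exact: compactU.
apply/BcP; split=> //; last by exists (K `|` K').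
  exists (rnorm a * M + N) => g; rewrite -coord_norm// coord_lin//.
  rewrite (le_trans (rnormD _ _))// rnormM coord_norm// coord_norm// lerD//.
  by rewrite ler_wpM2l// rnorm_ge0.
apply: (borel_patch KUc KU) => x _.
have [U [sg [Uo Ux sgP sgc kc]]] := local_section E x; exists U; split=> //.
have cb f0 : is_section f0 -> borel_on [set: G] f0 ->
    borel_on U (fun g => fell_coord (sg (fell_proj (f0 g))) (f0 g)).
  move=> f0s f0b; apply: (borel_coordinate Uo kc) => [g Ug|]; first by rewrite f0s.
  exact: borel_onS f0b.
apply: (borel_on_eq _ (borel_on_joint (Psi := fun g x y => fell_class (sg g) (a * x + y))
  Uo (cb f fs fb) (cb h hs hb) _)).
  move=> g Ug; rewrite /section_lin !fs !hs.
  rewrite -[in RHS](@fell_coordK _ _ _ _ (sg g) (f g)) ?fs ?sgP//.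
  rewrite -[in RHS](@fell_coordK _ _ _ _ (sg g) (h g)) ?hs ?sgP//.
  by rewrite fell_scale_class fell_add_class.
move=> g x1 x2 W Ug /fell_prod_nbhs[A [B [Ag Bx AB]]].
have : nbhs (x1, x2) [set p : R[i] * R[i] | B (a * p.1 + p.2)].
  have : continuous (fun p : R[i] * R[i] => a * p.1 + p.2).
    move=> p; apply: cvgD; last exact: cvg_snd.
    by apply: continuous_comp; [exact: cvg_fst|exact: complex_mul_continuous].
  by move=> /(_ (x1, x2) B Bx).
move=> [[B1 B2] /= [B1x B2x] B12].
exists (sg @^-1` A), B1, B2; split=> // [|g' y1 y2 Ag' B1y B2y].
  exact: sgc.
by apply: AB => //; exact: (B12 (y1, y2)).
Qed.

Lemma Bc_involution f : Bc f -> Bc (involution f).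
Proof.
move=> /BcP[fs [M fM] fb [K [Kc fK]]]; apply/BcP; split.
- exact: involution_section.
- exists M => g; rewrite /involution (coord_funE (ginv g) fs) fell_star_class fell_norm_class.
  by rewrite rnormJ coord_norm.
- apply: (borel_on_postcomp (M := [set: L]) (f := f \o @ginv X G) (k := @fell_star R X G E)) => //.
  + exact: openT.
  + by move=> l _; exact: fell_star_continuous.
  apply: (borel_on_precomp (M := [set: G])) => //; first exact: openT.
  by move=> g _; exact: ginv_continuous.
exists (@ginv X G @` K); split.
  by apply: continuous_compact => //; apply: continuous_subspaceT; exact: ginv_continuous.
move=> g /nonzero_involution/fK Kg; exists (ginv g) => //; exact: ginvK.
Qed.

Definition section_restrict (A : set G) f g := if `[< A g >] then f g else fell_zero E g.

Lemma restrict_section A f : is_section f -> is_section (section_restrict A f).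
Proof.
by move=> fs g; rewrite /section_restrict; case: ifP; rewrite ?fs// fell_proj_zero.
Qed.

Lemma nonzero_restrict A f : nonzero_set (section_restrict A f) `<=` A `&` nonzero_set f.
Proof. by move=> g; rewrite /nonzero_set /section_restrict /=; case: asboolP. Qed.

Lemma Bc_restrict A f : borel A -> Bc f -> Bc (section_restrict A f).
Proof.
move=> Ab /BcP[fs [M fM] fb [K [Kc fK]]]; apply/BcP; split.
- exact: restrict_section.
- exists M => g; rewrite /section_restrict; case: ifP => // _.
  by rewrite fell_zero_norm (le_trans _ (fM g))// -coord_norm// rnorm_ge0.
- move=> O Oo; have -> : [set: G] `&` section_restrict A f @^-1` O =
      (A `&` ([set: G] `&` f @^-1` O)) `|` (~` A `&` fell_zero E @^-1` O).
    apply/seteqP; rewrite /section_restrict; split=> g /=; case: asboolP.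
    + by move=> Ag [_ Og]; left.
    + by move=> Ag [_ Og]; right.
    + by move=> Ag [[_ []]|[]].
    by move=> Ag [[]|[]].
  apply: borelU; first by apply: borelI => //; exact: fb.
  apply: borelI; first exact: borelC.
  apply: borel_open; apply: open_comp => // x _; exact: fell_zero_continuous.
by exists K; split=> // g /(@nonzero_restrict A f)[_ /fK].
Qed.

Lemma restrict_lin A f : is_section f ->
  f = section_lin 1 (section_restrict A f) (section_restrict (~` A) f).
Proof.
move=> fs; apply: section_ext => //.
  by apply: lin_section; exact: restrict_section.
move=> g; rewrite coord_lin; [|exact: restrict_section..].
rewrite mul1r /coord_fun /section_restrict asbool_neg; case: asboolP => _ /=.
  by rewrite [X in _ + X]coord_zero addr0.
by rewrite [X in X + _]coord_zero add0r.
Qed.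

Hypotheses (etG : etale G) (hausX : hausdorff_space X) (lcX : locally_compact [set: X]).

Lemma Bc_propagation f : Bc f -> exists m, finite_propagation m f.
Proof.
move=> /BcP[fs _ _ [K [Kc fK]]].
exact: (compact_support_propagation etG fs Kc fK).
Qed.

(** Cutting along an open set and its complement preserves Borel sections, so indicators do the work
    of bumps. [bump_exists] contributes only its sets: a neighbourhood inside a compact subset of a
    bisection. *)
Lemma Bc_partition (P : (G -> L) -> Prop) : P (fell_zero E) ->
  (forall f h, Bc f -> Bc h -> P f -> P h -> P (section_lin 1 f h)) ->
  (forall V C f, bisection V -> compact C -> C `<=` V -> nonzero_set f `<=` C -> Bc f -> P f) ->
  forall f, Bc f -> P f.
Proof.
move=> P0 Pl Pb f Bf; have /BcP[_ _ _ [K [Kc fK]]] := Bf.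
pose Q (A : set G) := exists M, [/\ open M, A `<=` M &
  forall f, Bc f -> nonzero_set f `<=` M -> P f].
suff [M [_ KM MP]] : Q K by apply: MP => //; exact: subset_trans fK KM.
apply: (compact_induction (P := Q) _ _ _ Kc).
- exists set0; split=> [||h Bh h0]; [exact: open0|by []|].
  suff -> : h = fell_zero E by [].
  by apply/funext => g; apply: contrapT => /h0.
- by move=> A B AB [M [Mo BM MP]]; exists M; split=> //; exact: subset_trans AB BM.
- move=> A B [M [Mo AM MP]] [N [No BN NP]]; exists (M `|` N); split; first exact: openU.
    by move=> x [/AM|/BN]; [left|right].
  move=> h Bh hMN; have hs := Bc_section Bh.
  have Mb : borel M by exact: borel_open.
  have Mb' : borel (~` M) by exact: borelC.
  rewrite (restrict_lin M hs); apply: Pl; [exact: Bc_restrict|exact: Bc_restrict| |].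
    by apply: MP; [exact: Bc_restrict|move=> g /(@nonzero_restrict M h)[]].
  by apply: NP; [exact: Bc_restrict|move=> g /(@nonzero_restrict _ h)[Mg /hMN[]]].
move=> x _; have [V [Vb Vx _]] := bisection_exists etG (@filterT _ (nbhs x) _).
have [_ [C [W [Cc CV [Wx WC] _ _]]]] := bump_exists etG R hausX lcX Vb Vx.
exists (interior W); first by apply: open_nbhs_nbhs; split=> //; exact: open_interior.
exists (interior W); split=> //; first exact: open_interior.
move=> h Bh hW; apply: (Pb V C) => //.
by apply: subset_trans hW _; apply: subset_trans WC; exact: interior_subset.
Qed.

(** Only [f] is confined to a bisection: [h] enters through [h (beta g)], and composition with the
    continuous [beta] keeps it Borel. The compact [C] yields a compact set outside which the
    convolution vanishes. *)
Lemma bisection_convolution V C f h : bisection V -> compact C -> C `<=` V ->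
  nonzero_set f `<=` C -> Bc f -> Bc h -> Bc (convolution f h).
Proof.
move=> [Vo _ Vr] Cc CV fC /BcP[fs [M fM] fb _] /BcP[hs [N hN] hb [K [Kc hK]]].
have fV : nonzero_set f `<=` V by exact: subset_trans fC CV.
have [alpha [beta /=]] := bisection_factor E etG Vo Vr; set D := _ @^-1` _.
move=> [abE Do abP /(_ f h fs hs fV)[convE nzP]].
pose C' := [set gmul p.1 p.2 | p in [set p : G * G |
  [/\ C p.1, K p.2 & gsrc p.1 = grng p.2]]].
have Cc' : compact C' by exact: compact_composable.
have convC : nonzero_set (convolution f h) `<=` C'.
  move=> g /nzP[Dg fa hb']; have [_ ab gE _ _] := abP g Dg.
  by exists (alpha g, beta g) => //; split=> //=; [exact: fC|exact: hK].
have CD : C' `<=` D.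
  by move=> _ [[a b] /= [/CV Va _ ab] <-]; exists a => //; rewrite grng_mul.
apply/BcP; split; [exact: convolution_section| | |by exists C'].
  exists (`|M| * `|N|) => g; have [Dg|Dg] := pselect (D g).
    rewrite convE// fell_norm_mul ler_pM//.
    - by rewrite -coord_norm// rnorm_ge0.
    - by rewrite -coord_norm// rnorm_ge0.
    - by rewrite (le_trans (fM _))// ler_norm.
    - by rewrite (le_trans (hN _))// ler_norm.
  suff -> : convolution f h g = fell_zero E g by rewrite fell_zero_norm mulr_ge0.
  by apply: contrapT => /nzP[].
apply: (borel_patch Cc' convC) => x /CD Dx.
have [U1 [s1 [U1o U1x s1P s1c k1c]]] := local_section E (alpha x).
have [U2 [s2 [U2o U2x s2P s2c k2c]]] := local_section E (beta x).
pose M' := (D `&` alpha @^-1` U1) `&` (D `&` beta @^-1` U2).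
have Mo : open M'.
  by apply: openI; apply: open_preimage_on => // g /abP[].
have ac g : M' g -> {for g, continuous alpha} by move=> [[/abP[]]].
have bc g : M' g -> {for g, continuous beta} by move=> [[/abP[]]].
exists M'; split=> //.
have Fb : borel_on M' (fun g => fell_coord (s1 (fell_proj (f (alpha g)))) (f (alpha g))).
  apply: (borel_coordinate (F := f \o alpha) U1o k1c) => [g [[_ Ug] _]|]; first by rewrite /= fs.
  by apply: (borel_on_precomp (M := [set: G])).
have Hb : borel_on M' (fun g => fell_coord (s2 (fell_proj (h (beta g)))) (h (beta g))).
  apply: (borel_coordinate (F := h \o beta) U2o k2c) => [g [_ [_ Ug]]|]; first by rewrite /= hs.
  by apply: (borel_on_precomp (M := [set: G])).
apply: (borel_on_eq _ (borel_on_joint (Psi := fun g x y =>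
  fell_mul (fell_class (s1 (alpha g)) x) (fell_class (s2 (beta g)) y)) Mo Fb Hb _)).
  move=> g [[Dg Ug] [_ Ug']]; rewrite convE// !fs !hs.
  by rewrite !fell_coordK ?s1P ?s2P.
have ab g : M' g -> gsrc (fell_proj (fell_class (s1 (alpha g)) 0)) =
  grng (fell_proj (fell_class (s2 (beta g)) 0)).
  by move=> [[Dg Ug] [_ Ug']]; rewrite !fell_proj_class s1P// s2P//; have [] := abP g Dg.
move=> g a b W Mg; have Un : nbhs g M' by exact: open_nbhs_nbhs.
move=> /fell_mul_nbhs[|A [B [Aa Bb AB]]].
  by move: (ab g Mg); rewrite !fell_proj_class.
have [A1 [A2 [A1g A2a A12]]] := fell_prod_nbhs Aa.
have [B1 [B2 [B1g B2b B12]]] := fell_prod_nbhs Bb.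
have [[_ U1g] [_ U2g]] := Mg.
have A1' : nbhs g (alpha @^-1` (s1 @^-1` A1)) := ac g Mg _ (s1c _ U1g _ A1g).
have B1' : nbhs g (beta @^-1` (s2 @^-1` B1)) := bc g Mg _ (s2c _ U2g _ B1g).
exists (M' `&` (alpha @^-1` (s1 @^-1` A1) `&` beta @^-1` (s2 @^-1` B1))), A2, B2.
split=> // [|g' a' b' [Mg' [Ag' Bg']] Aa' Bb'].
  by apply: filterI => //; exact: filterI.
apply: AB; [exact: A12|exact: B12|].
by move: (ab g' Mg'); rewrite !fell_proj_class.
Qed.

Lemma Bc_convolution f h : Bc f -> Bc h -> Bc (convolution f h).
Proof.
move=> Bf Bh; have hs := Bc_section Bh; move: f Bf; apply: Bc_partition.
- by rewrite convolution_zerol//; exact: Bc_zero.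
- move=> f f' Bf Bf' C1 C2; have [m fp] := Bc_propagation Bf.
  have [m' fp'] := Bc_propagation Bf'.
  by rewrite (convolution_linl _ fp fp' hs); exact: Bc_lin.
by move=> V C f Vb Cc CV fC Bf; exact: bisection_convolution Vb Cc CV fC Bf Bh.
Qed.

End BorelSections.

Theorem theorem1p2 (R : realType) :
  (forall (X : topologicalType) (G : topGroupoid X) (E : twist R G),
     hausdorff_space X -> locally_compact [set: X] ->
     locally_compact_space G -> etale G ->
     (forall (A : cstarAlgType R[i]) (j : (G -> fell E) -> A),
        reduced_completion (@Cc R X G E) j -> controlled_propagation A) /\
     (forall (B : cstarAlgType R[i]) (j : (G -> fell E) -> B),
        reduced_completion (@Bc R X G E) j -> controlled_propagation B)) /\
  (forall (H : hilbertType R[i]) (J : set (bop H)),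
     ~ finite_dimensional H -> closed_ideal J -> J <> setT ->
     forall (Q : cstarAlgType R[i]) (p : bop H -> Q), quotient_algebra J p ->
     uncontrolled_propagation Q /\
     (forall (A : cstarAlgType R[i]), controlled_propagation A ->
        forall phi : Q -> A, star_hom phi -> forall q, phi q = 0)) /\
  (forall A : cstarAlgType R[i], von_neumann_algebra A ->
     controlled_propagation A -> finite_algebra A).
Proof.
split; [|split].
- move=> X G E hausX lcX _ etG; split=> A j jA; apply: (reduced_completion_controlled jA).
  + by move=> f; exact: Cc_propagation.
  + exact: Cc_lin.
  + exact: Cc_convolution.
  + exact: Cc_involution.
  + by move=> f; exact: Bc_propagation.
  + exact: Bc_lin.
  + exact: Bc_convolution.
  + exact: Bc_involution.
- move=> H J Hinf _ J_proper Q p [[pl pM pS] p_onto pJ _].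
  have hom0 (A : cstarAlgType R[i]) : controlled_propagation A ->
      forall phi : Q -> A, star_hom phi -> forall q, phi q = 0.
    move=> [I [rho [[rl rM rS] rho_inj rhoc]]] phi [fl fM fS] q.
    have [x _ <-] : range p q by rewrite p_onto.
    have r0 : rho 0 = 0 by exact: linear0_fun rl.
    apply: rho_inj; rewrite r0.
    (* Everything is pulled back along [p] to a homomorphism on all of B(H), and vanishing is
       detected by the injective [rho]. *)
    apply: (bop_hom_controlled0 (pi := fun x => rho (phi (p x))) Hinf); last first.
      by move=> _ [y _ <-]; apply: rhoc; exists (phi (p y)).
    by split=> [a y z|y z|y]; rewrite ?pl ?fl ?rl ?pM ?fM ?rM ?pS ?fS ?rS.
  (* If [Q] were controlled, its identity map would vanish, so [p = 0] and the ideal would be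
     everything. *)
  split=> // Qc; apply: J_proper; apply/seteqP; split=> // x _; apply/pJ.
  by apply: (hom0 Q Qc id).
- by move=> A; exact: controlled_vN_finite.
Qed.
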